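(* Let $q\ge 2$ be a fixed integer. There is an algorithm which, given a power circuit $\Pi=(\Gamma,\delta)$ (with base $q$) and a list $\mathcal{M}=(M_1,\ldots,M_m)$ of markings in $\Pi$, returns a reduced power circuit $\Pi'=(\Gamma',\delta')$ and a list $\mathcal{M}'=(M_1',\ldots,M_m')$ of markings in $\Pi'$ such that $\varepsilon(M_i)=\varepsilon(M_i')$ for $1\le i\le m$. The algorithm takes $\tilde{\mathcal{O}}(|\Gamma|^2+|\Gamma|\cdot m)$ time, and the size of $\Gamma'$ is bounded by $2|\Gamma|$.
   Context: Fix $q\ge 2$ and let $D=\{-q+1,\ldots,q-1\}$. A graph $\Pi=(\Gamma,\delta)$ consists of a finite set $\Gamma$ of nodes and a map $\delta:\Gamma\times\Gamma\to D$, where $\delta(u,v)=e\ne 0$ means that there is an edge from $u$ to $v$ labelled $e$ and $\delta(u,v)=0$ means there is no edge; the directed graph $(\Gamma,\operatorname{supp}\delta)$ is always assumed acyclic. A marking of $\Pi$ is a map $M:\Gamma\to D$, with support $\operatorname{supp}M$. The successor marking of a node $u$ is $\Lambda_u:\Gamma\to D$, $v\mapsto\delta(u,v)$. Values of nodes and markings are defined inductively by $\varepsilon(\emptyset)=0$ (zero marking), $\varepsilon(M)=\sum_{u\in\operatorname{supp}M}M(u)\varepsilon(u)$ and $\varepsilon(u)=q^{\varepsilon(\Lambda_u)}$. $\Pi$ is a power circuit if $\varepsilon(\Lambda_u)\ge 0$ for all $u\in\Gamma$ (equivalently, all markings have integer values). A reduced power circuit is a power circuit together with a list $(u_1,\ldots,u_n)$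 of its nodes and a bit vector $(b_1,\ldots,b_{n-1})$ such that different nodes have different values, $\varepsilon(u_1)<\cdots<\varepsilon(u_n)$, and $b_i=1$ iff $q\,\varepsilon(u_i)=\varepsilon(u_{i+1})$. $\tilde{\mathcal{O}}$ suppresses logarithmic factors. Time is measured on a random-access machine; $q$ is a constant; graphs are stored with adjacency lists. *)

(* Defs.v *)
From HB Require Import structures.
From mathcomp Require Import all_boot all_order all_algebra.
From mathcomp Require Import reals exp.

Set Implicit Arguments.
Unset Strict Implicit.
Unset Printing Implicit Defensive.

Import Order.TTheory GRing.Theory Num.Theory.
Local Open Scope ring_scope.

(** * Power circuits *)

Definition digit (q : nat) := {x : int | - q%:Z + 1 <= x <= q%:Z - 1}.

Definition marking (q : nat) (V : finType) := V -> digit q.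

Definition supp (q : nat) (V : finType) (M : marking q V) : pred V :=
  [pred u | val (M u) != 0].

(* [cycle e c] says that [c] is a closed walk of [e]; loops are the case
   [size c = 1]. *)
Record pgraph (q : nat) (V : finType) := PGraph {
  delta : V -> V -> digit q;
  delta_acyclic : forall c : seq V,
    cycle [rel u v | val (delta u v) != 0] c -> c = [::]
}.

Definition succ_marking (q : nat) (V : finType) (P : pgraph q V) (u : V) :
  marking q V := delta P u.

Section Values.

Variables (R : realType) (q : nat) (V : finType).

Definition mval (f : V -> R) (M : marking q V) : R :=
  \sum_(u | supp M u) (val (M u))%:~R * f u.

Variable P : pgraph q V.

Definition nval_step (f : V -> R) (u : V) : R :=
  q%:R `^ mval f (succ_marking P u).

(* A walk in an acyclic graph has fewer than #|V| edges, so #|V| rounds reach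
   the solution of the defining recursion, whatever the starting values: see
   [eps_nodeE].  The values are real because the exponents may be negative or
   fractional when P is not a power circuit. *)
Definition eps_node : V -> R := iter #|V| nval_step (fun=> 0).

Definition eps : marking q V -> R := mval eps_node.

Let e : rel V := [rel u v | val (delta P u v) != 0].

Let walk_uniq u p : path e u p -> uniq (u :: p).
Proof.
elim: p u => [//|v p IHp] u pe; have := pe => /= /andP[_ /IHp/= ->].
rewrite andbT; apply/negP => uvp.
move: pe; case/splitPr: {v p IHp} (v :: p) / uvp => p1 p2.
rewrite cat_path /= => /andP[p1e /andP[lu _]].
by have := @delta_acyclic _ _ P (u :: p1); rewrite /= rcons_path p1e => /(_ lu).
Qed.

Let iter_stable j u : (forall p, path e u p -> (size p < j)%N) ->
  forall i, (j <= i)%N ->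
  iter i nval_step (fun=> 0) u = iter j nval_step (fun=> 0) u.
Proof.
elim: j u => [|j IHj] u hu; first by have := hu [::] isT.
case=> // i; rewrite ltnS => ji /=; congr (_ `^ _).
apply: eq_bigr => v uv; congr (_ * _); apply: IHj => // p pv.
by have := hu (v :: p); rewrite /= pv andbT; apply.
Qed.

Lemma eps_nodeE u : eps_node u = q%:R `^ eps (succ_marking P u).
Proof.
rewrite -[RHS]/(iter #|V|.+1 nval_step (fun=> 0) u) [RHS](@iter_stable #|V|) //.
by move=> p /walk_uniq/card_uniqP/= <-; apply: max_card.
Qed.

Definition power_circuit : Prop := forall u, 0 <= eps (succ_marking P u).

(* [us] is the list (u_1, ..., u_n) and [b] the bit vector (b_1, ..., b_(n-1)),
   both indexed from 0 here. *)
Definition reduced (us : seq V) (b : bitseq) : Prop :=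
  [/\ power_circuit,
      perm_eq us (enum V),
      injective eps_node,
      sorted (fun u v => eps_node u < eps_node v) us &
      size b = (size us).-1 /\
      forall (u0 : V) (i : nat), (i.+1 < size us)%N ->
        nth false b i <->
        q%:R * eps_node (nth u0 us i) = eps_node (nth u0 us i.+1)].

End Values.

(** * Random-access machines

    The machine of Cook and Reckhow (Time bounded random access machines, 1973)
    with the logarithmic cost criterion, so that arithmetic on long integers is
    not free.  Register indices and jump targets are 0-based. *)

Inductive instr :=
  | IConst of nat & int         (* X_i := c *)
  | IAdd of nat & nat & nat     (* X_i := X_j + X_k *)
  | ISub of nat & nat & nat     (* X_i := X_j - X_k *)
  | ILoad of nat & nat          (* X_i := X_(X_j) *)
  | IStore of nat & nat         (* X_(X_i) := X_j *)
  | IJpos of nat & nat          (* if X_j > 0 then goto l *)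
  | IRead of nat                (* X_i := next input symbol *)
  | IPrint of nat               (* append X_i to the output *)
  | IHalt.

Definition program := seq instr.

Record config := Config {
  pc : nat;
  regs : nat -> int;
  inp : seq int;
  out : seq int
}.

Definition upd (X : nat -> int) (i : nat) (x : int) : nat -> int :=
  fun j => if j == i then x else X j.

Definition len (x : int) : nat := (trunc_log 2 `|x|).+1.

(* Cost and successor of a configuration.  [None]: halted, or stuck on a
   negative address, an exhausted input or a missing instruction. *)
Definition step (p : program) (s : config) : option (nat * config) :=
  let: Config l X w o := s in
  match onth p l with
  | Some (IConst i c) => Some (len c, Config l.+1 (upd X i c) w o)
  | Some (IAdd i j k) =>
      Some ((len (X j) + len (X k))%N, Config l.+1 (upd X i (X j + X k)) w o)
  | Some (ISub i j k) =>
      Some ((len (X j) + len (X k))%N, Config l.+1 (upd X i (X j - X k)) w o)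
  | Some (ILoad i j) =>
      if X j is Posz a then
        Some ((len (X j) + len (X a))%N, Config l.+1 (upd X i (X a)) w o)
      else None
  | Some (IStore i j) =>
      if X i is Posz a then
        Some ((len (X i) + len (X j))%N, Config l.+1 (upd X a (X j)) w o)
      else None
  | Some (IJpos j l') =>
      Some (len (X j), Config (if 0 < X j then l' else l.+1) X w o)
  | Some (IRead i) =>
      if w is x :: w' then Some (len x, Config l.+1 (upd X i x) w' o) else None
  | Some (IPrint i) => Some (len (X i), Config l.+1 X w (rcons o (X i)))
  | Some IHalt | None => None
  end.

Inductive exec (p : program) : config -> nat -> seq int -> Prop :=
  | exec_halt s : onth p (pc s) = Some IHalt -> exec p s 1 (out s)
  | exec_step s k s' t o :
      step p s = Some (k, s') -> exec p s' t o -> exec p s (k + t) o.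

Definition outputs (p : program) (w : seq int) (t : nat) (o : seq int) : Prop :=
  exec p (Config 0 (fun=> 0) w [::]) t o.

(** * Adjacency-list encodings

    The nodes are 0, ..., n - 1.  A marking, and in particular the successor
    marking of a node, is stored as the number of nodes of its support followed
    by those nodes with their labels, in any order. *)

Definition enc_marking (q n : nat) (M : marking q 'I_n) (w : seq int) : Prop :=
  exists s : seq 'I_n, [/\ uniq s, s =i supp M &
    w = (size s)%:Z :: flatten [seq [:: (nat_of_ord v)%:Z; val (M v)] | v <- s]].

Definition enc_circuit (q n m : nat) (P : pgraph q 'I_n)
    (Ms : 'I_m -> marking q 'I_n) (w : seq int) : Prop :=
  exists (W : 'I_n -> seq int) (Z : 'I_m -> seq int),
    [/\ forall u, enc_marking (succ_marking P u) (W u),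
        forall i, enc_marking (Ms i) (Z i) &
        w = [:: n%:Z, m%:Z & flatten [seq W u | u <- enum 'I_n] ++
                             flatten [seq Z i | i <- enum 'I_m]]].

Definition enc_reduced (q n m : nat) (P : pgraph q 'I_n) (us : seq 'I_n)
    (b : bitseq) (Ms : 'I_m -> marking q 'I_n) (w : seq int) : Prop :=
  exists2 w' : seq int, enc_circuit P Ms w' &
    w = w' ++ [seq (nat_of_ord u)%:Z | u <- us] ++ [seq (nat_of_bool x)%:Z | x <- b].

(* f = O~(g) when f <= soft c k g for some constants c and k. *)
Definition soft (c k g : nat) : nat := (c * (g * (trunc_log 2 g).+1 ^ k))%N.

(* Main.v *)
Require Import Defs.
From HB Require Import structures.
From mathcomp Require Import all_boot all_order all_algebra.
From mathcomp Require Import reals exp.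
From mathcomp Require Import zify ring.

(** Write [n] for the number of nodes and [t u] for the exponent of the node
    [u]; a node is worth [q ^ t u], and [t u] is the value of its successor
    marking.  In a power circuit all these exponents are natural numbers
    ([exponents_exist]), and the task is to sort them without writing them down,
    as they may be towers of powers.

    The circuit that is built has [2n] nodes.  Node [i] carries an exponent
    [t i], no two of them the same, and its successor marking is stored as a row
    of labels whose nonzero entries sit at earlier nodes.  The first [n] nodes
    have the exponents [0, ..., n - 1] and the base-[q] digits of these numbers
    as rows.  Then each input node, in topological order, adds one node.  Its
    successor marking is first rewritten over the nodes already there: several
    input nodes may have the same exponent, so labels add up, and the excess
    over [q - 1] is carried upwards along the sorted order ([norm_ok]).  Binary
    search finds the place of the number thus represented ([search_ok]).  If no
    node has this exponent, a node with it is created; otherwise the input node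
    is identified with the one found, and the new node gets the first exponent
    missing above it ([place_ok]).  In both cases the sum of any labels at the
    input nodes handled so far can still be carried out inside the set of
    exponents: occupying the next hole is what makes room for one more
    duplicate, as in hashing with linear probing.

    This room is what [adm] measures.  A set of exponents with contents [w] is
    admissible if there are bounds [K e] on the carry that arrives at [e], with
    [K e = 0] off the set.  Insertion keeps it by raising [K] by one between the
    exponent and the hole ([adm_insert]); a carry [k] keeps it by lowering [K]
    by [|k|] at its target ([adm_carry]), so that carrying never needs an
    exponent outside the set ([adm_carry_room]).  The row of a node with
    exponent [f + 1] is that of the node with exponent [f], plus one at node
    [0].  To have room for these increments, all rows keep a slack of one unit
    per insertion still to come at node [0]; at the start it is there because
    [2n <= q ^ n] ([stage0]).

    Exponents are compared through their rows, from the largest position down.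
    The difference of what has been read, in units of the current position, is
    kept exactly as long as it is at most [1] in absolute value; from [2] on its
    sign is settled, as the remaining digits cannot make up for it
    ([cmp_stepP]).  The only information needed about the positions is whether
    two consecutive exponents differ by one, and that is the bit vector of the
    reduced circuit.  So a comparison takes [O(n)] steps, an insertion
    [O(n log n)] and a marking [O(n)].

    The algorithm is written in a small imperative language with arrays, whose
    programs are compiled to the machine at the price of a constant factor
    ([compile_correct]).  Products with the row length, halves, and quotients
    and remainders by [q] are read from tables.  All values stored are at most
    quadratic in [n + m], so that each step costs [O(log)] under the logarithmic
    criterion, and one more logarithm comes from the search: this is the bound
    [soft c 2] of the theorem. *)

Set Implicit Arguments.
Unset Strict Implicit.
Unset Printing Implicit Defensive.

Import Order.TTheory GRing.Theory Num.Theory.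
Local Open Scope ring_scope.

(** * A structured language and its compilation *)

Inductive var :=
  | vn | vm | vw | vh | vx | vr | vz | vlg | vpw | vi | vj | vu | ve | vd
  | vc | vp | vrow | va | vb | vacc | vlo | vhi | vmid | vfound | vcnt | vk.

Inductive arr := aMul | aQuo | aRem | aHalf | aD | aR | aOrd | aBit | aNode
  | aDone | aCnt.

Definition var_code (x : var) : nat :=
  match x with
  | vn => 0 | vm => 1 | vw => 2 | vh => 3 | vx => 4 | vr => 5 | vz => 6
  | vlg => 7 | vpw => 8 | vi => 9 | vj => 10 | vu => 11 | ve => 12 | vd => 13
  | vc => 14 | vp => 15 | vrow => 16 | va => 17 | vb => 18 | vacc => 19
  | vlo => 20 | vhi => 21 | vmid => 22 | vfound => 23 | vcnt => 24 | vk => 25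
  end.

Definition arr_code (a : arr) : nat :=
  match a with
  | aMul => 0 | aQuo => 1 | aRem => 2 | aHalf => 3 | aD => 4 | aR => 5
  | aOrd => 6 | aBit => 7 | aNode => 8 | aDone => 9 | aCnt => 10
  end.

Lemma var_code_inj : injective var_code.
Proof. by do 2 case. Qed.

Lemma arr_code_inj : injective arr_code.
Proof. by do 2 case. Qed.

HB.instance Definition _ := Equality.copy var (inj_type var_code_inj).
HB.instance Definition _ := Equality.copy arr (inj_type arr_code_inj).

Inductive exp :=
  | EC of int
  | EV of var
  | EA of arr & exp
  | EAdd of exp & exp
  | ESub of exp & exp.

Inductive cmd :=
  | Skip
  | Asg of var & exp
  | Sto of arr & exp & exp
  | Read of var
  | Print of exp
  | Seq of cmd & cmd
  | If of exp & cmd & cmd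
  | While of exp & cmd.

Record st := St {
  sv : var -> int;
  ar : arr -> nat -> int;
  si : seq int;
  so : seq int
}.

Definition setv (s : st) (x : var) (z : int) : st :=
  St (fun y => if y == x then z else sv s y) (ar s) (si s) (so s).

Definition seta (s : st) (a : arr) (i : nat) (z : int) : st :=
  St (sv s) (fun b j => if (b == a) && (j == i) then z else ar s b j)
     (si s) (so s).

Definition seti (s : st) (w : seq int) : st := St (sv s) (ar s) w (so s).

Definition seto (s : st) (o : seq int) : st := St (sv s) (ar s) (si s) o.

(** Reading an array at the absolute value of the index makes evaluation total,
    so that no program of the language can get stuck on an address. *)
Fixpoint ev (s : st) (e : exp) : int :=
  match e with
  | EC c => c
  | EV x => sv s x
  | EA a e1 => ar s a `|ev s e1|%N
  | EAdd e1 e2 => ev s e1 + ev s e2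
  | ESub e1 e2 => ev s e1 - ev s e2
  end.

(** [run B c s t s'] counts in [t] the elementary commands and tests executed, and holds
    only if no stored value exceeds [B]: under the logarithmic criterion this
    bound and [t] together determine the cost. *)
Inductive run (B : nat) : cmd -> st -> nat -> st -> Prop :=
  | run_skip s : run B Skip s 0 s
  | run_asg x e s : (`|ev s e| <= B)%N -> run B (Asg x e) s 1 (setv s x (ev s
    e))
  | run_sto a e1 e2 s : (`|ev s e2| <= B)%N ->
      run B (Sto a e1 e2) s 1 (seta s a `|ev s e1|%N (ev s e2))
  | run_read x s z w : si s = z :: w -> (`|z| <= B)%N ->
      run B (Read x) s 1 (seti (setv s x z) w)
  | run_print e s : run B (Print e) s 1 (seto s (rcons (so s) (ev s e)))
  | run_seq c1 c2 s t1 s1 t2 s2 : run B c1 s t1 s1 -> run B c2 s1 t2 s2 ->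
      run B (Seq c1 c2) s (t1 + t2) s2
  | run_if e c1 c2 s t s1 : run B (if 0 < ev s e then c1 else c2) s t s1 ->
      run B (If e c1 c2) s t.+1 s1
  | run_while e c s t1 s1 t2 s2 : 0 < ev s e -> run B c s t1 s1 ->
      run B (While e c) s1 t2 s2 -> run B (While e c) s (t1 + t2).+1 s2
  | run_end e c s : ~~ (0 < ev s e) -> run B (While e c) s 1 s.

(** Registers are dealt out modulo 16: the cells of the eleven arrays, the
    variables, and an unlimited supply of temporaries. *)
Definition cell (a : arr) (i : nat) : nat := (16 * i + arr_code a)%N.
Definition vreg (x : var) : nat := (16 * var_code x + 14)%N.
Definition tmp (d : nat) : nat := (16 * d + 15)%N.

(** Absolute value, multiplication by 16 as four doublings, offset of the
    array. *)
Definition caddr (l d : nat) (a : arr) : program :=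
  [:: IJpos (tmp d) (l + 3); IConst (tmp d.+1) 0;
      ISub (tmp d) (tmp d.+1) (tmp d);
      IAdd (tmp d) (tmp d) (tmp d); IAdd (tmp d) (tmp d) (tmp d);
      IAdd (tmp d) (tmp d) (tmp d); IAdd (tmp d) (tmp d) (tmp d);
      IConst (tmp d.+1) (arr_code a)%:Z; IAdd (tmp d) (tmp d) (tmp d.+1)].

Fixpoint cexp (l d : nat) (e : exp) : program :=
  match e with
  | EC c => [:: IConst (tmp d) c]
  | EV x => [:: IConst (tmp d) 0; IAdd (tmp d) (tmp d) (vreg x)]
  | EA a e1 =>
      let p := cexp l d e1 in
      p ++ caddr (l + size p) d a ++ [:: ILoad (tmp d) (tmp d)]
  | EAdd e1 e2 =>
      let p := cexp l d e1 in
      p ++ cexp (l + size p) d.+1 e2 ++ [:: IAdd (tmp d) (tmp d) (tmp d.+1)]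
  | ESub e1 e2 =>
      let p := cexp l d e1 in
      p ++ cexp (l + size p) d.+1 e2 ++ [:: ISub (tmp d) (tmp d) (tmp d.+1)]
  end.

(** The machine has only conditional jumps. *)
Definition cjump (l : nat) : program := [:: IConst (tmp 0) 1; IJpos (tmp 0) l].

Fixpoint compile (l : nat) (c : cmd) : program :=
  match c with
  | Skip => [::]
  | Asg x e =>
      cexp l 0 e ++ [:: IConst (vreg x) 0; IAdd (vreg x) (vreg x) (tmp 0)]
  | Sto a e1 e2 =>
      let p1 := cexp l 0 e1 in
      let p2 := caddr (l + size p1) 0 a in
      p1 ++ p2 ++ cexp (l + size p1 + size p2) 1 e2
         ++ [:: IStore (tmp 0) (tmp 1)]
  | Read x => [:: IRead (vreg x)]
  | Print e => cexp l 0 e ++ [:: IPrint (tmp 0)]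
  | Seq c1 c2 => let p := compile l c1 in p ++ compile (l + size p) c2
  | If e c1 c2 =>
      let p0 := cexp l 0 e in
      let l2 := (l + size p0 + 1)%N in
      let p2 := compile l2 c2 in
      let l1 := (l2 + size p2 + 2)%N in
      let p1 := compile l1 c1 in
      p0 ++ [:: IJpos (tmp 0) l1] ++ p2 ++ cjump (l1 + size p1) ++ p1
  | While e c =>
      let p0 := cexp l 0 e in
      let l1 := (l + size p0 + 3)%N in
      let p1 := compile l1 c in
      p0 ++ [:: IJpos (tmp 0) l1] ++ cjump (l1 + size p1 + 2) ++ p1 ++ cjump l
  end.

(** * Correctness of the compilation *)
Definition code_at (p : program) (l : nat) (c : program) : Prop :=
  forall i, (i < size c)%N -> onth p (l + i)%N = onth c i.

Lemma code_at_cat p l c1 c2 : code_at p l (c1 ++ c2) ->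
  code_at p l c1 /\ code_at p (l + size c1) c2.
Proof.
move=> H; split=> i hi.
  by rewrite H ?onth_cat ?hi // size_cat ltn_addr.
rewrite -addnA H; first by rewrite onth_cat ltnNge leq_addr /= addKn.
by rewrite size_cat ltn_add2l.
Qed.

Lemma code_at_cons p l i c : code_at p l (i :: c) ->
  onth p l = Some i /\ code_at p l.+1 c.
Proof.
move=> H; split; first by have := H 0%N isT; rewrite addn0.
by move=> j hj; have := H j.+1 hj; rewrite addnS.
Qed.

Inductive msteps (p : program) : config -> nat -> config -> Prop :=
  | msteps_refl s : msteps p s 0 s
  | msteps_cons s k1 s1 k2 s2 : step p s = Some (k1, s1) ->
      msteps p s1 k2 s2 -> msteps p s (k1 + k2) s2.

Lemma msteps_trans p s k1 s1 k2 s2 :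
  msteps p s k1 s1 -> msteps p s1 k2 s2 -> msteps p s (k1 + k2) s2.
Proof.
by elim=> [//|u j1 u1 j2 u2 h _ IH] /IH; rewrite -addnA; apply: msteps_cons.
Qed.

Lemma msteps_exec p s k s' : msteps p s k s' ->
  onth p (pc s') = Some IHalt -> exec p s k.+1 (out s').
Proof.
elim=> [u|u j1 u1 j2 u2 h _ IH] H; first exact: exec_halt.
by rewrite -addnS; apply: exec_step h (IH H).
Qed.

Definition blen (B : nat) : nat := (trunc_log 2 B).+1.

Lemma len_le c B x : (1 <= B)%N -> (`|x| <= c * B)%N -> (len x <= c.+1 * blen
  B)%N.
Proof.
move=> B1 h; rewrite /len /blen mulSn.
have hB : (B < 2 ^ (trunc_log 2 B).+1)%N by apply: trunc_log_ltn.
have hc : (c < 2 ^ c)%N by apply: ltn_expl.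
suff: (trunc_log 2 `|x| <= (trunc_log 2 B) + c)%N by nia.
case: (posnP `|x|) => [->|x0]; first by rewrite trunc_log0.
rewrite -ltnS -(ltn_exp2l (m := 2)) //.
apply: leq_ltn_trans (trunc_logP _ x0) _ => //.
rewrite -addSn expnD; nia.
Qed.

Definition sbnd (B : nat) (s : st) : Prop :=
  (forall x, `|sv s x| <= B)%N /\ (forall a i, `|ar s a i| <= B)%N.

Definition rep (s : st) (X : nat -> int) : Prop :=
  (forall x, X (vreg x) = sv s x) /\ (forall a i, X (cell a i) = ar s a i).

(** Expressions are not bounded by [B] themselves, only linearly in it. *)
Fixpoint ebnd (e : exp) : nat :=
  match e with
  | EC c => `|c|%N
  | EV _ | EA _ _ => 1
  | EAdd e1 e2 | ESub e1 e2 => (ebnd e1 + ebnd e2)%N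
  end.

Lemma ev_bnd B s e : (1 <= B)%N -> sbnd B s -> (`|ev s e| <= ebnd e * B)%N.
Proof.
move=> B1 [h1 h2]; elim: e => /= [c|x|a e1 _|e1 h3 e2 h4|e1 h3 e2 h4];
  rewrite ?mul1n //; nia.
Qed.

Lemma tmp_inj d d' : tmp d = tmp d' -> d = d'.
Proof. rewrite /tmp; lia. Qed.
Lemma vreg_tmp x d : vreg x == tmp d = false.
Proof. rewrite /tmp /vreg; lia. Qed.
Lemma cell_tmp a i d : cell a i == tmp d = false.
Proof. apply/eqP; rewrite /tmp /cell; case: a => /=; lia. Qed.
Lemma cell_vreg a i x : cell a i == vreg x = false.
Proof. apply/eqP; rewrite /vreg /cell; case: a => /=; lia. Qed.
Lemma vregE x y : (vreg x == vreg y) = (x == y).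
Proof. apply/eqP/eqP => [|-> //] h; apply: var_code_inj; move: h;
  rewrite /vreg; lia. Qed.
Lemma cellE a i b j : (cell a i == cell b j) = (a == b) && (i == j).
Proof.
apply/eqP/andP=> [|[/eqP -> /eqP -> //]].
rewrite /cell => h; have [h1 h2] : arr_code a = arr_code b /\ i = j.
  by move: h; case: a; case: b => /=; lia.
by rewrite h2 (arr_code_inj h1).
Qed.

(** Code at depth [d] spoils the temporaries from [d] on and nothing else, so
    the value of a left operand survives the evaluation of the right one. *)
Definition above (d : nat) (X X' : nat -> int) : Prop :=
  forall r, (forall d', (d <= d')%N -> (r == tmp d') = false) -> X' r = X r.

Lemma above_refl d X : above d X X.
Proof. by []. Qed.

Lemma above_trans d d' X X1 X2 : (d <= d')%N ->
  above d X X1 -> above d' X1 X2 -> above d X X2.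
Proof.
move=> dd h1 h2 r hr; rewrite h2 ?h1 // => e he.
by apply: hr; apply: leq_trans he.
Qed.

Lemma above_upd d d' X X' z : (d <= d')%N ->
  above d X X' -> above d X (upd X' (tmp d') z).
Proof. by move=> dd h r hr; rewrite /upd hr ?h. Qed.

Lemma above_tmp d d' X X' : (d' < d)%N -> above d X X' -> X' (tmp d') = X (tmp
  d').
Proof.
move=> dd h; apply: h => e he; apply/eqP => /tmp_inj h1.
by move: dd; rewrite h1 ltnNge he.
Qed.

Lemma rep_above d s X X' : above d X X' -> rep s X -> rep s X'.
Proof.
move=> h [h1 h2]; split=> [x|a i]; rewrite h //.
- by move=> d' _; apply: vreg_tmp.
- by move=> d' _; apply: cell_tmp.
Qed.

Lemma updE X i z : upd X i z i = z.
Proof. by rewrite /upd eqxx. Qed.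
Lemma updN X i z j : (j == i) = false -> upd X i z j = X j.
Proof. by rewrite /upd => ->. Qed.
Lemma tmpS d : (tmp d == tmp d.+1) = false.
Proof. rewrite /tmp; lia. Qed.

(* Executes one straight-line instruction, found in the hypothesis [h]. *)
Ltac onestep h :=
  let h1 := fresh in
  move: h => /code_at_cons[h1 h];
  eapply msteps_cons; first by rewrite /step h1.

(** As in all lemmas on compiled code, the constant is chosen before the state
    and the bound [B]; it absorbs the number of instructions. *)
Lemma caddr_ok l d a : exists C, forall p B X w o c,
  code_at p l (caddr l d a) -> (1 <= B)%N -> (`|X (tmp d)| <= c * B)%N ->
  exists X' k, [/\
    msteps p (Config l X w o) k (Config (l + size (caddr l d a)) X' w o),
    X' (tmp d) = (cell a `|X (tmp d)|%N)%:Z, above d X X' &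
    (k <= C * c.+1 * blen B)%N].
Proof.
exists 1000%N => p B X w o c H B1 hX.
have hb : (1 <= blen B)%N by [].
have L : (len (X (tmp d)) <= c.+1 * blen B)%N by apply: len_le.
have [X1 [k1 [h1 hz ha hk1]]] : exists X1 k1, [/\
    msteps p (Config l X w o) k1 (Config (l + 3) X1 w o),
    X1 (tmp d) = `|X (tmp d)|%N%:Z, above d X X1 &
    (k1 <= 10 * (c.+1 * blen B))%N].
  have [x0|x0] := boolP (0 < X (tmp d)).
    exists X, (len (X (tmp d)) + 0)%N; split=> //; last by lia.
    - onestep H; rewrite x0; exact: msteps_refl.
    - by rewrite gtz0_abs.
  exists (upd (upd X (tmp d.+1) 0) (tmp d) (0 - X (tmp d))).
  eexists; split.
  - move: (H); rewrite /caddr => H2.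
    onestep H2; rewrite (negbTE x0); onestep H2; onestep H2.
    rewrite addn3 updE updN ?tmpS //; exact: msteps_refl.
  - rewrite updE; lia.
  - by apply: above_upd => //; apply: above_upd => //; apply: above_refl.
  - rewrite updE updN ?tmpS // (_ : len 0 = 1%N) //.
    by move: L; move: (len _) => l1; nia.
have H3 : code_at p (l + 3) (drop 3 (caddr l d a)).
  by move: H; rewrite /caddr => H; do 3 (move: H => /code_at_cons[_ H]);
    rewrite addn3.
set z := `|X (tmp d)|%N in hz *.
have Lz j : (j <= 16 * z + 16)%N -> (len j%:Z <= 17 * (c.+1 * blen B))%N.
  move=> hj; rewrite mulnA; apply: leq_trans (len_le (c := 16 * c.+1) B1 _) _.
    by move: hX; rewrite -/z; nia.
  by rewrite leq_mul2r; apply/orP; right; lia.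
have La : (arr_code a < 16)%N by case: (a).
eexists; eexists; split.
- apply: msteps_trans h1 _.
  onestep H3; rewrite hz; onestep H3; rewrite updE; onestep H3; rewrite updE.
  onestep H3; rewrite updE; onestep H3; onestep H3.
  rewrite updE updN ?tmpS // updE (_ : (l + size _)%N = (l + 3).+4.+2);
    last by rewrite /=; lia.
  exact: msteps_refl.
- rewrite updE /cell; lia.
- do !apply: above_upd => //.
- rewrite !updE updN ?tmpS // updE hz -[X in (_ <= X)%N]mulnA.
  have := hk1; move: (c.+1 * blen B)%N Lz => y Lz {}hk1.
  have := Lz z; have := Lz (z + z)%N; have := Lz (z + z + (z + z))%N.
  have := Lz (z + z + (z + z) + (z + z + (z + z)))%N.
  have := Lz (z + z + (z + z) + (z + z + (z + z)) + (z + z + (z + z) + (z + z +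
    (z + z))))%N.
  have := Lz (arr_code a); rewrite !PoszD.
  move: (len _) (len _) (len _) (len _) (len _) (len _) => l1 l2 l3 l4 l5 l6.
  lia.
Qed.

Lemma cexp_ok e : forall l d, exists C, forall p B s X w o,
  code_at p l (cexp l d e) -> (1 <= B)%N -> sbnd B s -> rep s X ->
  exists X' k, [/\
    msteps p (Config l X w o) k (Config (l + size (cexp l d e)) X' w o),
    X' (tmp d) = ev s e, above d X X' & (k <= C * blen B)%N].
Proof.
elim: e => [c|x|a e IH|e1 IH1 e2 IH2|e1 IH1 e2 IH2] l d.
- exists `|c|.+1%N => p B s X w o /= H B1 hs hX.
  eexists; eexists; split.
  + onestep H; rewrite addn1; exact: msteps_refl.
  + by rewrite updE.
  + exact: above_upd (@above_refl _ _).
  + by rewrite addn0; apply: len_le => //; nia.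
- exists 4%N => p B s X w o /= H B1 hs hX.
  eexists; eexists; split.
  + onestep H; onestep H; rewrite addn2; exact: msteps_refl.
  + by rewrite !updE updN ?vreg_tmp // add0r (hX.1 x).
  + by do 2!apply: above_upd => //; apply: above_refl.
  + rewrite updE updN ?vreg_tmp // (hX.1 x) (_ : len 0 = 1%N) //.
    have := @len_le 1 B (sv s x) B1; rewrite mul1n => /(_ (hs.1 x)).
    by rewrite /blen; lia.
- have [C1 h1] := IH l d.
  have [C2 h2] := caddr_ok (l + size (cexp l d e)) d a.
  pose b := ebnd e.
  exists (C1 + C2 * b.+1 + 16 * b + 100)%N => p B s X w o.
  rewrite [cexp l d _](_ : _ = cexp l d e ++
    caddr (l + size (cexp l d e)) d a ++ [:: ILoad (tmp d) (tmp d)]) //.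
  move=> /code_at_cat[H1 /code_at_cat[H2 H3]] B1 hs hX.
  have [X1 [k1 [m1 e1 a1 c1]]] := h1 p B s X w o H1 B1 hs hX.
  have hb : (`|X1 (tmp d)| <= b * B)%N by rewrite e1; apply: ev_bnd.
  have [X2 [k2 [m2 e2 a2 c2]]] := h2 p B X1 w o b H2 B1 hb.
  have a12 := above_trans (leqnn d) a1 a2.
  have hX2 := rep_above a12 hX.
  eexists; eexists; split.
  + apply: msteps_trans m1 _; apply: msteps_trans m2 _.
    move/code_at_cons: H3 => [H3 _].
    apply: msteps_cons; first by rewrite /step H3 e2.
    rewrite (_ : (l + size (_ ++ _))%N = (l + size (cexp l d e) + 9).+1);
      last first.
      by rewrite !size_cat /=; lia.
    exact: msteps_refl.
  + by rewrite updE hX2.2 e1.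
  + exact: above_upd.
  + rewrite hX2.2.
    have := @len_le 1 B (ar s a `|X1 (tmp d)|) B1; rewrite mul1n =>
      /(_ (hs.2 _ _)).
    have : (len (cell a `|X1 (tmp d)|)%:Z <= (16 * b + 16).+1 * blen B)%N.
      apply: len_le => //; rewrite /cell /=; have : (arr_code a < 16)%N by
        case: (a).
      by move: hb; move: `|X1 _|%N => y; nia.
    by move: (len _) (len _) => l1 l2; nia.
- have [C1 h1] := IH1 l d.
  have [C2 h2] := IH2 (l + size (cexp l d e1))%N d.+1.
  exists (C1 + C2 + ebnd e1 + ebnd e2 + 10)%N => p B s X w o /= H B1 hs hX.
  move/code_at_cat: H => [H1 /code_at_cat[H2 H3]].
  have [X1 [k1 [m1 x1 a1 c1]]] := h1 p B s X w o H1 B1 hs hX.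
  have [X2 [k2 [m2 x2 a2 c2]]] := h2 p B s X1 w o H2 B1 hs (rep_above a1 hX).
  have x12 : X2 (tmp d) = ev s e1 by rewrite (above_tmp _ a2).
  eexists; eexists; split.
  + apply: msteps_trans m1 _; apply: msteps_trans m2 _.
    onestep H3; rewrite !size_cat /= addn1 !addnS !addnA; exact: msteps_refl.
  + by rewrite updE x12 x2.
  + by apply: above_upd => //; apply: above_trans a1 a2.
  + rewrite x12 x2.
    have := len_le B1 (ev_bnd e1 B1 hs); have := len_le B1 (ev_bnd e2 B1 hs).
    by move: (len _) (len _) => l1 l2; nia.
- have [C1 h1] := IH1 l d.
  have [C2 h2] := IH2 (l + size (cexp l d e1))%N d.+1.
  exists (C1 + C2 + ebnd e1 + ebnd e2 + 10)%N => p B s X w o /= H B1 hs hX.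
  move/code_at_cat: H => [H1 /code_at_cat[H2 H3]].
  have [X1 [k1 [m1 x1 a1 c1]]] := h1 p B s X w o H1 B1 hs hX.
  have [X2 [k2 [m2 x2 a2 c2]]] := h2 p B s X1 w o H2 B1 hs (rep_above a1 hX).
  have x12 : X2 (tmp d) = ev s e1 by rewrite (above_tmp _ a2).
  eexists; eexists; split.
  + apply: msteps_trans m1 _; apply: msteps_trans m2 _.
    onestep H3; rewrite !size_cat /= addn1 !addnS !addnA; exact: msteps_refl.
  + by rewrite updE x12 x2.
  + by apply: above_upd => //; apply: above_trans a1 a2.
  + rewrite x12 x2.
    have := len_le B1 (ev_bnd e1 B1 hs); have := len_le B1 (ev_bnd e2 B1 hs).
    by move: (len _) (len _) => l1 l2; nia.
Qed.

Lemma msteps_refl_pc p l l' X w o : l = l' ->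
  msteps p (Config l X w o) 0 (Config l' X w o).
Proof. by move->; apply: msteps_refl. Qed.

Lemma rep_setv s X x z : rep s X -> rep (setv s x z) (upd X (vreg x) z).
Proof.
move=> [h1 h2]; split=> [y|a i] /=; rewrite /upd ?vregE ?cell_vreg //.
by case: eqP.
Qed.

Lemma rep_seta s X a i z : rep s X -> rep (seta s a i z) (upd X (cell a i) z).
Proof.
move=> [h1 h2]; split=> [y|b j] /=; rewrite /upd ?cellE ?(eq_sym (vreg y))
  ?cell_vreg //.
by rewrite h2.
Qed.

Lemma sbnd_setv B s x z : sbnd B s -> (`|z| <= B)%N -> sbnd B (setv s x z).
Proof. by move=> [h1 h2] hz; split=> //= y; case: eqP. Qed.

Lemma sbnd_seta B s a i z : sbnd B s -> (`|z| <= B)%N -> sbnd B (seta s a i z).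
Proof. by move=> [h1 h2] hz; split=> //= b j; case: andP. Qed.

Lemma len_bnd B x : (1 <= B)%N -> (`|x| <= B)%N -> (len x <= 2 * blen B)%N.
Proof. by move=> B1 h; apply: len_le => //; rewrite mul1n. Qed.

Lemma rep_setv2 s X x y z : rep s X ->
  rep (setv s x z) (upd (upd X (vreg x) y) (vreg x) z).
Proof.
move=> [h1 h2]; split=> [v|a i] /=; rewrite /upd ?vregE ?cell_vreg //.
by case: eqP.
Qed.

(** By induction on the command; the loop needs an inner induction on the run,
    with the constant already fixed by the body. *)
Lemma comp_ok c : forall l, exists C, forall p B s t s' X,
  run B c s t s' -> code_at p l (compile l c) -> (1 <= B)%N -> sbnd B s ->
  rep s X -> exists X' k, [/\
    msteps p (Config l X (si s) (so s)) k
      (Config (l + size (compile l c)) X' (si s') (so s')),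
    rep s' X', sbnd B s' & (k <= C * t * blen B)%N].
Proof.
have T0 X z : upd X (tmp 0) z (tmp 0) = z by rewrite updE.
have len1 : len 1 = 1%N by [].
have len0 : len 0 = 1%N by [].
elim: c => [|x e|a e1 e2|x|e|c1 IH1 c2 IH2|e c1 IH1 c2 IH2|e c IH] l.
- exists 0%N => p B s t s' X h; inversion h; subst=> _ _ hs hX.
  by exists X, 0%N; split=> //; rewrite addn0; apply: msteps_refl.
- have [C h] := @cexp_ok e l 0; exists (C + ebnd e + 10)%N => p B s t s' X hr.
  inversion hr as [|? ? ? hb| | | | | | |]; subst=> /= H B1 hs hX.
  move/code_at_cat: H => [H1 H2].
  have [X1 [k1 [m1 x1 a1 c1]]] := h p B s X (si s) (so s) H1 B1 hs hX.
  eexists; eexists; split.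
  + apply: msteps_trans m1 _; onestep H2; onestep H2.
    rewrite size_cat addnA addn2; exact: msteps_refl.
  + rewrite updE updN; last by rewrite eq_sym vreg_tmp.
    by rewrite x1 add0r; apply: rep_setv2; apply: rep_above a1 hX.
  + exact: sbnd_setv.
  + rewrite updE updN ?x1; last by rewrite eq_sym vreg_tmp.
    rewrite len0; have := len_bnd B1 hb; rewrite /blen.
    by move: (len _) => l1; move: c1; rewrite /blen; move: (trunc_log _ _) =>
      y c1; nia.
- have [C1 h1] := @cexp_ok e1 l 0.
  have [C2 h2] := caddr_ok (l + size (cexp l 0 e1)) 0 a.
  have [C3 h3] := @cexp_ok e2 (l + size (cexp l 0 e1) +
    size (caddr (l + size (cexp l 0 e1)) 0 a))%N 1.
  pose b := ebnd e1.
  exists (C1 + C2 * b.+1 + C3 + 16 * b + 100)%N => p B s t s' X hr.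
  inversion hr as [| |? ? ? ? hb| | | | | |]; subst.
  rewrite [compile l _](_ : _ = cexp l 0 e1 ++
    caddr (l + size (cexp l 0 e1)) 0 a ++
    cexp (l + size (cexp l 0 e1) + size (caddr (l + size (cexp l 0 e1)) 0 a)) 1
      e2
    ++ [:: IStore (tmp 0) (tmp 1)]) //.
  move=> /code_at_cat[H1 /code_at_cat[H2 /code_at_cat[H3 H4]]] B1 hs hX.
  have [X1 [k1 [m1 x1 a1 c1]]] := h1 p B s X (si s) (so s) H1 B1 hs hX.
  have hb1 : (`|X1 (tmp 0)| <= b * B)%N by rewrite x1; apply: ev_bnd.
  have [X2 [k2 [m2 x2 a2 c2]]] := h2 p B X1 (si s) (so s) b H2 B1 hb1.
  have hX2 := rep_above a2 (rep_above a1 hX).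
  have [X3 [k3 [m3 x3 a3 c3]]] := h3 p B s X2 (si s) (so s) H3 B1 hs hX2.
  have x32 : X3 (tmp 0) = (cell a `|ev s e1|%N)%:Z.
    by rewrite (above_tmp _ a3) // x2 x1.
  eexists; eexists; split.
  + apply: msteps_trans m1 _; apply: msteps_trans m2 _;
      apply: msteps_trans m3 _.
    move/code_at_cons: H4 => [H4 _].
    apply: msteps_cons; first by rewrite /step H4 x32.
    apply: msteps_refl_pc; rewrite !size_cat /=; lia.
  + by rewrite x3; apply: rep_seta; apply: rep_above a3 hX2.
  + exact: sbnd_seta.
  + have : (len (cell a `|ev s e1|)%:Z <= (16 * b + 16).+1 * blen B)%N.
      apply: len_le => //; rewrite /cell /=; have : (arr_code a < 16)%N by
        case: (a).
      by move: hb1; rewrite x1; move: `|ev _ _|%N => y; nia.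
    have := len_bnd B1 hb; rewrite x3.
    move: (len _) (len _) => l1 l2; move: c1 c2 c3; move: (blen B) => y.
    by rewrite /b; nia.
- exists 10%N => p B s t s' X hr.
  inversion hr as [| | |? ? ? ? hw hb| | | | |]; subst=> H B1 hs hX.
  eexists; eexists; split.
  + move/code_at_cons: H => [H _].
    apply: msteps_cons; first by rewrite /step H hw.
    rewrite addn1; exact: msteps_refl.
  + by have [] := rep_setv x z hX.
  + by have [] := sbnd_setv x hs hb.
  + have := len_bnd B1 hb; lia.
- have [C h] := @cexp_ok e l 0; exists (C + ebnd e + 10)%N => p B s t s' X hr.
  inversion hr; subst=> /= H B1 hs hX.
  move/code_at_cat: H => [H1 H2].
  have [X1 [k1 [m1 x1 a1 c1]]] := h p B s X (si s) (so s) H1 B1 hs hX.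
  eexists; eexists; split.
  + apply: msteps_trans m1 _; onestep H2.
    rewrite size_cat addnA addn1 x1; exact: msteps_refl.
  + by have [] := rep_above a1 hX.
  + by case: hs.
  + rewrite ?x1; have := len_le B1 (ev_bnd e B1 hs).
    by move: (len _) => l1; nia.
- have [C1 h1] := IH1 l; have [C2 h2] := IH2 (l + size (compile l c1))%N.
  exists (C1 + C2)%N => p B s t s' X hr.
  inversion hr as [| | | | |? ? ? t1 s1 t2 ? r1 r2| | |]; subst=> /= H B1 hs hX.
  move/code_at_cat: H => [H1 H2].
  have [X1 [k1 [m1 hX1 hs1 e1]]] := h1 p B s t1 s1 X r1 H1 B1 hs hX.
  have [X2 [k2 [m2 hX2 hs2 e2]]] := h2 p B s1 t2 s' X1 r2 H2 B1 hs1 hX1.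
  exists X2, (k1 + k2)%N; split=> //; last by nia.
  rewrite size_cat addnA; exact: msteps_trans m1 m2.
- have [C0 h0] := @cexp_ok e l 0.
  set l2 := (l + size (cexp l 0 e) + 1)%N.
  set l1 := (l2 + size (compile l2 c2) + 2)%N.
  have [C1 h1] := IH1 l1; have [C2 h2] := IH2 l2.
  exists (C0 + C1 + C2 + ebnd e + 10)%N => p B s t s' X hr.
  inversion hr as [| | | | | |? ? ? ? t' ? r1| |]; subst=> /=.
  rewrite -/l2 -/l1 => H B1 hs hX; move: (H).
  move=> /code_at_cat[H0 /code_at_cons[Hj /code_at_cat[H2 H3]]].
  have [X1 [k1 [m1 x1 a1 d1]]] := h0 p B s X (si s) (so s) H0 B1 hs hX.
  have hX1 := rep_above a1 hX.
  have hl := len_le B1 (ev_bnd e B1 hs).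
  have el2 : (l + size (cexp l 0 e)).+1 = l2 by rewrite /l2 addn1.
  rewrite el2 in H2 H3.
  move: H3 => /code_at_cons[Hj1 /code_at_cons[Hj2 H1]].
  have el1 : (l2 + size (compile l2 c2)).+2 = l1 by rewrite /l1 addn2.
  rewrite el1 in H1.
  have -> : (l + size (cexp l 0 e ++ IJpos (tmp 0) l1 :: compile l2 c2 ++
      [:: IConst (tmp 0) 1, IJpos (tmp 0) (l1 + size (compile l1 c1)) & compile
        l1 c1])
      = l1 + size (compile l1 c1))%N.
    by rewrite !(size_cat) /= !size_cat /= /l1 /l2; lia.
  case: ifP r1 => he r1.
  + have [X2 [k2 [m2 hX2 hs2 d2]]] := h1 p B s t' s' X1 r1 H1 B1 hs hX1.
    exists X2, (k1 + (len (X1 (tmp 0)) + k2))%N; split=> //; last first.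
      by rewrite x1; move: hl d1 d2; move: (len _) (blen B) => u v; nia.
    apply: msteps_trans m1 _; apply: msteps_cons m2.
    by rewrite /step Hj x1 he.
  + have [X2 [k2 [m2 hX2 hs2 d2]]] := h2 p B s t' s' X1 r1 H2 B1 hs hX1.
    eexists; eexists; split.
    * apply: msteps_trans m1 _.
      apply: msteps_cons; first by rewrite /step Hj x1 he el2.
      apply: msteps_trans m2 _.
      apply: msteps_cons; first by rewrite /step Hj1.
      apply: msteps_cons; first by rewrite /step Hj2 T0 ltr01.
      exact: msteps_refl.
    * by apply: rep_above hX2; apply: (above_upd _ (leqnn 0));
        apply: above_refl.
    * exact: hs2.
    * rewrite len1; have := ltn0Sn (trunc_log 2 B); rewrite -/(blen B).
      by move: hl d1 d2; move: (len _) (blen B) => u v; nia.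
- have [C0 h0] := @cexp_ok e l 0.
  set l1 := (l + size (cexp l 0 e) + 3)%N.
  have [C1 h1] := IH l1.
  exists (C0 + C1 + ebnd e + 10)%N => p B s t s' X hr.
  move: X; remember (While e c) as W eqn:hW.
  elim: hr hW => // {s t s'}.
  + move=> e' c' s t1 s1 t2 s2 he r1 _ r2 IHr [? ?] X; subst e' c'.
    move=> /= H B1 hs hX; move: (H); rewrite -/l1.
    move=> /code_at_cat[H0 /code_at_cons[Hj /code_at_cons[_ /code_at_cons[_
      /code_at_cat[H1 H2]]]]].
    move: H2 => /code_at_cons[Hj1 /code_at_cons[Hj2 _]].
    have el1 : (l + size (cexp l 0 e)).+3 = l1 by rewrite /l1 addn3.
    rewrite el1 in H1 Hj1 Hj2.
    have [X1 [k1 [m1 x1 a1 d1]]] := h0 p B s X (si s) (so s) H0 B1 hs hX.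
    have hX1 := rep_above a1 hX.
    have [X2 [k2 [m2 hX2 hs2 d2]]] := h1 p B s t1 s1 X1 r1 H1 B1 hs hX1.
    have hX2' : rep s1 (upd X2 (tmp 0) 1).
      by apply: rep_above hX2; apply: (above_upd _ (leqnn 0));
        apply: above_refl.
    have [X3 [k3 [m3 hX3 hs3 d3]]] := IHr erefl _ H B1 hs2 hX2'.
    have hl := len_le B1 (ev_bnd e B1 hs).
    eexists; eexists; split.
    * apply: msteps_trans m1 _.
      apply: msteps_cons; first by rewrite /step Hj x1 he.
      apply: msteps_trans m2 _.
      apply: msteps_cons; first by rewrite /step Hj1.
      apply: msteps_cons; first by rewrite /step Hj2 T0 ltr01.
      exact: m3.
    * exact: hX3.
    * exact: hs3.
    * rewrite len1; have := ltn0Sn (trunc_log 2 B); rewrite -/(blen B).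
      by move: hl d1 d2 d3; move: (len _) (blen B) => u v; nia.
  + move=> e' c' s he [? ?] X; subst e' c'.
    move=> /= H B1 hs hX; move: (H); rewrite -/l1.
    move=> /code_at_cat[H0 /code_at_cons[Hj /code_at_cons[Hj1 /code_at_cons[Hj2
      _]]]].
    have [X1 [k1 [m1 x1 a1 d1]]] := h0 p B s X (si s) (so s) H0 B1 hs hX.
    have hX1 := rep_above a1 hX.
    have hl := len_le B1 (ev_bnd e B1 hs).
    eexists; eexists; split.
    * apply: msteps_trans m1 _.
      apply: msteps_cons; first by rewrite /step Hj x1 (negbTE he).
      apply: msteps_cons; first by rewrite /step Hj1.
      apply: msteps_cons; first by rewrite /step Hj2 T0 ltr01.
      by apply: msteps_refl_pc; rewrite !size_cat /= !size_cat /= /l1; lia.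
    * by apply: rep_above hX1; apply: (above_upd _ (leqnn 0));
        apply: above_refl.
    * exact: hs.
    * rewrite len1; have := ltn0Sn (trunc_log 2 B); rewrite -/(blen B).
      by move: hl d1; move: (len _) (blen B) => u v; nia.
Qed.

(** The machine needs no further mention: what remains is to exhibit a program
    of the language, with a bound on its steps and on the values it stores. *)
Lemma compile_correct c : exists (p : program) (C : nat),
  forall B w t s', (1 <= B)%N ->
  run B c (St (fun=> 0) (fun _ _ => 0) w [::]) t s' ->
  exists2 k, outputs p w k (so s') & (k <= (C * t * blen B).+1)%N.
Proof.
have [C h] := comp_ok c 0; exists (compile 0 c ++ [:: IHalt]), C =>
  B w t s' B1 hr.
have hc : code_at (compile 0 c ++ [:: IHalt]) 0 (compile 0 c).
  by move=> i hi; rewrite onth_cat hi.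
have [//|//|X' [k [m _ _ hk]]] := h _ _ _ _ _ (fun=> 0) hr hc B1.
exists k.+1 => //; apply: (msteps_exec m) => /=.
by rewrite onth_cat ltnn subnn.
Qed.

(** * Total correctness with a step count *)

(** Besides the postcondition, [ok] asserts termination within [T] steps on
    values bounded by [B]. *)
Definition ok (B : nat) (c : cmd) (s : st) (T : nat) (Q : st -> Prop) : Prop :=
  exists t s', [/\ run B c s t s', (t <= T)%N & Q s'].

(** The variables and arrays that a command may write, read off its syntax:
    everything else is unchanged by a run ([run_frame]), and this makes most
    invariants immediate. *)
Fixpoint wv (c : cmd) : seq var :=
  match c with
  | Skip | Sto _ _ _ | Print _ => [::]
  | Asg x _ | Read x => [:: x]
  | Seq c1 c2 | If _ c1 c2 => wv c1 ++ wv c2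
  | While _ c1 => wv c1
  end.

Fixpoint wa (c : cmd) : seq arr :=
  match c with
  | Skip | Asg _ _ | Read _ | Print _ => [::]
  | Sto a _ _ => [:: a]
  | Seq c1 c2 | If _ c1 c2 => wa c1 ++ wa c2
  | While _ c1 => wa c1
  end.

Fixpoint reads (c : cmd) : bool :=
  match c with
  | Read _ => true
  | Seq c1 c2 | If _ c1 c2 => reads c1 || reads c2
  | While _ c1 => reads c1
  | _ => false
  end.

Fixpoint prints (c : cmd) : bool :=
  match c with
  | Print _ => true
  | Seq c1 c2 | If _ c1 c2 => prints c1 || prints c2
  | While _ c1 => prints c1
  | _ => false
  end.

Record frame (c : cmd) (s s' : st) : Prop := Frame {
  frame_v : forall x, x \notin wv c -> sv s' x = sv s x;
  frame_a : forall a i, a \notin wa c -> ar s' a i = ar s a i;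
  frame_i : ~~ reads c -> si s' = si s;
  frame_o : ~~ prints c -> so s' = so s
}.

Lemma frame_sub c c' s s' : {subset wv c <= wv c'} -> {subset wa c <= wa c'} ->
  (reads c -> reads c') -> (prints c -> prints c') ->
  frame c s s' -> frame c' s s'.
Proof.
move=> h1 h2 h3 h4 [f1 f2 f3 f4]; split=> [x hx|a i ha|hr|hp].
- by apply: f1; apply: contra hx; apply: h1.
- by apply: f2; apply: contra ha; apply: h2.
- by apply: f3; apply: contra hr.
- by apply: f4; apply: contra hp.
Qed.

Lemma frame_trans c s1 s2 s3 : frame c s1 s2 -> frame c s2 s3 -> frame c s1 s3.
Proof.
move=> [a1 a2 a3 a4] [b1 b2 b3 b4]; split=> [x h|a i h|h|h].
- by rewrite b1 ?a1. - by rewrite b2 ?a2. - by rewrite b3 ?a3.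
- by rewrite b4 ?a4.
Qed.

Lemma run_frame B c s t s' : run B c s t s' -> frame c s s'.
Proof.
elim=> {c s t s'} //=.
- by move=> x e s _; split=> //= y; rewrite inE; case: (y == x).
- move=> a e1 e2 s _; split=> //= b i; rewrite inE; by case: (b == a).
- by move=> x s z w _ _; split=> //= y; rewrite inE; case: (y == x).
- move=> c1 c2 s t1 s1 t2 s2 _ f1 _ f2; apply: frame_trans.
    apply: frame_sub f1 => [x|x| |] /=; rewrite ?mem_cat; by move=> ->.
  apply: frame_sub f2 => [x|x| |] /=; rewrite ?mem_cat;
  by move=> ->; rewrite ?orbT.
- move=> e c1 c2 s t s1 _; case: ifP => _ f;
    apply: frame_sub f => [x|x| |] /=; rewrite ?mem_cat;
    by move=> ->; rewrite ?orbT.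
- by move=> e c s t1 s1 t2 s2 _ _ f1 _ f2; apply: frame_trans f2;
    apply: frame_sub f1.
Qed.

Fixpoint evars (e : exp) : seq var :=
  match e with
  | EC _ => [::] | EV x => [:: x] | EA _ e1 => evars e1
  | EAdd e1 e2 | ESub e1 e2 => evars e1 ++ evars e2
  end.

Fixpoint earrs (e : exp) : seq arr :=
  match e with
  | EC _ | EV _ => [::] | EA a e1 => a :: earrs e1
  | EAdd e1 e2 | ESub e1 e2 => earrs e1 ++ earrs e2
  end.

Lemma ev_frame c s s' e : frame c s s' ->
  all [predC wv c] (evars e) -> all [predC wa c] (earrs e) -> ev s' e = ev s e.
Proof.
move=> f; elim: e => //= [x|a e IH|e1 IH1 e2 IH2|e1 IH1 e2 IH2].
- by rewrite andbT => h _; apply: (frame_v f).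
- by move=> h /andP[ha h']; rewrite IH // (frame_a f).
- by rewrite !all_cat => /andP[? ?] /andP[? ?]; rewrite IH1 ?IH2.
- by rewrite !all_cat => /andP[? ?] /andP[? ?]; rewrite IH1 ?IH2.
Qed.

Section Rules.

Variable B : nat.
Implicit Types (s : st) (c : cmd) (T : nat) (Q : st -> Prop).

Lemma ok_weaken c s T T' Q Q' : ok B c s T Q -> (T <= T')%N ->
  (forall s', frame c s s' -> Q s' -> Q' s') -> ok B c s T' Q'.
Proof.
move=> [t [s' [r ht hQ]]] hT H; exists t, s'; split=> //.
  exact: leq_trans hT.
by apply: H hQ; apply: run_frame r.
Qed.

Lemma ok_skip s T Q : Q s -> ok B Skip s T Q.
Proof. by move=> h; exists 0%N, s; split=> //; constructor. Qed.

Lemma ok_asg x e s T Q : (`|ev s e| <= B)%N -> (0 < T)%N ->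
  Q (setv s x (ev s e)) -> ok B (Asg x e) s T Q.
Proof. by move=> *; exists 1%N; eexists; split; first constructor. Qed.

Lemma ok_sto a e1 e2 s T Q : (`|ev s e2| <= B)%N -> (0 < T)%N ->
  Q (seta s a `|ev s e1|%N (ev s e2)) -> ok B (Sto a e1 e2) s T Q.
Proof. by move=> *; exists 1%N; eexists; split; first constructor. Qed.

Lemma ok_read x z w s T Q : si s = z :: w -> (`|z| <= B)%N -> (0 < T)%N ->
  Q (seti (setv s x z) w) -> ok B (Read x) s T Q.
Proof. by move=> h *; exists 1%N; eexists; split; first constructor; eauto. Qed.

Lemma ok_print e s T Q : (0 < T)%N ->
  Q (seto s (rcons (so s) (ev s e))) -> ok B (Print e) s T Q.
Proof. by move=> *; exists 1%N; eexists; split; first constructor. Qed.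

Lemma ok_seq c1 c2 s T1 T Q : (T1 <= T)%N ->
  ok B c1 s T1 (fun s1 => ok B c2 s1 (T - T1) Q) -> ok B (Seq c1 c2) s T Q.
Proof.
move=> hT [t1 [s1 [r1 h1 [t2 [s2 [r2 h2 hQ]]]]]].
by exists (t1 + t2)%N, s2; split=> //; [apply: run_seq r2 | lia].
Qed.

Lemma ok_if e c1 c2 s T Q : (0 < T)%N ->
  (0 < ev s e -> ok B c1 s T.-1 Q) -> (ev s e <= 0 -> ok B c2 s T.-1 Q) ->
  ok B (If e c1 c2) s T Q.
Proof.
move=> hT; have [he h1 _|he _ h2] := ltP 0 (ev s e).
  have [t [s' [r ht hQ]]] := h1 isT.
  by exists t.+1, s'; split=> //; [constructor; rewrite he | lia].
have [t [s' [r ht hQ]]] := h2 isT.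
by exists t.+1, s'; split=> //; [constructor; rewrite ltNge he | lia].
Qed.

(** The bound [e] is evaluated again in every round; [for_wf] makes sure that
    its value does not change. *)
Definition For i e c : cmd :=
  Seq (Asg i (EC 0))
      (While (ESub e (EV i)) (Seq c (Asg i (EAdd (EV i) (EC 1))))).

Definition for_wf i e c : bool :=
  [&& i \notin wv c, all [predC (i :: wv c)] (evars e)
    & all [predC wa c] (earrs e)].

(** The invariant only has to describe what the body changes: the frame of the
    whole loop comes for free in every round. *)
Lemma ok_for i e c s0 k Tb (I : nat -> st -> Prop) T Q :
  for_wf i e c -> ev s0 e = k%:Z -> (k <= B)%N ->
  I 0%N (setv s0 i 0) ->
  (forall j s1, (j < k)%N -> frame (For i e c) s0 s1 -> sv s1 i = j%:Z ->
     I j s1 -> ok B c s1 Tb (fun s2 => I j.+1 (setv s2 i j.+1%:Z))) ->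
  (forall s1, frame (For i e c) s0 s1 -> sv s1 i = k%:Z -> I k s1 -> Q s1) ->
  (k * Tb.+2 + 2 <= T)%N ->
  ok B (For i e c) s0 T Q.
Proof.
move=> /and3P[hi hv ha] he kB I0 Ib Iq hT.
have fe s1 : frame (For i e c) s0 s1 -> ev s1 e = k%:Z.
  move=> f; rewrite -he; apply: ev_frame f _ _.
  - apply: sub_all hv => x /=; rewrite !inE !mem_cat inE negb_or.
    by move=> /andP[/negbTE -> /negbTE ->].
  - by apply: sub_all ha => a /=; rewrite cats0.
have sub c' s s' : {subset wv c' <= i :: wv c} -> {subset wa c' <= wa c} ->
    (reads c' -> reads c) -> (prints c' -> prints c) ->
    frame c' s s' -> frame (For i e c) s s'.
  move=> h1 h2 h3 h4; apply: frame_sub => /= [x|x|h|h].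
  - by move/h1; rewrite !inE !mem_cat inE; case/orP=> ->; rewrite ?orbT.
  - by move/h2; rewrite cats0.
  - by rewrite h3.
  - by rewrite h4.
suff W : forall j s1, (j <= k)%N -> frame (For i e c) s0 s1 ->
    sv s1 i = j%:Z -> I j s1 ->
    ok B (While (ESub e (EV i)) (Seq c (Asg i (EAdd (EV i) (EC 1))))) s1
      ((k - j) * Tb.+2 + 1) Q.
  apply: (@ok_seq _ _ _ 1); first by lia.
  apply: ok_asg => //=; apply: (ok_weaken (W 0%N _ _ _ _ _)) => //=.
  - split=> //= x; rewrite !inE; by case: (x == i).
  - by rewrite eqxx.
  - by lia.
move=> j s1 jk; have [m hm] := ubnP (k - j); elim: m => // m IH in j s1 jk hm *.
move=> f hj hI; have [jk'|kj] := ltnP j k; last first.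
  have ej : j = k by apply/eqP; rewrite eqn_leq jk.
  rewrite ej in hj hI; exists 1%N, s1; split; [|by lia|exact: Iq].
  by constructor; rewrite /= fe // hj subrr.
have [t [s2 [r ht hI2]]] := Ib j s1 jk' f hj hI.
have fr := run_frame r.
have hj2 : sv s2 i = j%:Z by rewrite (frame_v fr).
have f2 : frame (For i e c) s0 (setv s2 i j.+1%:Z).
  apply: frame_trans f _; apply: (@frame_trans _ _ s2).
    by apply: sub fr => // x; rewrite inE => ->; rewrite orbT.
  by split=> //= x; rewrite !inE; case: (x == i).
have [||t3 [s3 [r3 h3 hQ]]] := IH j.+1 _ jk' _ f2 _ hI2.
- by lia.
- by rewrite /= eqxx.
exists (t + 1 + t3).+1, s3; split=> //.
  apply: run_while r3; first by rewrite /= fe // hj; lia.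
  apply: run_seq r _.
  have E : j.+1%:Z = ev s2 (EAdd (EV i) (EC 1)) by rewrite /= hj2; lia.
  by rewrite E; constructor; rewrite -E; lia.
have -> : (k - j = (k - j.+1).+1)%N by lia.
rewrite mulSn; lia.
Qed.

End Rules.

(** * Capacity of a set of exponents *)

Section Capacity.

Variable q : nat.
Hypothesis q2 : (2 <= q)%N.

(** [K e] bounds the carry arriving at exponent [e].  A content [w i] plus this
    carry leaves a quotient by [q] of at most [K (t i).+1], and no carry arrives
    where there is no node. *)
Definition adm (p : nat) (t w : nat -> nat) : Prop :=
  exists K : nat -> nat,
    (forall i, (i < p)%N -> (w i + K (t i) < q * (K (t i).+1).+1)%N) /\
    (forall e, (forall i, (i < p)%N -> t i <> e) -> K e = 0%N).

Lemma adm_le p t w w' : (forall i, (i < p)%N -> (w' i <= w i)%N) ->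
  adm p t w -> adm p t w'.
Proof.
move=> h [K [h1 h2]]; exists K; split=> // i ip.
by apply: leq_ltn_trans (h1 i ip); rewrite leq_add2r h.
Qed.

(** A node with the first exponent missing at or above that of [i0] pays for a
    content larger by [q - 1] at [i0]: the additional carry is at most one, it
    runs through the exponents in between, and the new node, which received no
    carry before, absorbs it. *)
Lemma adm_insert p t t' w w' i0 :
  adm p t w -> (t' i0 <= t' p)%N ->
  (forall i, (i < p)%N -> t' i = t i) ->
  (forall i, (i < p)%N -> t i <> t' p) ->
  (forall e, (t' i0 <= e < t' p)%N -> exists2 i, (i < p)%N & t i = e) ->
  (forall i, (i < p)%N -> (w' i <= w i + (q - 1) * (i == i0))%N) ->
  (w' p <= (q - 1) * (p == i0))%N ->
  adm p.+1 t' w'.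
Proof.
move=> [K [h1 h2]] hi0 ht hf hfill hw hwp.
(* When [i0] is the new node itself, [K] stays as it is. *)
pose K' e := (K e + (t' i0 < e <= t' p))%N.
exists K'; split=> [i|e he]; last first.
  rewrite /K' h2 => [|i ip]; last by rewrite -ht //; apply: he; lia.
  case: (ltngtP e (t' p)) => [h|h|h]; rewrite ?andbF //; last first.
    by case: (he p) => //.
  rewrite andbT; case: ltnP => // hlt.
  have [|i ip hie] := hfill e; first by lia.
  by case: (he i); [lia|rewrite ht].
rewrite ltnS leq_eqVlt => /orP[/eqP -> | ip].
  have hK : K (t' p) = 0%N by apply: h2.
  rewrite /K' hK; move: hwp; case: eqP => [<-|_] hwp.
    by rewrite ltnn; nia.
  by move: (_ < _ <= _)%N => u; nia.
have hi := hf i ip; rewrite -(ht i ip) in hi.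
have := h1 i ip; have := hw i ip; rewrite /K' -(ht i ip).
have [ei|ne] := eqVneq i i0.
  rewrite -ei in hi0 *; have -> : (t' i < (t' i).+1 <= t' p)%N by lia.
  by rewrite ltnn; nia.
case: (ltngtP (t' i0) (t' i)) => h; case: (ltngtP (t' i) (t' p)) => h' //=;
  nia.
Qed.

(** A nonzero carry out of [a] forces [K (t a).+1] to be positive, so this is the
    exponent of some node. *)
Lemma adm_carry_room p t (c : nat -> int) (s : nat -> nat) a (r k : int) :
  adm p t (fun i => `|c i| + s i)%N -> (a < p)%N ->
  `|c a|%N = (`|r| + q * `|k|)%N -> k != 0 ->
  exists2 b, (b < p)%N & t b = (t a).+1.
Proof.
move=> [K [h1 h2]] ap hc k0.
have [/hasP[b]|/hasPn h] := boolP (has (fun b => t b == (t a).+1) (iota 0 p)).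
  by rewrite mem_iota add0n => /andP[_ bp] /eqP e; exists b.
have K0 : K (t a).+1 = 0%N.
  by apply: h2 => i ip; apply/eqP/h; rewrite mem_iota.
by have := h1 a ap; rewrite K0 hc; nia.
Qed.

(** The carry [k] that has been executed no longer has to be expected, so [K] can
    be lowered by [|k|] at its target, where the content grows by at most that
    much.  The slack [s] is not touched. *)
Lemma adm_carry p t (c : nat -> int) (s : nat -> nat) a b (r k : int) :
  (forall i j, (i < p)%N -> (j < p)%N -> t i = t j -> i = j) ->
  adm p t (fun i => `|c i| + s i)%N -> (a < p)%N -> (b < p)%N ->
  t b = (t a).+1 -> `|c a|%N = (`|r| + q * `|k|)%N ->
  adm p t (fun i => `|upd (upd c a r) b (c b + k) i| + s i)%N.
Proof.
move=> tinj [K [h1 h2]] ap bp tb hc.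
have kK : (`|k| <= K (t b))%N by have := h1 a ap; rewrite hc -tb; nia.
exists (fun e => if e == t b then (K e - `|k|)%N else K e).
split=> [i ip|e he].
  have := h1 i ip; rewrite /upd.
  have ab : a == b = false by apply/eqP => ab; move: tb; rewrite ab; lia.
  have [->|nb] := eqVneq i b.
    have -> : ((t b).+1 == t b) = false by lia.
    by rewrite eqxx; nia.
  have -> : (t i == t b) = false by apply/eqP => /(tinj _ _ ip bp); apply/eqP.
  have [->|na] := eqVneq i a.
    by rewrite -tb eqxx hc; nia.
  suff -> : ((t i).+1 == t b) = false by [].
  by apply/eqP; rewrite tb => -[] /(tinj _ _ ip ap); apply/eqP.
by rewrite h2 //; case: eqP.
Qed.

(** Over the exponents [0, ..., n - 1] the bounds are the carries of schoolbook
    addition; the last one vanishes since the total is below [q ^ n]. *)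
Lemma adm_base (w : nat -> nat) n : (\sum_(j < n) w j * q ^ j < q ^ n)%N ->
  adm n id w.
Proof.
move=> hn; pose S i := (\sum_(j < i) w j * q ^ j)%N.
exists (fun e => if (e < n)%N then (S e %/ q ^ e)%N else 0%N);
  split=> [i ip|e he].
  have E : (w i + S i %/ q ^ i < q * (S i.+1 %/ q ^ i.+1).+1)%N.
    have -> : (w i + S i %/ q ^ i = S i.+1 %/ q ^ i)%N.
      rewrite /S big_ord_recr /= divnDMl ?expn_gt0; lia.
    rewrite expnSr divnMA; move: (_ %/ q ^ i)%N => x.
    by have := divn_eq x q; have := ltn_pmod x (ltnW q2); nia.
  rewrite /= ip; case: (ltnP i.+1 n) => // h; move: E.
  have -> : i.+1 = n by lia.
  by rewrite [(S n %/ _)%N]divn_small.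
by case: ltnP => // h; case: (he e).
Qed.

Definition qval (p : nat) (t : nat -> nat) (c : nat -> int) : int :=
  \sum_(j < p) c j * q%:Z ^+ t j.

Lemma qval_upd p t c a z : (a < p)%N ->
  qval p t (upd c a z) = qval p t c + (z - c a) * q%:Z ^+ t a.
Proof.
move=> ap; rewrite /qval (bigD1 (Ordinal ap)) //= [in RHS](bigD1 (Ordinal ap))
  //=.
rewrite /upd eqxx; set S := \sum_(_ < _ | _) _; set S' := \sum_(_ < _ | _) _.
suff -> : S = S' by ring.
by apply: eq_bigr => i hi; rewrite ifN //.
Qed.

Lemma qval_carry p t c a b (r k : int) : (a < p)%N -> (b < p)%N ->
  t b = (t a).+1 -> c a = r + q%:Z * k ->
  qval p t (upd (upd c a r) b (c b + k)) = qval p t c.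
Proof.
move=> ap bp tb hc; rewrite !qval_upd // /upd.
have -> : b == a = false by apply/eqP => ab; move: tb; rewrite ab; lia.
rewrite hc tb exprS; ring.
Qed.

Lemma eq_qval p t t' c c' : (forall j, (j < p)%N -> c j = c' j) ->
  (forall j, (j < p)%N -> t j = t' j) -> qval p t c = qval p t' c'.
Proof. by move=> h1 h2; apply: eq_bigr => i _; rewrite h1 ?h2. Qed.

Lemma qval_digits n k : (k < q ^ n)%N ->
  qval n id (fun j => (k %/ q ^ j %% q)%N%:Z) = k%:Z.
Proof.
move=> kn; suff <- : (k %% q ^ n)%N%:Z = qval n id (fun j =>
  (k %/ q ^ j %% q)%N%:Z).
  by rewrite modn_small.
elim: n {kn} => [|n IH]; first by rewrite /qval big_ord0 expn0 modn1.
have -> : (k %% q ^ n.+1 = k %% q ^ n + (k %/ q ^ n %% q) * q ^ n)%N.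
  rewrite expnS; have e0 : (0 < q ^ n)%N by rewrite expn_gt0; lia.
  have h1 := divn_eq k (q ^ n); have h2 := divn_eq (k %/ q ^ n) q.
  have h3 := ltn_pmod k e0; have h4 := ltn_pmod (k %/ q ^ n) (ltnW q2).
  have {1}-> : k = (k %/ q ^ n %/ q * (q * q ^ n) +
      (k %/ q ^ n %% q * q ^ n + k %% q ^ n))%N by nia.
  rewrite modnMDl modn_small; first by rewrite addnC.
  by move: h3 h4; move: (k %/ q ^ n %% q)%N (k %% q ^ n)%N => x y; nia.
by rewrite PoszD IH /qval big_ord_recr PoszM -!natz !natrX /=.
Qed.

(** Rewriting a marking of the input over the nodes [nd v] that stand for the
    input nodes [v] keeps its value, although [nd] need not be injective. *)
Lemma qval_pull p t n (d : nat -> int) (nd : nat -> nat) :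
  (forall v, (v < n)%N -> d v != 0 -> (nd v < p)%N) ->
  qval p t (fun i => \sum_(v < n | nd v == i) d v) =
  \sum_(v < n) d v * q%:Z ^+ t (nd v).
Proof.
move=> h; rewrite /qval.
under eq_bigr do rewrite big_mkcond mulr_suml.
rewrite exchange_big /=; apply: eq_bigr => v _.
have [->|d0] := eqVneq (d v) 0.
  by rewrite mul0r big1 // => i _; rewrite if_same mul0r.
rewrite (bigD1 (Ordinal (h v (ltn_ord v) d0))) //= eqxx big1 ?addr0 // => i hi.
rewrite ifN ?mul0r //; apply: contra hi => /eqP e.
by apply/eqP/val_inj => /=; rewrite e.
Qed.

End Capacity.

(** * Reduced circuits in the making *)

Section Structure.

Variables q W : nat.
Hypothesis q2 : (2 <= q)%N.

Lemma qval_perm p t c o : (forall i, (i < p)%N -> (o i < p)%N) ->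
  (forall i j, (i < j < p)%N -> (t (o i) < t (o j))%N) ->
  qval q p t c = \sum_(i < p) c (o i) * q%:Z ^+ t (o i).
Proof.
move=> ho hinc; pose h (i : 'I_p) := Ordinal (ho i (ltn_ord i)).
have hinj : injective h.
  move=> i j /(congr1 val) /= e; apply: val_inj => /=.
  case: (ltngtP i j) => // ij.
    by have := hinc i j; rewrite ij ltn_ord e ltnn => /(_ isT).
  by have := hinc j i; rewrite ij ltn_ord e ltnn => /(_ isT).
by rewrite /qval (reindex h) //; apply: onW_bij; apply: injF_bij.
Qed.

(** The first [p] nodes form a reduced circuit: [t] are the exponents, [R i] is
    the successor marking of node [i], [o] lists the nodes by increasing value
    and [b] holds the bit vector, indexed by nodes rather than by positions so
    that it need not be shifted.  [g_low] makes the graph acyclic. *)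
Record good (p : nat) (t : nat -> nat) (R : nat -> nat -> int) (o : nat -> nat)
    (b : nat -> bool) : Prop := Good {
  g_dig : forall i j, (i < p)%N -> (j < W)%N -> (`|R i j| < q)%N;
  g_low : forall i j, (i < p)%N -> (j < W)%N -> R i j != 0 -> (j < i)%N;
  g_val : forall i, (i < p)%N -> qval q p t (R i) = (t i)%:Z;
  g_o : forall i, (i < p)%N -> (o i < p)%N;
  g_inc : forall i j, (i < j < p)%N -> (t (o i) < t (o j))%N;
  g_onto : forall x, (x < p)%N -> exists2 i, (i < p)%N & o i = x;
  g_bit : forall x, (x < p)%N ->
    b x = has (fun y => t y == (t x).+1) (iota 0 p)
}.

Section Good.

Variables (p : nat) (t : nat -> nat) (R : nat -> nat -> int) (o : nat -> nat)
  (b : nat -> bool).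
Hypothesis G : good p t R o b.

Lemma good_incE i j : (i < p)%N -> (j < p)%N ->
  (t (o i) < t (o j))%N = (i < j)%N.
Proof.
move=> ip jp; case: (ltngtP i j) => [h|h|->]; last by rewrite ltnn.
- by rewrite (g_inc G) // h.
- have : (t (o j) < t (o i))%N by rewrite (g_inc G) // h.
  by rewrite ltnNge => h'; apply/negbTE; move: h'; apply: contra; apply: ltnW.
Qed.

Lemma good_inj i j : (i < p)%N -> (j < p)%N -> t i = t j -> i = j.
Proof.
move=> /(g_onto G)[i' ip <-] /(g_onto G)[j' jp <-] e.
congr o; case: (ltngtP i' j') => // h; move: (h).
  by rewrite -good_incE // e ltnn.
by rewrite -good_incE // e ltnn.
Qed.

Lemma good_oinj i j : (i < p)%N -> (j < p)%N -> o i = o j -> i = j.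
Proof.
move=> ip jp e; case: (ltngtP i j) => // h; move: (h).
  by rewrite -good_incE // e ltnn.
by rewrite -good_incE // e ltnn.
Qed.

Lemma good_next i x : (i < p)%N -> (x < p)%N -> t x = (t (o i)).+1 ->
  (i.+1 < p)%N /\ o i.+1 = x.
Proof.
move=> ip /(g_onto G)[j jp <-] e.
have ij : (i < j)%N by rewrite -good_incE // e.
have [h|h|-> //] := ltngtP i.+1 j; last by move: ij; rewrite ltnNge -ltnS h.
have h1 : (t (o i) < t (o i.+1))%N by rewrite good_incE //; lia.
have h2 : (t (o i.+1) < t (o j))%N by rewrite good_incE //; lia.
by move: h2; rewrite e ltnS leqNgt h1.
Qed.

Lemma good_bitP x : (x < p)%N ->
  reflect (exists2 y, (y < p)%N & t y = (t x).+1) (b x).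
Proof.
move=> xp; rewrite (g_bit G) //; apply: (iffP hasP) => [[y]|[y yp e]].
  by rewrite mem_iota add0n => /andP[_ yp] /eqP e; exists y.
by exists y; [rewrite mem_iota | rewrite e].
Qed.

Lemma good_bit_next i : (i.+1 < p)%N ->
  b (o i) = (t (o i.+1) == (t (o i)).+1).
Proof.
move=> ip; apply/good_bitP/eqP; first exact/(g_o G)/ltnW.
  by move=> [y yp e]; have [_ ->] := good_next (ltnW ip) yp e.
by move=> e; exists (o i.+1) => //; apply: (g_o G).
Qed.

(** Only the bits of the new node and of its left neighbour can change. *)
Lemma good_insert pos f (d : nat -> int) t' R' o' b' :
  (pos <= p)%N ->
  (forall i, (i < pos)%N -> (t (o i) < f)%N) ->
  (forall i, (pos <= i < p)%N -> (f < t (o i))%N) ->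
  (forall j, (j < W)%N -> (`|d j| < q)%N) ->
  (forall j, (j < W)%N -> d j != 0 -> (j < p)%N) ->
  qval q p t d = f%:Z ->
  (p < W)%N ->
  (forall i, (i < p)%N -> t' i = t i) -> t' p = f ->
  (forall i j, (i < p)%N -> (j < W)%N -> R' i j = R i j) ->
  (forall j, (j < W)%N -> R' p j = d j) ->
  (forall i, (i < pos)%N -> o' i = o i) -> o' pos = p ->
  (forall i, (pos <= i < p)%N -> o' i.+1 = o i) ->
  b' p = (pos < p)%N && (t (o pos) == f.+1) ->
  (forall x, (x < p)%N ->
     b' x = b x || [&& (0 < pos)%N, x == o pos.-1 & f == (t x).+1]) ->
  good p.+1 t' R' o' b'.
Proof.
move=> pp hlo hhi dq dlow dval pW t1 t2 R1 R2 o1 o2 o3 b1 b2.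
have ot i : (i <= p)%N ->
    [\/ (i < pos)%N /\ o' i = o i, i = pos /\ o' i = p |
        (pos < i)%N /\ o' i = o i.-1].
  move=> ip; case: (ltngtP i pos) => h.
  - by apply: Or31; rewrite o1.
  - by apply: Or33; case: i ip h => // i ip h; rewrite o3 //; lia.
  - by apply: Or32; rewrite h.
have op i : (i < p)%N -> (o i < p)%N by apply: (g_o G).
have tne x : (x < p)%N -> t x <> f.
  move=> /(g_onto G)[i ip <-]; case: (ltnP i pos) => h.
    by have := hlo i h; lia.
  by have := hhi i; rewrite h ip => /(_ isT); lia.
have ext c : (c p = 0) -> qval q p.+1 t' c = qval q p t c.
  move=> c0; rewrite /qval big_ord_recr /= c0 mul0r addr0.
  by apply: eq_bigr => j _; rewrite t1.
split.
- move=> i j; rewrite ltnS leq_eqVlt => /orP[/eqP ->|ip] jW;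
    first by rewrite R2 ?dq.
  by rewrite R1 // (g_dig G).
- move=> i j; rewrite ltnS leq_eqVlt => /orP[/eqP ->|ip] jW;
    first by rewrite R2 //; apply: dlow.
  by rewrite R1 //; apply: (g_low G).
- move=> i; rewrite ltnS leq_eqVlt => /orP[/eqP ->|ip].
    rewrite ext ?t2 -?dval; last first.
      by rewrite R2 //; apply/eqP; apply: contraTT isT => /(dlow _ pW);
        rewrite ltnn.
    by apply: eq_qval => // j jp; apply: R2; apply: ltn_trans pW.
  rewrite t1 // ext -?(g_val G ip); last first.
    rewrite R1 //; apply/eqP; apply: contraTT isT => /(g_low G ip pW) h.
    by rewrite ltnNge (ltnW ip) in h.
  by apply: eq_qval => // j jp; apply: R1 => //; apply: ltn_trans pW.
- move=> i ip; case: (ot i ip) => [[h ->]|[h ->]|[h ->]] //.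
    by apply: leqW; apply: op; lia.
  by apply: leqW; apply: op; lia.
- move=> i j /andP[ij jp].
  case: (ot i) => [|[hi ->]|[hi ->]|[hi ->]]; first lia;
  case: (ot j) => [|[hj ->]|[hj ->]|[hj ->]]; try lia.
  + by rewrite !t1 ?(g_inc G) ?op ?ij //; lia.
  + by rewrite t1 ?op ?t2 ?hlo //; lia.
  + by rewrite !t1 ?(g_inc G) ?op //; lia.
  + by rewrite t2 t1 ?op ?hhi //; lia.
  + by rewrite !t1 ?(g_inc G) ?op //; lia.
- move=> x; rewrite ltnS leq_eqVlt => /orP[/eqP ->|xp]; first by exists pos.
  have [i ip <-] := g_onto G xp; case: (ltnP i pos) => h.
    by exists i; [lia|rewrite o1].
  by exists i.+1; [lia|rewrite o3 // h].
- have hasS x : (x <= p)%N -> has (fun y => t' y == (t' x).+1) (iota 0 p.+1) =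
      has (fun y => t y == (t' x).+1) (iota 0 p) || (f == (t' x).+1).
    move=> xp; rewrite -[p.+1]addn1 iotaD has_cat /= add0n t2 orbF; congr orb.
    by apply: eq_in_has => y; rewrite mem_iota add0n => /andP[_ yp]; rewrite t1.
  move=> x; rewrite ltnS leq_eqVlt => /orP[/eqP ->|xp].
    rewrite hasS // t2 b1 [f == _](_ : _ = false) ?orbF; last by lia.
    apply/andP/hasP => [[h e]|[y]].
      by exists (o pos) => //; rewrite mem_iota op.
    rewrite mem_iota add0n => /andP[_ /(g_onto G)[i ip <-]] /eqP e.
    have pi : (pos <= i)%N by rewrite leqNgt; apply/negP => /hlo; lia.
    case: (ltngtP pos i) pi => // [h _|-> _]; last by rewrite e ip.
    have := g_inc G (i := pos) (j := i); rewrite h ip e => /(_ isT).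
    by have := hhi pos; rewrite leqnn (ltn_trans h ip) => /(_ isT); lia.
  rewrite hasS ?(ltnW xp) // b2 // (t1 _ xp) -(g_bit G xp); congr orb.
  case: (f =P _) => [e|_]; last by rewrite !andbF.
  rewrite andbT; have [i ip ex] := g_onto G xp.
  have ilt : (i < pos)%N.
    rewrite ltnNge; apply/negP => h; have := hhi i; rewrite h ip ex e =>
      /(_ isT).
    lia.
  rewrite (leq_ltn_trans _ ilt) //=; apply/eqP; rewrite -ex; congr o.
  apply/eqP; rewrite eqn_leq; apply/andP; split; first by lia.
  rewrite leqNgt; apply/negP => h; have := hlo pos.-1.
  have := g_inc G (i := i) (j := pos.-1); rewrite h ex e.
  by case: (ltnP pos.-1 p) => [_ /(_ isT)|]; lia.
Qed.

End Good.

(** Node [k] refers to the nodes [j] below it only, because [k < q ^ k]. *)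
Lemma good_base n o : (n <= W)%N -> (forall i, (i < n)%N -> o i = i) ->
  good n id (fun k j => if (j < n)%N then (k %/ q ^ j %% q)%N%:Z else 0) o
    (fun x => (x.+1 < n)%N).
Proof.
move=> nW ho; have qk k : (k < q ^ k)%N by apply: ltn_expl.
split=> //= [i j _ _|i j ip _|i ip|i ip|i j /andP[ij jp]|x xp|x xp].
- by case: ifP => _ /=; rewrite ?ltn_mod; lia.
- case: ltnP => // _ h; rewrite ltnNge; apply/negP => ij.
  move: h; rewrite divn_small ?mod0n //.
  by apply: leq_trans (qk i) _; rewrite leq_exp2l.
- rewrite -[RHS](@qval_digits q q2 n i).
    by apply: eq_qval => // j ->.
  by apply: ltn_trans ip (qk n).
- by rewrite ho.
- by rewrite !ho //; apply: ltn_trans jp.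
- by exists x; rewrite ?ho.
- apply/idP/hasP => [h|[y]]; first by exists x.+1 => //; rewrite mem_iota.
  by rewrite mem_iota add0n => h /eqP <-.
Qed.

End Structure.

(** * Comparison digit by digit *)
Section Compare.

Variable q : nat.
Hypothesis q2 : (2 <= q)%N.

(** [V] is the difference of the parts read so far and [Q] the value of the
    current position: [acc] is [V / Q] as long as this is at most [1] in absolute
    value, and beyond that only the sign of [acc] counts. *)
Definition cmp_inv (acc V Q : int) : Prop :=
  (`|acc| <= 1 /\ V = acc * Q) \/ (2%:Z <= acc /\ Q *+ 2 <= V) \/
  (acc <= - 2%:Z /\ V <= - (Q *+ 2)).

(** The bit [b] tells whether the position of [d] is lower than the previous one
    by a factor of exactly [q]; if not, the factor is at least [q ^ 2] and a
    difference of one unit becomes decisive. *)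
Definition cmp_step (acc d : int) (b : bool) : int :=
  if acc == 0 then d
  else if `|acc| == 1 then (if b then acc * q%:Z + d else acc *+ 2) else acc.

(** The difference of two digits is at most [2 * (q - 1)] in absolute value, and
    [2 * q - 2 * (q - 1) = 2]: a lead of two units is never lost.  A lead of one
    unit across a gap becomes at least [q ^ 2 - 2 * (q - 1) >= 2]. *)
Lemma cmp_stepP acc V Q m d (b : bool) : 0 < Q -> cmp_inv acc V (m * Q) ->
  (`|d| <= 2 * (q - 1))%N ->
  (acc <> 0 -> if b then m = q%:Z else (q * q)%N%:Z <= m) ->
  cmp_inv (cmp_step acc d b) (V + d * Q) Q.
Proof.
move=> Q0 hV hd hm.
have self a : cmp_inv a (a * Q) Q.
  have [h|h] := lerP `|a| 1; first by left.
  right; have [h2|h2] := lerP 2%:Z a; [left|right]; split=> //; nia.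
rewrite /cmp_step; case: eqP => [a0|a0].
  by case: hV => [[_ ->]|[[]|[]]]; rewrite ?a0 ?mul0r ?add0r //; lia.
have hq : q%:Z <= m by move: (hm a0); case: (b); nia.
have mQ : q%:Z * Q <= m * Q by rewrite ler_pM2r.
have dQ : `|d * Q| <= (2 * (q - 1))%N%:Z * Q.
  by rewrite normrM (gtr0_norm Q0) ler_pM2r //; lia.
case: hV => [[h1 ->]|[[h1 h2]|[h1 h2]]]; last first.
- rewrite ifN; last by lia.
  by right; right; split=> //; nia.
- rewrite ifN; last by lia.
  by right; left; split=> //; nia.
have a1 : `|acc| == 1 by lia.
rewrite a1; have := hm a0; case: (b) => [->|hm2].
  by rewrite mulrA -mulrDl; apply: self.
have mQ2 : (q * q)%N%:Z * Q <= m * Q by rewrite ler_pM2r.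
have [ap|an] := ltP 0 acc.
  have -> : acc = 1 by lia.
  by right; left; split=> //; nia.
have -> : acc = -1 by lia.
by right; right; split=> //; nia.
Qed.

End Compare.

(** * The program *)

Declare Scope exp_scope.
Delimit Scope exp_scope with E.
Bind Scope exp_scope with exp.
Infix "+" := EAdd : exp_scope.
Infix "-" := ESub : exp_scope.
Coercion EV : var >-> exp.
Coercion num (k : nat) : exp := EC k%:Z.
Infix ";;" := Seq (at level 90, right associativity).

Definition mat (a : arr) (i j : exp) : exp := EA a (EA aMul i + j).
Definition Sto2 (a : arr) (i j e : exp) : cmd := Sto a (EA aMul i + j) e.
(** The only test of the language is positivity. *)
Definition IfNz (e : exp) (c : cmd) : cmd := If e c (If (num 0 - e) c Skip).

Section Program.

Variable q : nat.

(** After this, [vw] is the row length [2n], [vh] the number of input rows and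
    [vx] the size of the tables. *)
Definition c_sizes : cmd :=
  Read vn ;; Read vm ;; Asg vw (vn + vn) ;; Asg vh (vn + vm) ;;
  Asg vx (vh + num 1) ;; For vi (num q) (Asg vx (vx + vw)).

Definition c_mul : cmd :=
  Asg ve (num 0) ;;
  For vi vx (Sto aMul vi ve ;; Asg ve (ve + vw)).

Definition c_div (a : arr) (d : nat) : cmd :=
  Asg vz (num 0) ;; Asg vr (num 0) ;;
  For vi vx
    (Sto a vi vz ;; Sto aRem vi vr ;; Asg vr (vr + num 1) ;;
     If (vr - num d.-1) (Asg vr (num 0) ;; Asg vz (vz + num 1)) Skip).

Definition c_log : cmd :=
  Asg vlg (num 0) ;; Asg vpw (num 1) ;;
  For vi vx
    (If (vi + num 1 - vpw) (Asg vpw (vpw + vpw) ;; Asg vlg (vlg + num 1)) Skip).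

(* The second division table overwrites the remainders of the first. *)
Definition c_tables : cmd :=
  c_sizes ;; c_mul ;; c_div aHalf 2 ;; c_div aQuo q ;; c_log.

(** Row [u] of [aD] is the [u]-th marking of the input, those of the nodes coming
    first; [aCnt u] counts the successors of [u] not yet handled. *)
Definition c_read : cmd :=
  For vu vh
    (Read vk ;; Sto aCnt vu vk ;;
     For vj vk (Read vd ;; Read ve ;; Sto2 aD vu vd ve)).

Definition c_base : cmd :=
  For vu vn
    (Asg vc vu ;;
     For vj vn (Sto2 aR vu vj (EA aRem vc) ;; Asg vc (EA aQuo vc)) ;;
     Sto aOrd vu vu ;;
     If (vn - vu - num 1) (Sto aBit vu (num 1)) Skip).

Definition c_pick : cmd :=
  Asg vu (num 0) ;;
  For vi vn (If (num 1 - EA aDone vi - EA aCnt vi) (Asg vu vi) Skip).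

(** Rewrites input row [vu] over the nodes [aNode v] that stand for the input
    nodes, into row [vp]; entries may exceed the digits. *)
Definition c_pull : cmd :=
  For vj vw (Sto2 aR vp vj (num 0)) ;;
  For vj vn (Sto2 aR vp (EA aNode vj)
    (mat aR vp (EA aNode vj) + mat aD vu vj)).

(** Remainder and quotient are taken of the absolute value, so that signs agree
    and the content splits as [|c| = |r| + q * |k|].  In the last round the
    target of the carry does not exist, but the carry is zero then. *)
Definition c_norm : cmd :=
  For vj vp
    (Asg vd (EA aOrd vj) ;; Asg ve (EA aOrd (vj + num 1)) ;;
     Asg vc (mat aR vp vd) ;;
     If vc
       (Sto2 aR vp vd (EA aRem vc) ;;
        Sto2 aR vp ve (mat aR vp ve + EA aQuo vc))
       (Sto2 aR vp vd (num 0 - EA aRem vc) ;;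
        Sto2 aR vp ve (mat aR vp ve - EA aQuo vc))).

(** Unfolds [cmp_step] along the sorted order, from the top. *)
Definition c_cmp : cmd :=
  Asg vacc (num 0) ;;
  For vj vp
    (Asg vd (EA aOrd (vp - (vj + num 1))) ;;
     Asg ve (mat aR va vd - mat aR vb vd) ;;
     If vacc
       (If (vacc - num 1) Skip
         (If (EA aBit vd) (Asg vacc (num q + ve)) (Asg vacc (num 2))))
       (If (num 0 - vacc)
         (If (num 0 - vacc - num 1) Skip
           (If (EA aBit vd) (Asg vacc (ve - num q))
              (Asg vacc (num 0 - num 2))))
         (Asg vacc ve))).

(** The number of rounds is fixed beforehand, as a logarithm that suffices for
    the row length; rounds after the interval has become empty do nothing. *)
Definition c_search : cmd :=
  Asg vlo (num 0) ;; Asg vhi vp ;; Asg va vp ;;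
  For vi vlg
    (If (vhi - vlo)
      (Asg vmid (EA aHalf (vlo + vhi)) ;; Asg vb (EA aOrd vmid) ;; c_cmp ;;
       If vacc (Asg vlo (vmid + num 1)) (Asg vhi vmid))
      Skip).

Definition c_found : cmd :=
  Asg vfound (num 0) ;;
  If (vp - vlo)
    (Asg vb (EA aOrd vlo) ;; c_cmp ;;
     If vacc Skip (If (num 0 - vacc) Skip (Asg vfound (num 1))))
    Skip.

(** Climbs from position [vlo] to the end of its run of consecutive exponents,
    and stores the successor of the last one in row [vp]. *)
Definition c_extend : cmd :=
  For vi vp (If (EA aBit (EA aOrd vlo)) (Asg vlo (vlo + num 1)) Skip) ;;
  Asg vb (EA aOrd vlo) ;;
  For vj vw (Sto2 aR vp vj (mat aR vb vj)) ;;
  Sto2 aR vp (num 0) (mat aR vp (num 0) + num 1) ;;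
  c_norm ;; Asg vlo (vlo + num 1).

Definition c_place : cmd :=
  If vfound (Sto aNode vu (EA aOrd vlo) ;; c_extend) (Sto aNode vu vp).

(** A comparison returns exactly [1] if and only if the first number is one more
    than the second ([cmp_inv1]).  Bits are only set, as inserting nodes never resets one. *)
Definition c_bit : cmd :=
  c_cmp ;; If vacc (If (vacc - num 1) Skip (Sto aBit vc (num 1))) Skip.

Definition c_bits : cmd :=
  If (vp - vlo) (Asg va (EA aOrd vlo) ;; Asg vb vp ;; Asg vc vp ;;
    c_bit) Skip ;;
  If vlo (Asg va vp ;; Asg vb (EA aOrd (vlo - num 1)) ;; Asg vc vb ;; c_bit)
     Skip.

Definition c_shift : cmd :=
  For vi (vp - vlo) (Sto aOrd (vp - vi) (EA aOrd (vp - (vi + num 1)))) ;;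
  Sto aOrd vlo vp.

Definition c_finish : cmd :=
  Sto aDone vu (num 1) ;;
  For vi vn (IfNz (mat aD vi vu) (Sto aCnt vi (EA aCnt vi - num 1))).

Definition c_insert : cmd :=
  c_pick ;; c_pull ;; c_norm ;; c_search ;; c_found ;; c_place ;; c_bits ;;
  c_shift ;; c_finish.

Definition c_main : cmd := For vk vn (Asg vp (vn + vk) ;; c_insert).

Definition c_row : cmd :=
  Asg vcnt (num 0) ;;
  For vj vw (IfNz (mat aR vrow vj) (Asg vcnt (vcnt + num 1))) ;;
  Print vcnt ;;
  For vj vw (IfNz (mat aR vrow vj) (Print vj ;; Print (mat aR vrow vj))).

(** Row [2n], which belongs to no node, holds the markings one after the
    other. *)
Definition c_out : cmd :=
  Print vw ;; Print vm ;; Asg vp vw ;;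
  For vrow vw c_row ;;
  For vk vm (Asg vu (vn + vk) ;; c_pull ;; c_norm ;; Asg vrow vp ;; c_row) ;;
  For vj vw (Print (EA aOrd vj)) ;;
  For vj vw (If vj (Print (EA aBit (EA aOrd (vj - num 1)))) Skip).

Definition c_all : cmd := c_tables ;; c_read ;; c_base ;; c_main ;; c_out.

End Program.

(** * Derived rules and parameters *)
Lemma evD s e1 e2 : ev s (EAdd e1 e2) = ev s e1 + ev s e2.
Proof. by []. Qed.

Lemma evB s e1 e2 : ev s (ESub e1 e2) = ev s e1 - ev s e2.
Proof. by []. Qed.

Section DerivedRules.

Variable B : nat.

Lemma ok_asg_seq x e z c s T Q : ev s e = z -> (`|z| <= B)%N -> (0 < T)%N ->
  ok B c (setv s x z) T.-1 Q -> ok B (Seq (Asg x e) c) s T Q.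
Proof.
move=> h hB hT hok; apply: (@ok_seq _ _ _ _ 1) => //.
by apply: ok_asg => //; rewrite h // subn1.
Qed.

Lemma ok_asgE x e z s T (Q : st -> Prop) : ev s e = z -> (`|z| <= B)%N ->
  (0 < T)%N -> Q (setv s x z) -> ok B (Asg x e) s T Q.
Proof. by move=> h hB hT hok; apply: ok_asg; rewrite ?h. Qed.

Lemma ok_stoE a e1 e2 (i : nat) z s T (Q : st -> Prop) :
  ev s e1 = i%:Z -> ev s e2 = z -> (`|z| <= B)%N ->
  (0 < T)%N -> Q (seta s a i z) -> ok B (Sto a e1 e2) s T Q.
Proof. by move=> h1 h2 hB hT hok; apply: ok_sto; rewrite ?h1 ?h2. Qed.

Lemma ok_sto_seq a e1 e2 (i : nat) z c s T Q :
  ev s e1 = i%:Z -> ev s e2 = z -> (`|z| <= B)%N ->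
  (0 < T)%N -> ok B c (seta s a i z) T.-1 Q ->
  ok B (Seq (Sto a e1 e2) c) s T Q.
Proof.
move=> h1 h2 hB hT hok; apply: (@ok_seq _ _ _ _ 1) => //.
by apply: (ok_stoE (i := i) (z := z)); rewrite ?subn1.
Qed.

Lemma ok_print_seq e c s T Q : (0 < T)%N ->
  ok B c (seto s (rcons (so s) (ev s e))) T.-1 Q -> ok B (Seq (Print e) c) s T
    Q.
Proof.
move=> hT hok; apply: (@ok_seq _ _ _ _ 1) => //.
by apply: ok_print; rewrite ?subn1.
Qed.

Lemma ok_read_seq x z w c s T Q : si s = z :: w -> (`|z| <= B)%N -> (0 < T)%N ->
  ok B c (seti (setv s x z) w) T.-1 Q -> ok B (Seq (Read x) c) s T Q.
Proof.
move=> h1 h2 hT hok; apply: (@ok_seq _ _ _ _ 1) => //.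
by apply: (ok_read (z := z) (w := w)); rewrite ?subn1.
Qed.

(** Hands the frame of the first part to the rest: in this way facts on
    variables and arrays that a routine does not write pass through it. *)
Lemma ok_call c1 c2 s T1 T (Q1 Q : st -> Prop) : ok B c1 s T1 Q1 -> (T1 <= T)%N
  ->
  (forall s1, frame c1 s s1 -> Q1 s1 -> ok B c2 s1 (T - T1) Q) ->
  ok B (Seq c1 c2) s T Q.
Proof.
by move=> h1 hT h2; apply: ok_seq hT _; apply: ok_weaken h1 _ _ => // *;
  apply: h2.
Qed.

Lemma ok_le c s T T' (Q : st -> Prop) :
  ok B c s T Q -> (T <= T')%N -> ok B c s T' Q.
Proof. by move=> h hT; apply: ok_weaken h hT _. Qed.

Lemma ok_calls c1 c2 s T1 T2 (Q1 Q : st -> Prop) : ok B c1 s T1 Q1 ->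
  (forall s1, frame c1 s s1 -> Q1 s1 -> ok B c2 s1 T2 Q) ->
  ok B (Seq c1 c2) s (T1 + T2) Q.
Proof.
move=> h1 h2; apply: ok_call h1 (leq_addr _ _) _ => s1 f1 q1.
by rewrite addKn; apply: h2.
Qed.

Lemma ok_ifnz e c s T Q : (1 < T)%N -> (ev s e != 0 -> ok B c s (T - 2) Q) ->
  (ev s e = 0 -> Q s) -> ok B (IfNz e c) s T Q.
Proof.
move=> hT h1 h2; apply: ok_if => [|h|h]; first by lia.
  by apply: ok_weaken (h1 _) _ _ => //; lia.
apply: ok_if => [|h'|h'] ; first by lia.
  by apply: ok_weaken (h1 _) _ _ => //; [move: h'; rewrite /= | ]; lia.
by apply: ok_skip; apply: h2; move: h'; rewrite /=; lia.
Qed.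

End DerivedRules.

(** [B] bounds every stored value: the largest are the row offsets, multiples
    of [n + n] up to [table_size], and the doubled counter of [c_log]. *)
Definition table_size (q n m : nat) : nat := (n + m + 1 + q * (n + n))%N.

Record params (q n m B : nat) : Prop := Params {
  p_q : (2 <= q)%N;
  p_B1 : ((table_size q n m).+1 * (n + n) <= B)%N;
  p_B2 : (table_size q n m + table_size q n m + 4 * q + 4 <= B)%N
}.

Lemma good_ext q W p t R R' o b : (p <= W)%N ->
  (forall i j, (i < p)%N -> (j < W)%N -> R' i j = R i j) ->
  good q W p t R o b -> good q W p t R' o b.
Proof.
move=> pW e [g1 g2 g3 g4 g5 g6 g7]; split=> // [i j ip jW|i j ip jW|i ip].
- by rewrite e // g1.
- by rewrite e //; apply: g2.
- by rewrite -g3 //; apply: eq_qval => // j jp; rewrite e //;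
    apply: leq_trans pW.
Qed.

(** At the lowest position, of value [1], the accumulator tells the order of the
    two numbers and whether they are consecutive. *)
Lemma cmp_inv1 acc (E F : nat) : cmp_inv acc (E%:Z - F%:Z) 1 ->
  [/\ (0 < acc) = (F < E)%N, (acc < 0) = (E < F)%N & (acc == 1) = (E == F.+1)].
Proof.
by case=> [[h1 h2]|[[h1 h2]|[h1 h2]]]; split; lia.
Qed.

Lemma absz_sum n (P : pred 'I_n) (F : 'I_n -> int) k :
  (forall v, P v -> (`|F v| <= k)%N) ->
  (`|(\sum_(v < n | P v) F v)%R| <= k * \sum_(v < n | P v) 1)%N.
Proof.
move=> h; rewrite big_distrr /=.
elim/big_rec2: _ => // v x y Pv IH; have := h v Pv; lia.
Qed.

Lemma divn_succ i d : (0 < d)%N -> ((i.+1 %/ d)%N, (i.+1 %% d)%N) =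
  if ((i %% d).+1 == d)%N then ((i %/ d).+1%N, 0%N) else ((i %/ d)%N, (i %%
    d).+1%N).
Proof.
move=> d0; have := ltn_pmod i d0; have E := divn_eq i d.
case: eqP => [e _|ne lt].
  have -> : i.+1 = ((i %/ d).+1 * d)%N by rewrite {1}E -{2}e; lia.
  by rewrite mulnK // modnMl.
have -> : i.+1 = (i %/ d * d + (i %% d).+1)%N by rewrite {1}E addnS.
have lt2 : ((i %% d).+1 < d)%N by rewrite ltn_neqAle lt andbT; apply/eqP.
by rewrite divnMDl // modnMDl (divn_small lt2) (modn_small lt2) addn0.
Qed.

(** The encoding of one marking, over natural numbers. *)
Definition row_enc (n : nat) (d : nat -> int) (w : seq int) : Prop :=
  exists vs : seq nat, [/\ uniq vs,
    forall v, (v \in vs) = (v < n)%N && (d v != 0) &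
    w = (size vs)%:Z :: flatten [seq [:: v%:Z; d v] | v <- vs]].

(** The sparse form in which a row is printed. *)
Definition enc_row (k : nat) (d : nat -> int) : seq int :=
  let vs := [seq v <- iota 0 k | d v != 0] in
  (size vs)%:Z :: flatten [seq [:: v%:Z; d v] | v <- vs].

Lemma eq_enc_row k d d' : (forall j, (j < k)%N -> d j = d' j) ->
  enc_row k d = enc_row k d'.
Proof.
move=> e; rewrite /enc_row.
have -> : [seq v <- iota 0 k | d v != 0] = [seq v <- iota 0 k | d' v != 0].
  by apply: eq_in_filter => v; rewrite mem_iota add0n => /andP[_ vk]; rewrite e.
congr (_ :: flatten _); apply/eq_in_map => v; rewrite mem_filter mem_iota add0n.
by move=> /and3P[_ _ vk]; rewrite e.
Qed.

(** * Tables and rows in memory *)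

Section Verification.

Variables (q n m B : nat).
Hypothesis H : params q n m B.

Let q2 : (2 <= q)%N := p_q H.
Let B1 := p_B1 H.
Let B2 := p_B2 H.

Local Notation W := (n + n)%N.
Local Notation X := (table_size q n m).

Record tabs (s : st) : Prop := Tabs {
  tn : sv s vn = n%:Z;
  tm : sv s vm = m%:Z;
  tw : sv s vw = W%:Z;
  th : sv s vh = (n + m)%N%:Z;
  tmul : forall i, (i < X)%N -> ar s aMul i = (i * W)%N%:Z;
  thalf : forall i, (i < X)%N -> ar s aHalf i = (i %/ 2)%N%:Z;
  tquo : forall i, (i < X)%N -> ar s aQuo i = (i %/ q)%N%:Z;
  trem : forall i, (i < X)%N -> ar s aRem i = (i %% q)%N%:Z;
  tlog : exists2 lg : nat, sv s vlg = lg%:Z & (W < 2 ^ lg)%N /\ (lg <=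
    (trunc_log 2 X).+1)%N
}.

Definition tab_vars : seq var := [:: vn; vm; vw; vh; vlg].
Definition tab_arrs : seq arr := [:: aMul; aHalf; aQuo; aRem].

Lemma tabs_frame c s s' : frame c s s' -> all [predC wv c] tab_vars ->
  all [predC wa c] tab_arrs -> tabs s -> tabs s'.
Proof.
move=> f /= /and5P[h1 h2 h3 h4 /andP[h5 _]] /and5P[k1 k2 k3 k4 _] [].
move=> ? ? ? ? H1 H2 H3 H4 [lg e ?].
split; rewrite ?(frame_v f) //.
- by move=> i iX; rewrite (frame_a f) // H1.
- by move=> i iX; rewrite (frame_a f) // H2.
- by move=> i iX; rewrite (frame_a f) // H3.
- by move=> i iX; rewrite (frame_a f) // H4.
- by exists lg.
Qed.

Definition rowv (s : st) (a : arr) (i j : nat) : int := ar s a (i * W + j)%N.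

Lemma flat_inj i j i' j' : (j < W)%N -> (j' < W)%N ->
  (i * W + j == i' * W + j')%N = (i == i') && (j == j').
Proof.
move=> jW jW'; apply/eqP/andP => [e|[/eqP -> /eqP -> //]].
have W0 : (0 < W)%N by apply: leq_ltn_trans jW.
have : i = i'.
  by have := congr1 (divn ^~ W) e; rewrite /= !divnMDl // !divn_small // !addn0.
by move=> ei; split; apply/eqP => //; move: e; rewrite ei => /addnI.
Qed.

Arguments rowv : simpl never.

Lemma rowv_frame c s s' a i j : frame c s s' -> a \notin wa c ->
  rowv s' a i j = rowv s a i j.
Proof. by move=> f ha; rewrite /rowv (frame_a f). Qed.

Lemma rowv_seta s a i j b k l z : (j < W)%N -> (l < W)%N ->
  rowv (seta s a (i * W + j)%N z) b k l =
  if [&& b == a, k == i & l == j] then z else rowv s b k l.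
Proof. by move=> jW lW; rewrite /rowv /= flat_inj. Qed.

Lemma rowv_setv s x z a : rowv (setv s x z) a = rowv s a.
Proof. by []. Qed.

Lemma ev_idx s e1 e2 (i j : nat) : tabs s -> (i < X)%N ->
  ev s e1 = i%:Z -> ev s e2 = j%:Z ->
  ev s (EAdd (EA aMul e1) e2) = (i * W + j)%N%:Z.
Proof. by move=> t iX /= -> ->; rewrite tmul. Qed.

Lemma ev_mat s a e1 e2 (i j : nat) : tabs s -> (i < X)%N ->
  ev s e1 = i%:Z -> ev s e2 = j%:Z -> ev s (mat a e1 e2) = rowv s a i j.
Proof.
move=> t iX h1 h2; rewrite -[LHS]/(ar s a `|ev s (EAdd (EA aMul e1) e2)|%N).
by rewrite (ev_idx t iX h1 h2).
Qed.

Arguments ev_mat {s a e1 e2 i j}.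

Lemma ok_sto2 a e1 e2 e3 (i j : nat) z s T (Q : st -> Prop) :
  tabs s -> (i < X)%N -> ev s e1 = i%:Z -> ev s e2 = j%:Z -> ev s e3 = z ->
  (`|z| <= B)%N -> (0 < T)%N -> Q (seta s a (i * W + j) z) ->
  ok B (Sto2 a e1 e2 e3) s T Q.
Proof. by move=> t iX h1 h2 h3 hB hT h; apply: (ok_stoE (ev_idx t iX h1 h2)
  h3). Qed.

Lemma ok_sto2_seq a e1 e2 e3 (i j : nat) z c s T (Q : st -> Prop) :
  tabs s -> (i < X)%N -> ev s e1 = i%:Z -> ev s e2 = j%:Z -> ev s e3 = z ->
  (`|z| <= B)%N -> (0 < T)%N -> ok B c (seta s a (i * W + j) z) T.-1 Q ->
  ok B (Seq (Sto2 a e1 e2 e3) c) s T Q.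
Proof. by move=> t iX h1 h2 h3 hB hT h; apply: (ok_sto_seq (ev_idx t iX h1 h2)
  h3). Qed.

Lemma tabs_setv s x z : x \notin tab_vars -> tabs s -> tabs (setv s x z).
Proof.
move=> h; apply: (@tabs_frame (Asg x (EC z))) => //.
  by split=> //= y; rewrite inE; case: (y == x).
by apply/allP => y hy; rewrite /= inE; apply: contra h => /eqP <-.
Qed.

Lemma tabs_seta s a i z : a \notin tab_arrs -> tabs s -> tabs (seta s a i z).
Proof.
move=> h; apply: (@tabs_frame (Sto a (EC 0) (EC z))) => //.
  by split=> //= y j; rewrite inE; case: (y == a).
by apply/allP => y hy; rewrite /= inE; apply: contra h => /eqP <-.
Qed.

Lemma tabs_seti s w : tabs s -> tabs (seti s w).
Proof. by move=> []; split. Qed.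

Lemma tabs_seto s o : tabs s -> tabs (seto s o).
Proof. by move=> []; split. Qed.

(** The list is padded by zeros, so that the position after the last one still
    names a row, namely that of node [0]. *)
Definition ordered (s : st) (p : nat) (o : nat -> nat) : Prop :=
  (forall i, ar s aOrd i = (o i)%:Z) /\ (forall i, (p <= i)%N -> o i = 0%N).

(** Entries are at most [q * n] at first, one more carry keeps them within
    [2 * q * n], for which the tables are large enough.  Nothing is lost at the top by
    [adm_carry_room], and the slack [sl] is as large afterwards as before. *)
Lemma norm_ok p t R o b sl s :
  tabs s -> sv s vp = p%:Z -> (p <= W)%N -> ordered s p o ->
  good q W p t R o b ->
  (forall j, (j < W)%N -> rowv s aR p j != 0 -> (j < p)%N) ->
  (forall j, (j < p)%N -> (`|rowv s aR p j| <= q * n)%N) ->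
  adm q p t (fun j => `|rowv s aR p j| + sl j)%N ->
  ok B c_norm s (10 * p + 2) (fun s' =>
    [/\ forall j, (j < W)%N -> (`|rowv s' aR p j| < q)%N,
        forall j, (j < W)%N -> rowv s' aR p j != 0 -> (j < p)%N,
        qval q p t (rowv s' aR p) = qval q p t (rowv s aR p),
        adm q p t (fun j => `|rowv s' aR p j| + sl j)%N &
        forall i j, (j < W)%N -> i != p -> rowv s' aR i j = rowv s aR i j]).
Proof.
move=> tb hp pW [ho ho0] G hlow hbnd hadm.
pose I i s1 := [/\
  (forall j, (j < W)%N -> rowv s1 aR p j != 0 -> (j < p)%N) /\
    (forall j, (j < i)%N -> (`|rowv s1 aR p (o j)| < q)%N),
  (forall j, (i < j < p)%N -> (`|rowv s1 aR p (o j)| <= q * n)%N) /\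
    ((i < p)%N -> (`|rowv s1 aR p (o i)| <= 2 * (q * n))%N),
  qval q p t (rowv s1 aR p) = qval q p t (rowv s aR p),
  adm q p t (fun j => `|rowv s1 aR p j| + sl j)%N &
  forall i j, (j < W)%N -> i != p -> rowv s1 aR i j = rowv s aR i j].
have op i : (i < p)%N -> (o i < p)%N by apply: (g_o G).
have qn : (q * n <= X)%N by rewrite /table_size; nia.
apply: (ok_for (k := p) (Tb := 8) (I := I)) => //=.
- by have := B2; rewrite /table_size; nia.
- rewrite /I rowv_setv; split=> //; split=> // [j /andP[_ jp]|ip].
    exact/hbnd/op.
  by have := hbnd _ (op _ ip); nia.
- move=> i s1 ip f hi [[I1 I1'] [I2 I2'] I3 I4 I5].
  have tb1 : tabs s1 by apply: tabs_frame f _ _ tb.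
  have hp1 : sv s1 vp = p%:Z by rewrite (frame_v f).
  have ho1 j : ar s1 aOrd j = (o j)%:Z by rewrite (frame_a f).
  set x := rowv s1 aR p (o i).
  have xb : (`|x| <= 2 * (q * n))%N by apply: I2'.
  have n0 : (0 < n)%N by lia.
  have pX : (p < X)%N by rewrite /table_size; nia.
  have oW j : (o j < W)%N.
    by case: (ltnP j p) => [/op|/ho0 ->]; lia.
  have xX : (`|x| < X)%N by rewrite /table_size; nia.
  have [p0 oi] : (0 < p)%N /\ (o i < p)%N by split; [lia|exact: op].
  pose s2 := setv (setv (setv s1 vd (o i)%:Z) ve (o i.+1)%:Z) vc x.
  have tb2 : tabs s2 by do 3!(apply: tabs_setv => //).
  have fin (r k : int) : x = r + q%:Z * k -> `|x|%N = (`|r| + q * `|k|)%N ->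
      (`|r| < q)%N -> let s3 := seta s2 aR (p * W + o i) r in
      (`|(rowv s3 aR p (o i.+1) + k)%R| <= B)%N /\
      I i.+1 (setv (seta s3 aR (p * W + o i.+1) (rowv s3 aR p (o i.+1) + k)) vj
        i.+1%:Z).
    move=> xE xA rq s3.
    pose c1 := rowv s1 aR p; pose c2 := upd c1 (o i) r.
    have kqn : (`|k| <= q * n)%N by nia.
    have e3 j : (j < W)%N -> rowv s3 aR p j = c2 j.
      by move=> jW; rewrite /s3 rowv_seta // eqxx /= /c2 /upd; case: eqP.
    pose c3 := upd c2 (o i.+1) (c2 (o i.+1) + k).
    pose s4 := setv (seta s3 aR (p * W + o i.+1) (rowv s3 aR p (o i.+1) + k))
      vj i.+1%:Z.
    have e4 j : (j < W)%N -> rowv s4 aR p j = c3 j.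
      move=> jW; rewrite /s4 rowv_setv rowv_seta // !eqxx /= /c3 /upd.
      by case: eqP => _; rewrite e3.
    have e34 i' j : (j < W)%N -> i' != p -> rowv s4 aR i' j = rowv s aR i' j.
      move=> jW ne; rewrite /s4 rowv_setv !rowv_seta // (negbTE ne) /=;
        exact: I5.
    (* Without a carry, the target may be the padding of the list. *)
    have [k0|k0] := eqVneq k 0.
      have rx : r = c1 (o i) by rewrite /c1 -/x xE k0 mulr0 addr0.
      have e2 j : c2 j = c1 j by rewrite /c2 /upd; case: eqP => // ->.
      have e5 j : (j < W)%N -> rowv s4 aR p j = c1 j.
        by move=> /e4 ->; rewrite /c3 k0 addr0 /upd; case: eqP => [->|_];
          rewrite e2.
      split.
        rewrite e3 // e2 k0 addr0.
        have [i1p|pi1] := ltnP i.+1 p.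
          have : (`|c1 (o i.+1)| <= q * n)%N by apply: I2; rewrite ltnSn.
          by lia.
        rewrite ho0 //; have [l lp <-] := g_onto G p0.
        have [li|il] := ltnP l i; first by have := I1' l li; rewrite -/c1; lia.
        by have -> : l = i; [lia | rewrite /c1 -/x; lia].
      rewrite /I -/s4; split.
      + split=> [j jW|j ji]; first by rewrite e5 //; apply: I1.
        rewrite e5 //; have [->|ne] := eqVneq j i; first by rewrite -rx.
        by apply: I1'; lia.
      + split=> [j /andP[ij jp]|i1p].
          by rewrite e5 //; apply: I2; rewrite jp ltnW.
        by rewrite e5 //; apply: leq_trans (I2 i.+1 _) _; rewrite ?ltnSn //;
          lia.
      + by rewrite -I3; apply: eq_qval => // j jp; apply: e5;
          apply: leq_trans pW.
      + by apply: adm_le I4 => j jp; rewrite e5 //; apply: leq_trans pW.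
      + exact: e34.
    have hadm1 : `|c1 (o i)|%N = (`|r| + q * `|k|)%N by rewrite -xA.
    have [b' bp tb'] := adm_carry_room q2 I4 oi hadm1 k0.
    have [i1p eb] := good_next q2 G ip bp tb'.
    have bW : (b' < W)%N by rewrite -eb.
    have nb : b' == o i = false.
      by apply/eqP => h; move: tb'; rewrite h; lia.
    have c2b : c2 (o i.+1) = c1 b' by rewrite eb /c2 /upd nb.
    have c1b : (`|c1 b'| <= q * n)%N by rewrite -eb; apply: I2; rewrite ltnSn.
    have c3E j : c3 j = upd (upd c1 (o i) r) b' (c1 b' + k) j.
      by rewrite /c3 c2b eb.
    have oo j l : (j < p)%N -> (l < p)%N -> (o j == o l) = (j == l).
      by move=> jp lp; apply/eqP/eqP => [/(good_oinj G jp lp)|->].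
    split; first by rewrite e3 // c2b; lia.
    rewrite /I -/s4; split.
    + split=> [j jW|j ji].
        rewrite e4 // c3E /upd; case: (j =P b') => [-> //|_].
        case: (j =P o i) => [-> //|_].
        exact: I1.
      rewrite e4 // /c3 /c2 /upd !oo //; try lia.
      case: eqP => [|_]; first by lia.
      by case: eqP => // ne; apply: I1'; lia.
    + split=> [j /andP[ij jp]|_].
        rewrite e4 // /c3 /c2 /upd !oo //; try lia.
        rewrite !ifN; [|by lia|by lia].
        by apply: I2; lia.
      by rewrite e4 // /c3 {1}/upd eqxx c2b; lia.
    + rewrite -I3 -(qval_carry q2 oi bp tb' xE).
      by apply: eq_qval => // j jp; rewrite e4 ?c3E //; apply: leq_trans pW.
    + apply: adm_le (adm_carry q2 _ I4 oi bp tb' hadm1) => [j jp|].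
        by rewrite e4 ?c3E //; apply: leq_trans pW.
      exact: good_inj G.
    + exact: e34.
  apply: (ok_asg_seq (z := (o i)%:Z)) => //.
    by rewrite /= hi ho1.
    by have := oW i; have := B2; rewrite /table_size; nia.
  apply: (ok_asg_seq (z := (o i.+1)%:Z)) => //.
    by rewrite /= hi /= ho1 addn1.
    by have := oW i.+1; have := B2; rewrite /table_size; nia.
  have iX' : (p < X)%N by [].
  apply: (ok_asg_seq (z := x)) => //.
    by rewrite (ev_mat (i := p) (j := o i)) //; do 2!(apply: tabs_setv => //).
    by lia.
  rewrite -/s2; have xdiv := divn_eq `|x| q.
  have tb3 r : tabs (seta s2 aR (p * W + o i) r) by apply: tabs_seta.
  apply: ok_if => // hx.
    have {}hx : 0 < x := hx.
    have [|||h1 h2] := fin (`|x| %% q)%N%:Z (`|x| %/ q)%N%:Z;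
      rewrite ?absz_nat; try (by nia).
    apply: (ok_sto2_seq (i := p) (j := o i) (z := (`|x| %% q)%N%:Z)) => //.
    - by rewrite /= trem.
    - lia.
    apply: (ok_sto2 (i := p) (j := o i.+1) (tb3 _) _ _ _ _ h1) => //.
    by rewrite evD (ev_mat (i := p) (j := o i.+1)) //= tquo.
  have {}hx : x <= 0 := hx.
  have [|||h1 h2] := fin (- (`|x| %% q)%N%:Z) (- (`|x| %/ q)%N%:Z);
    rewrite ?abszN ?absz_nat; try (by nia).
  apply: (ok_sto2_seq (i := p) (j := o i) (z := - (`|x| %% q)%N%:Z)) => //.
  - by rewrite /= trem // sub0r.
  - lia.
  apply: (ok_sto2 (i := p) (j := o i.+1) (tb3 _) _ _ _ _ h1) => //.
  by rewrite evB (ev_mat (i := p) (j := o i.+1)) //= tquo.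
- move=> s1 f hi [[I1 I1'] _ I3 I4 I5]; split=> // j jW.
  have [jp|pj] := ltnP j p; first by have [i ip <-] := g_onto G jp; apply: I1'.
  have [->|h] := eqVneq (rowv s1 aR p j) 0; first by rewrite absz0; lia.
  by have := I1 j jW h; rewrite ltnNge pj.
- by lia.
Qed.

(** * Comparison and search *)

Record circuit (s : st) (p : nat) (t o : nat -> nat) (b : nat -> bool) : Prop :=
  Circuit {
  c_p : (0 < p <= W)%N;
  c_t0 : t 0%N = 0%N;
  c_ord : ordered s p o;
  c_bit_mem : forall i, (i < p)%N -> ar s aBit i = (b i : nat)%:Z;
  c_good : good q W p t (rowv s aR) o b
}.

Lemma circuit_ext s s' p t o b : circuit s p t o b ->
  (forall i, ar s' aOrd i = ar s aOrd i) ->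
  (forall i, (i < p)%N -> ar s' aBit i = ar s aBit i) ->
  (forall i j, (i < p)%N -> (j < W)%N -> rowv s' aR i j = rowv s aR i j) ->
  circuit s' p t o b.
Proof.
move=> [h1 h2 [h3 h3'] h4 h6] e1 e2 e3; split=> //.
- by split=> // i; rewrite e1.
- by move=> i ip; rewrite e2 // h4.
- by apply: good_ext h6 => //; case/andP: h1.
Qed.

Lemma circuit_frame c s s' p t o b : frame c s s' ->
  all [predC wa c] [:: aOrd; aBit; aR] -> circuit s p t o b ->
  circuit s' p t o b.
Proof.
move=> f /and4P[h1 h2 h3 _] h; apply: circuit_ext h _ _ _ => [i|i _|i j _ _].
- by rewrite (frame_a f).
- by rewrite (frame_a f).
- by rewrite (rowv_frame _ _ f).
Qed.

(** The least exponent is zero, so a comparison ends in units of one. *)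
Lemma circuit_o0 s p t o b : circuit s p t o b -> t (o 0%N) = 0%N.
Proof.
move=> [/andP[p0 _] t0 _ _ G]; have [i ip e] := g_onto G p0.
have [i0|i0] := posnP i; first by rewrite -{1}i0 e.
by have := g_inc G (i := 0%N) (j := i); rewrite i0 ip e t0 => /(_ isT).
Qed.

(** [V i] is the part of the difference from the [i] highest positions. *)
Lemma cmp_ok s p t o b a a' : tabs s -> circuit s p t o b -> sv s vp = p%:Z ->
  sv s va = a%:Z -> sv s vb = a'%:Z -> (a <= W)%N -> (a' <= W)%N ->
  (forall j, (j < p)%N -> (`|rowv s aR a j| < q)%N) ->
  (forall j, (j < p)%N -> (`|rowv s aR a' j| < q)%N) ->
  ok B (c_cmp q) s (10 * p + 3) (fun s' => cmp_inv (sv s' vacc)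
    (qval q p t (rowv s aR a) - qval q p t (rowv s aR a')) 1).
Proof.
move=> tb C hp ha hb aW aW' da db.
have G := c_good C; have /andP[p0 pW] := c_p C.
have [ho ho0] := c_ord C.
have op i : (i < p)%N -> (o i < p)%N by apply: (g_o G).
have WX : (W < X)%N by rewrite /table_size; nia.
pose d j := rowv s aR a j - rowv s aR a' j.
have db' j : (j < p)%N -> (`|d j| <= 2 * (q - 1))%N.
  by move=> jp; rewrite /d; have := da j jp; have := db j jp; lia.
pose V i := \sum_(j < i) d (o (p - j.+1)%N) * q%:Z ^+ t (o (p - j.+1)%N).
pose I i s1 := (`|sv s1 vacc| <= 3 * q)%N /\
  if i is i'.+1 then cmp_inv (sv s1 vacc) (V i) (q%:Z ^+ t (o (p - i)%N))
  else sv s1 vacc = 0.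
rewrite /c_cmp; apply: (ok_asg_seq (z := 0)) => //; first by lia.
apply: (ok_for (k := p) (Tb := 8) (I := I)) => //=; last by lia.
- lia.
- move=> i s1 ip f hi [I1 I2].
  have tb1 : tabs s1.
    by apply: tabs_frame f _ _ _ => //; apply: tabs_setv.
  have ho1 j : ar s1 aOrd j = (o j)%:Z by rewrite (frame_a f) //; apply: ho.
  have hp1 : sv s1 vp = p%:Z by rewrite (frame_v f).
  have ha1 : sv s1 va = a%:Z by rewrite (frame_v f).
  have hb1 : sv s1 vb = a'%:Z by rewrite (frame_v f).
  have hbit j : (j < p)%N -> ar s1 aBit j = (b j : nat)%:Z.
    by move=> jp; rewrite (frame_a f) //; apply: c_bit_mem C _ jp.
  have hrow i' j : rowv s1 aR i' j = rowv s aR i' j by rewrite (rowv_frame _ _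
    f).
  pose x := o (p - i.+1)%N.
  have xp : (x < p)%N by apply: op; lia.
  apply: (ok_asg_seq (z := x%:Z)) => //.
    by rewrite /= hp1 hi (_ : `|_|%N = (p - i.+1)%N) ?ho1 //; lia.
    by rewrite absz_nat; lia.
  pose s2 := setv s1 vd x%:Z.
  have tb2 : tabs s2 by apply: tabs_setv.
  apply: (ok_asg_seq (z := d x)) => //.
    have eA : ev s2 (mat aR va vd) = rowv s aR a x.
      by rewrite (ev_mat (i := a) (j := x) tb2) ?rowv_setv ?hrow //; lia.
    have eB : ev s2 (mat aR vb vd) = rowv s aR a' x.
      by rewrite (ev_mat (i := a') (j := x) tb2) ?rowv_setv ?hrow //; lia.
    by rewrite -/s2 evB eA eB.
    by have := db' x xp; lia.
  pose s3 := setv s2 ve (d x).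
  have fin s4 : sv s4 vacc = cmp_step q (sv s1 vacc) (d x) (b x) ->
      I i.+1 (setv s4 vj i.+1%:Z).
    move=> e4; rewrite /I /= e4; have dx := db' x xp; split.
      have I1' := I1; rewrite /cmp_step; move: (b x) => bx.
      case: ifP => h1; first by lia.
      by case: ifP => h2; [case: bx; lia | lia].
    rewrite /V big_ord_recr /= -/(V i) -/x.
    have Q0 : 0 < q%:Z ^+ t x by apply: exprn_gt0; lia.
    have [i0|i0] := posnP i.
      rewrite i0 in I2; rewrite I2 i0 /V big_ord0.
      by apply: (cmp_stepP q2 (m := 1)) => //; left; rewrite mul0r.
    pose y := o (p - i)%N; have ei : i = i.-1.+1 by lia.
    have {}I2 : cmp_inv (sv s1 vacc) (V i) (q%:Z ^+ t y).
      by move: I2; rewrite {1}ei.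
    have ey : (p - i = (p - i.+1).+1)%N by lia.
    have xy : (t x < t y)%N by apply: (g_inc G); lia.
    have bx : b x = (t y == (t x).+1).
      by rewrite /x (good_bit_next q2 G) -?ey //; lia.
    have hm : q%:Z ^+ t y = (q ^ (t y - t x))%N%:Z * q%:Z ^+ t x.
      by rewrite -!natz -!natrX -natrM -expnD subnK // ltnW.
    rewrite hm in I2; apply: (cmp_stepP q2 Q0 I2 dx) => _.
    rewrite bx; case: eqP => [-> | ne]; first by rewrite subSnn expn1.
    have : (q ^ 2 <= q ^ (t y - t x))%N by rewrite leq_exp2l //; lia.
    by rewrite expnS expn1; lia.
  apply: ok_if => // acc1; rewrite [ev _ _]/= in acc1.
    apply: ok_if => // acc2; rewrite [ev _ _]/= in acc2.
      apply: ok_skip; apply: fin; rewrite /= /cmp_step.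
      by rewrite !ifN //; lia.
    have e1 : sv s1 vacc = 1 by lia.
    apply: ok_if => // bx; rewrite /= hbit // /= in bx.
      apply: (ok_asgE (z := q%:Z + d x)) => //; first by have := db' x xp; lia.
      apply: fin; rewrite /= e1 /cmp_step /=.
      by rewrite (_ : b x = true) ?mul1r //; case: (b x) bx.
    apply: (ok_asgE (z := 2)) => //; first by lia.
    apply: fin; rewrite /= e1 /cmp_step /=.
    by rewrite (_ : b x = false) //; case: (b x) bx.
  apply: ok_if => // acc2; rewrite [ev _ _]/= in acc2.
    apply: ok_if => // acc3; rewrite [ev _ _]/= in acc3.
      apply: ok_skip; apply: fin; rewrite /= /cmp_step.
      by rewrite !ifN //; lia.
    have e1 : sv s1 vacc = -1 by lia.
    apply: ok_if => // bx; rewrite /= hbit // /= in bx.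
      apply: (ok_asgE (z := d x - q%:Z)) => //; first by have := db' x xp; lia.
      apply: fin; rewrite /= e1 /cmp_step /=.
      by rewrite (_ : b x = true) ?mulN1r 1?addrC //; case: (b x) bx.
    apply: (ok_asgE (z := - 2%:Z)) => //; first by lia.
    apply: fin; rewrite /= e1 /cmp_step /=.
    by rewrite (_ : b x = false) //; case: (b x) bx.
  have e1 : sv s1 vacc = 0 by lia.
  apply: (ok_asgE (z := d x)) => //; first by have := db' x xp; lia.
  by apply: fin; rewrite /= e1 /cmp_step /=.
- move=> s1 f _ [I1]; have ep : p = p.-1.+1 by lia.
  rewrite {1}ep subnn (circuit_o0 C) expr0.
  rewrite !(qval_perm q _ op (g_inc G)) -sumrB (reindex_inj rev_ord_inj) /=.
  congr (cmp_inv _ _ _); apply: eq_bigr => i _; rewrite /d; ring.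
Qed.

Lemma half_lt lo hi : (lo < hi)%N -> (lo <= (lo + hi) %/ 2 < hi)%N.
Proof. by move=> h; rewrite leq_divRL // ltn_divLR //; lia. Qed.

Lemma size_bounds p : (p <= W)%N ->
  [/\ (p < X)%N, (p + p < X)%N & (X < B)%N].
Proof. by move=> pW; have := B2; rewrite /table_size; split; nia. Qed.

(** In the context for the sake of [lia]. *)
Let table_B : (X < B)%N.
Proof. by have [] := @size_bounds 0 isT. Qed.

Let W_table : (W < X)%N.
Proof. by rewrite /table_size; nia. Qed.

(** The length of the interval stays below [2 ^ (lg - i)] in round [i]. *)
Lemma search_ok s p t o b E : tabs s -> circuit s p t o b -> sv s vp = p%:Z ->
  (forall j, (j < p)%N -> (`|rowv s aR p j| < q)%N) ->
  qval q p t (rowv s aR p) = E%:Z ->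
  ok B (c_search q) s (10 + (trunc_log 2 X).+1 * (12 + 10 * p)) (fun s' =>
    exists2 lo : nat, sv s' vlo = lo%:Z /\ sv s' va = p%:Z & [/\ (lo <= p)%N,
      forall i, (i < lo)%N -> (t (o i) < E)%N &
      forall i, (lo <= i < p)%N -> (E <= t (o i))%N]).
Proof.
move=> tb C hp dp hE.
have G := c_good C; have /andP[p0 pW] := c_p C.
have [ho ho0] := c_ord C.
have op i : (i < p)%N -> (o i < p)%N by apply: (g_o G).
have [pX ppX XB] := size_bounds pW.
have [lg hlg [lg1 lg2]] := tlog tb.
pose I i s1 := exists lo hi : nat, [/\ sv s1 vlo = lo%:Z, sv s1 vhi = hi%:Z,
  (lo <= hi <= p)%N /\ (hi - lo < 2 ^ (lg - i))%N,
  forall i, (i < lo)%N -> (t (o i) < E)%N &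
  forall i, (hi <= i < p)%N -> (E <= t (o i))%N].
apply: (ok_asg_seq (z := 0)) => //.
apply: (ok_asg_seq (z := p%:Z)) => //; first by lia.
apply: (ok_asg_seq (z := p%:Z)) => //; first by lia.
apply: (ok_for (k := lg) (Tb := 10 + 10 * p) (I := I)) => //.
- apply: leq_trans lg2 _; apply: leq_trans (ltnW XB);
    have X0 : (0 < X)%N by lia.
  by apply: leq_trans (trunc_logP (isT : 1 < 2)%N X0); apply: ltn_expl.
- exists 0%N, p; split=> //; last by move=> i; lia.
  by rewrite leqnn !subn0; split=> //; lia.
- move=> i s1 ip f hi [lo [h [h1 h2 [h3 h3'] h4 h5]]].
  have tb1 : tabs s1.
    by apply: tabs_frame f _ _ _ => //; do 3!(apply: tabs_setv => //).
  have C1 : circuit s1 p t o b.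
    by apply: circuit_frame f _ _ => //; apply: circuit_ext C _ _ _.
  have [ho1 _] := c_ord C1.
  have hp1 : sv s1 vp = p%:Z by rewrite (frame_v f).
  have ha1 : sv s1 va = p%:Z by rewrite (frame_v f).
  have hrow i' j : rowv s1 aR i' j = rowv s aR i' j by rewrite (rowv_frame _ _
    f).
  have e2 : (2 ^ (lg - i) = 2 * 2 ^ (lg - i.+1))%N.
    by rewrite -expnS; congr (_ ^ _)%N; lia.
  apply: ok_if => [//|hlo|hlo]; rewrite /= h1 h2 in hlo; last first.
    by apply: ok_skip; exists lo, h; split=> //; split=> //; lia.
  have lh : (lo < h)%N by lia.
  pose mid := ((lo + h) %/ 2)%N; have /andP[m1 m2] := half_lt lh.
  apply: (ok_asg_seq (z := mid%:Z)) => //.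
    by rewrite /= h1 h2 (thalf tb1) //; lia.
    by lia.
  apply: (ok_asg_seq (z := (o mid)%:Z)) => //.
    exact: ho1.
    by have := op mid; lia.
  pose s2 := setv (setv s1 vmid mid%:Z) vb (o mid)%:Z.
  have mp : (o mid < p)%N by apply: op; lia.
  have tb2 : tabs s2 by do 2!(apply: tabs_setv => //).
  have C2 : circuit s2 p t o b by apply: circuit_ext C1 _ _ _.
  have cm := @cmp_ok s2 p t o b p (o mid) tb2 C2 hp1 ha1 erefl pW.
  apply: ok_call (cm _ _ _) _ _.
  + by lia.
  + by move=> j jp; rewrite !rowv_setv hrow dp.
  + by move=> j jp; rewrite !rowv_setv hrow (g_dig G) //; lia.
  + by lia.
  move=> s3 f3; rewrite !rowv_setv.
  have e1 : qval q p t (rowv s1 aR p) = E%:Z.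
    by rewrite -hE; apply: eq_qval => // j _; rewrite hrow.
  have e3 : qval q p t (rowv s1 aR (o mid)) = (t (o mid))%:Z.
    by rewrite -(g_val G mp); apply: eq_qval => // j _; rewrite hrow.
  rewrite e1 e3 => /cmp_inv1[a1 a2 _].
  have h13 : sv s3 vlo = lo%:Z by rewrite (frame_v f3).
  have h23 : sv s3 vhi = h%:Z by rewrite (frame_v f3).
  have hm3 : sv s3 vmid = mid%:Z by rewrite (frame_v f3).
  apply: ok_if => [|hc|hc]; [by lia| |]; rewrite /= in hc.
    apply: (ok_asgE (z := mid.+1%:Z)) => /=; rewrite ?hm3; try lia.
    exists mid.+1, h; split=> //=; first by split; lia.
    move=> j jm; apply: leq_ltn_trans (_ : t (o j) <= t (o mid))%N _;
      last by lia.
    have [->//|ne] := eqVneq j mid; apply: ltnW; apply: (g_inc G); lia.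
  apply: (ok_asgE (z := mid%:Z)) => /=; rewrite ?hm3; try lia.
  exists lo, mid; split=> //=; first by split; lia.
  move=> j /andP[mj jp]; apply: leq_trans (_ : t (o mid) <= t (o j))%N;
    first by lia.
  have [->//|ne] := eqVneq mid j; apply: ltnW; apply: (g_inc G); lia.
- move=> s1 f _ [lo [h [h1 h2 [h3 h3'] h4 h5]]]; exists lo.
    by split=> //; rewrite (frame_v f).
  split=> //; first by lia.
  move=> i hi; apply: h5; move: h3'; rewrite subnn; lia.
- by nia.
Qed.

Lemma found_ok s p t o b E lo : tabs s -> circuit s p t o b ->
  sv s vp = p%:Z -> sv s va = p%:Z -> sv s vlo = lo%:Z -> (lo <= p)%N ->
  (forall j, (j < p)%N -> (`|rowv s aR p j| < q)%N) ->
  qval q p t (rowv s aR p) = E%:Z ->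
  ok B (c_found q) s (12 + 10 * p) (fun s' =>
    sv s' vfound = ((lo < p)%N && (t (o lo) == E) : nat)%:Z).
Proof.
move=> tb C hp ha hlo lop dp hE.
have G := c_good C; have /andP[p0 pW] := c_p C.
have [ho ho0] := c_ord C.
have [pX ppX XB] := size_bounds pW.
apply: (ok_asg_seq (z := 0)) => //.
apply: ok_if => [//|h|h]; rewrite /= hp hlo in h; last first.
  by apply: ok_skip => /=; rewrite [(lo < p)%N](_ : _ = false) //; lia.
have lp : (lo < p)%N by lia.
have olp : (o lo < p)%N by apply: (g_o G).
apply: (ok_asg_seq (z := (o lo)%:Z)) => //.
  by rewrite /= hlo ho.
  by lia.
set s2 := setv _ _ _.
have tb2 : tabs s2 by do 2!(apply: tabs_setv => //).
have C2 : circuit s2 p t o b by apply: circuit_ext C _ _ _.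
have cm := @cmp_ok s2 p t o b p (o lo) tb2 C2 hp ha erefl pW.
apply: ok_call (cm _ _ _) _ _.
+ by lia.
+ by move=> j jp; rewrite !rowv_setv dp.
+ by move=> j jp; rewrite !rowv_setv (g_dig G) //; lia.
+ by lia.
move=> s3 f3; rewrite !rowv_setv hE (g_val G olp) => /cmp_inv1[a1 a2 _].
have hf : sv s3 vfound = 0 by rewrite (frame_v f3).
rewrite lp /=.
apply: ok_if => [|hc|hc]; first by lia.
  by apply: ok_skip; rewrite hf; move: hc => /= hc; lia.
apply: ok_if => [|hc'|hc']; first by lia.
  by apply: ok_skip; rewrite hf; move: hc' => /= hc'; lia.
apply: (ok_asgE (z := 1)) => //; [by lia|by lia|].
by move: hc hc' => /= hc hc'; lia.
Qed.

(** * The parts of an insertion *)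

(** For a topological order any unhandled node will do whose successors are all
    handled. *)
Lemma pick_ok s (dn : nat -> bool) (cn : nat -> nat) : tabs s ->
  (forall i, (i < n)%N -> ar s aDone i = (dn i : nat)%:Z) ->
  (forall i, (i < n)%N -> ar s aCnt i = (cn i)%:Z) ->
  (exists2 u, (u < n)%N & ~~ dn u && (cn u == 0)%N) ->
  ok B c_pick s (10 + 4 * n) (fun s' =>
    exists2 u, sv s' vu = u%:Z & [/\ (u < n)%N, ~~ dn u & cn u = 0%N]).
Proof.
move=> tb hd hc [w wn wr].
pose good u := (u < n)%N && (~~ dn u && (cn u == 0)%N).
pose I i s1 := (exists2 u, (u < i)%N & good u) -> exists2 u, sv s1 vu = u%:Z &
  good u.
have XB : (X < B)%N by have [] := @size_bounds 0 isT.
have nX : (n < X)%N by rewrite /table_size; lia.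
apply: (ok_asg_seq (z := 0)) => //.
apply: (ok_for (k := n) (Tb := 2) (I := I)) => //.
- by rewrite /= (tn tb).
- lia.
- by case.
- move=> i s1 ip f hi hI.
  have hd1 : ar s1 aDone i = (dn i : nat)%:Z by rewrite (frame_a f) // hd.
  have hc1 : ar s1 aCnt i = (cn i)%:Z by rewrite (frame_a f) // hc.
  apply: ok_if => [//|h|h]; rewrite /= hi /= hd1 hc1 in h.
    apply: (ok_asgE (z := i%:Z)) => //; first by lia.
    move=> _; exists i => //; rewrite /good ip; move: h; case: (dn i) => /=;
      lia.
  apply: ok_skip => -[u]; rewrite ltnS leq_eqVlt => /orP[/eqP -> | ui gu].
    by rewrite /good ip; move: h; case: (dn i) => //=; lia.
  by apply: hI; exists u.
- move=> s1 f _ []; first by exists w => //; rewrite /good wn.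
  by move=> u hu /and3P[h1 h2 /eqP h3]; exists u.
- lia.
Qed.

Lemma pull_ok s p r (nd : nat -> nat) (D : nat -> int) : tabs s ->
  sv s vp = p%:Z -> (p <= W)%N -> sv s vu = r%:Z -> (r < n + m)%N ->
  (forall v, (v < n)%N -> rowv s aD r v = D v) ->
  (forall v, (v < n)%N -> (`|D v| <= q)%N) ->
  (forall v, (v < n)%N -> ar s aNode v = (nd v)%:Z) ->
  (forall v, (v < n)%N -> (nd v < W)%N) ->
  ok B c_pull s (10 + 5 * W) (fun s' =>
    (forall j, (j < W)%N -> rowv s' aR p j = \sum_(v < n | nd v == j) D v) /\
    (forall i j, (j < W)%N -> i != p -> rowv s' aR i j = rowv s aR i j)).
Proof.
move=> tb hp pW hr rm hD Dq hnd ndW.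
have [pX ppX XB] := @size_bounds p pW.
have [WX _ _] := @size_bounds W (leqnn _).
have rX : (r < X)%N by rewrite /table_size; lia.
have nqX : (q * n < X)%N by rewrite /table_size; nia.
pose I1 i s1 := (forall j, (j < i)%N -> (j < W)%N -> rowv s1 aR p j = 0) /\
  (forall i' j, (j < W)%N -> i' != p -> rowv s1 aR i' j = rowv s aR i' j).
apply: (@ok_seq _ _ _ _ (3 * W + 2)); first by lia.
apply: (ok_for (k := W) (Tb := 1) (I := I1)) => //.
- by rewrite /= (tw tb).
- lia.
- move=> i s1 iW f hi [h1 h2].
  have tb1 : tabs s1 by apply: tabs_frame f _ _ _.
  apply: (ok_sto2 (i := p) (j := i) (z := 0) tb1) => //.
    by rewrite /= (frame_v f).
  split=> [j ji jW|i' j jW ne].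
    rewrite rowv_setv rowv_seta // !eqxx /=; case: eqP => // /eqP ne.
    by apply: h1 => //; rewrite ltnS leq_eqVlt (negbTE ne) in ji.
  by rewrite rowv_setv rowv_seta // (negbTE ne) h2.
- move=> s1 f1 _ [h1 h2].
  have tb1 : tabs s1 by apply: tabs_frame f1 _ _ _.
  pose S i j := \sum_(v < i | nd v == j) D v.
  pose I2 i s2 := (forall j, (j < W)%N -> rowv s2 aR p j = S i j) /\
    (forall i' j, (j < W)%N -> i' != p -> rowv s2 aR i' j = rowv s aR i' j).
  apply: (ok_for (k := n) (Tb := 1) (I := I2)) => //.
  + by rewrite /= (tn tb1).
  + lia.
  + split=> // j jW; rewrite rowv_setv h1 //; by rewrite /S big_ord0.
  + move=> i s2 iN f2 hi [h3 h4].
    have tb2 : tabs s2 by apply: tabs_frame f2 _ _ _.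
    have hnd2 : ev s2 (EA aNode vj) = (nd i)%:Z.
      by rewrite /= hi (frame_a f2) // (frame_a f1) // hnd.
    have hp2 : ev s2 vp = p%:Z by rewrite /= (frame_v f2) // (frame_v f1).
    have hu2 : ev s2 vu = r%:Z by rewrite /= (frame_v f2) // (frame_v f1).
    have nW := ndW i iN.
    have eS j : S i.+1 j = S i j + (if nd i == j then D i else 0).
      by rewrite /S big_mkcond big_ord_recr /= -big_mkcond.
    have Sb : (`|S i.+1 (nd i)| <= q * n)%N.
      apply: leq_trans (absz_sum (k := q) _) _ => [v _|].
        by apply: Dq; apply: leq_trans (ltn_ord v) iN.
      rewrite leq_mul2l sum1_card; apply/orP; right.
      by apply: leq_trans (max_card _) _; rewrite card_ord.
    have e1 : ev s2 (mat aR vp (EA aNode vj)) = S i (nd i).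
      by rewrite (ev_mat (i := p) (j := nd i) tb2) // h3.
    have e2 : ev s2 (mat aD vu vj) = D i.
      rewrite (ev_mat (i := r) (j := i) tb2) //.
      by rewrite (rowv_frame _ _ f2) // (rowv_frame _ _ f1) // hD.
    apply: (ok_sto2 (i := p) (j := nd i) (z := S i.+1 (nd i)) tb2) => //.
      by rewrite evD e1 e2 eS eqxx.
      by lia.
    split=> [j jW|i' j jW ne].
      rewrite rowv_setv rowv_seta // !eqxx /=; case: (j =P nd i) => [-> //|ne].
      by rewrite h3 // eS; case: (nd i =P j) => [e|_];
        [case: ne | rewrite addr0].
    by rewrite rowv_setv rowv_seta // (negbTE ne) h4.
  + lia.
- lia.
Qed.

Lemma finish_ok s u (Du : nat -> int) : tabs s -> sv s vu = u%:Z -> (u < n)%N ->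
  (forall i, (i < n)%N -> rowv s aD i u = Du i) ->
  (forall i, (i < n)%N -> (`|ar s aCnt i| <= n)%N) ->
  ok B c_finish s (10 + 5 * n) (fun s' =>
    (forall j, ar s' aDone j = if j == u then 1 else ar s aDone j) /\
    (forall i, (i < n)%N ->
       ar s' aCnt i = ar s aCnt i - ((Du i != 0) : nat)%:Z)).
Proof.
move=> tb hu un hD hc.
have XB : (X < B)%N by have [] := @size_bounds 0 isT.
have nX : (n + n < X)%N by rewrite /table_size; nia.
apply: (ok_sto_seq (i := u) (z := 1)) => //; first by lia.
set s0 := seta _ _ _ _.
pose I i s1 := forall j, (j < n)%N ->
  ar s1 aCnt j = ar s aCnt j - (((j < i)%N && (Du j != 0)) : nat)%:Z.
have tb0 : tabs s0 by apply: tabs_seta.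
apply: (ok_for (k := n) (Tb := 3) (I := I)) => //.
- by rewrite /= (tn tb).
- lia.
- by move=> j jn; rewrite /= subr0.
- move=> i s1 iN f hi h.
  have tb1 : tabs s1 by apply: tabs_frame f _ _ _.
  have eD : ev s1 (mat aD vi vu) = Du i.
    rewrite (ev_mat (i := i) (j := u) tb1) //; last by rewrite /= (frame_v f).
      by rewrite (rowv_frame _ _ f) // -hD.
    by lia.
  apply: ok_ifnz => // hd; rewrite eD in hd.
    apply: (ok_stoE (i := i) (z := ar s aCnt i - 1)) => //.
      by rewrite /= hi h // ltnn subr0.
      by have := hc i iN; lia.
    move=> j jn; rewrite /= ltnS; case: (ltngtP j i) => [ji|ji|->] /=.
    + by rewrite h // ji.
    + by rewrite h // ltnNge (ltnW ji).
    + by rewrite hd.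
  move=> j jn; rewrite /= h // ltnS [X in _ = _ - (X && _ : nat)%:Z]leq_eqVlt.
  by case: (j =P i) => [->|_ //]; rewrite hd eqxx !andbF.
- move=> s1 f _ h; split=> [j|i iN]; last by rewrite h // iN.
  by rewrite (frame_a f) //= .
- lia.
Qed.

Definition ins (o : nat -> nat) (lo p i : nat) : nat :=
  if (i < lo)%N then o i else if i == lo then p
  else if (i <= p)%N then o i.-1 else 0%N.

Lemma shift_ok s p o lo : tabs s -> ordered s p o -> sv s vp = p%:Z ->
  sv s vlo = lo%:Z -> (lo <= p)%N -> (p < W)%N ->
  (forall i, (i < p)%N -> (o i < p)%N) ->
  ok B c_shift s (10 + 3 * p) (fun s' => ordered s' p.+1 (ins o lo p)).
Proof.
move=> tb [ho ho0] hp hlo lop pW op.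
have [pX ppX XB] := @size_bounds p (ltnW pW).
pose I i s1 := forall j, ar s1 aOrd j =
  (if (p - i < j <= p)%N then o j.-1 else o j)%:Z.
apply: (@ok_seq _ _ _ _ (3 * p + 2)); first by lia.
apply: (ok_for (k := (p - lo)%N) (Tb := 1) (I := I)) => //.
- by rewrite /= hp hlo; lia.
- lia.
- by move=> j /=; rewrite subn0 ho; case: ifP => //; lia.
- move=> i s1 ip f hi h.
  have hp1 : sv s1 vp = p%:Z by rewrite (frame_v f).
  apply: (ok_stoE (i := (p - i)%N) (z := (o (p - i.+1)%N)%:Z)) => //.
  + by rewrite /= hi hp1; lia.
  + rewrite /= hi hp1 (_ : `|_|%N = (p - i.+1)%N); last by lia.
    by rewrite h; case: ifP => //; lia.
  + by have := op (p - i.+1)%N; lia.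
  move=> j /=; case: (j =P (p - i)%N) => [->|ne].
    by rewrite ifT; [congr (o _)%:Z; lia | lia].
  by rewrite h; congr (Posz _); do 2 case: ifP => //; lia.
- move=> s1 f _ h.
  have hp1 : sv s1 vp = p%:Z by rewrite (frame_v f).
  have hlo1 : sv s1 vlo = lo%:Z by rewrite (frame_v f).
  apply: (ok_stoE (i := lo) (z := p%:Z)) => //; [by lia|by lia|].
  split=> [j|j pj]; last by rewrite /ins !ifN //; lia.
  rewrite /= /ins h; case: (ltngtP j lo) => // jl.
    by rewrite ifN //; lia.
  rewrite (_ : (p - (p - lo) < j)%N = true) /=; last by lia.
  by case: ifP => // jp; rewrite ho0 //; lia.
- lia.
Qed.

Lemma bit_ok s p t o b a a' x E F : tabs s -> circuit s p t o b ->
  sv s vp = p%:Z -> sv s va = a%:Z -> sv s vb = a'%:Z -> sv s vc = x%:Z ->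
  (a <= W)%N -> (a' <= W)%N ->
  (forall j, (j < p)%N -> (`|rowv s aR a j| < q)%N) ->
  (forall j, (j < p)%N -> (`|rowv s aR a' j| < q)%N) ->
  qval q p t (rowv s aR a) = E%:Z -> qval q p t (rowv s aR a') = F%:Z ->
  ok B (c_bit q) s (10 + 10 * p) (fun s' =>
    forall i, ar s' aBit i = if (i == x) && (E == F.+1) then 1 else ar s aBit
      i).
Proof.
move=> tb C hp ha hb hx aW aW' da db hE hF.
have cm := @cmp_ok s p t o b a a' tb C hp ha hb aW aW' da db.
apply: ok_call cm _ _ => [|s1 f1]; first by lia.
rewrite hE hF => /cmp_inv1[a1 _ a3].
have hx1 : sv s1 vc = x%:Z by rewrite (frame_v f1).
have hbit i : ar s1 aBit i = ar s aBit i by rewrite (frame_a f1).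
apply: ok_if => [|hc|hc]; [by lia| |]; rewrite /= in hc.
  apply: ok_if => [|hc'|hc']; [by lia| |]; rewrite /= in hc'.
    by apply: ok_skip => i; rewrite hbit (_ : E == _ = false) ?andbF //; lia.
  apply: (ok_stoE (i := x) (z := 1)) => //; [have := B2; lia|by lia|].
  by move=> i /=; rewrite hbit (_ : E == _ = true) ?andbT //; lia.
by apply: ok_skip => i; rewrite hbit (_ : E == _ = false) ?andbF //; lia.
Qed.

Lemma bits_ok s p t o b f lo : tabs s -> circuit s p t o b ->
  sv s vp = p%:Z -> sv s vlo = lo%:Z -> (lo <= p)%N ->
  (forall j, (j < p)%N -> (`|rowv s aR p j| < q)%N) ->
  qval q p t (rowv s aR p) = f%:Z ->
  ar s aBit p = 0 ->
  ok B (c_bits q) s (50 + 20 * p) (fun s' =>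
    [/\ ar s' aBit p = ((lo < p)%N && (t (o lo) == f.+1) : nat)%:Z,
        forall x, (x < p)%N -> ar s' aBit x =
          (b x || [&& (0 < lo)%N, x == o lo.-1 & f == (t x).+1] : nat)%:Z &
        forall x, (p < x)%N -> ar s' aBit x = ar s aBit x]).
Proof.
move=> tb C hp hlo lop dp hf hbp.
have G := c_good C; have /andP[p0 pW] := c_p C.
have [ho ho0] := c_ord C.
have [pX ppX XB] := @size_bounds p pW.
have dg i j : (i < p)%N -> (j < p)%N -> (`|rowv s aR i j| < q)%N.
  by move=> ip jp; apply: (g_dig G) => //; apply: leq_trans pW.
apply: (@ok_call _ _ _ _ (20 + 10 * p) _ (fun s' => forall x, ar s' aBit x =
    if x == p then ((lo < p)%N && (t (o lo) == f.+1) : nat)%:Z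
    else ar s aBit x)).
- apply: ok_if => [//|h|h]; rewrite /= hp hlo in h; last first.
    apply: ok_skip => x; case: eqP => // ->.
    by rewrite [(lo < p)%N](_ : _ = false) //; lia.
  have lp : (lo < p)%N by lia.
  have olp : (o lo < p)%N by apply: (g_o G).
  apply: (ok_asg_seq (z := (o lo)%:Z)) => //; first by rewrite /= hlo ho.
    by lia.
  apply: (ok_asg_seq (z := p%:Z)) => //; first by lia.
  apply: (ok_asg_seq (z := p%:Z)) => //; first by lia.
  set s2 := setv _ _ _.
  have tb2 : tabs s2 by do 3!(apply: tabs_setv => //).
  have C2 : circuit s2 p t o b by apply: circuit_ext C _ _ _.
  apply: ok_weaken (@bit_ok s2 p t o b (o lo) p p (t (o lo)) f _ _ _ _ _ _ _ _
    _ _ _ _) _ _ => //.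
  + by lia.
  + by move=> j jp; apply: dg.
  + by rewrite !rowv_setv (g_val G).
  + by lia.
  move=> s3 _ h3 x; rewrite h3 lp /=; case: eqP => [->|//].
  by case: eqP => //=.
- by lia.
move=> s1 f1 h1.
have hp1 : sv s1 vp = p%:Z by rewrite (frame_v f1).
have hlo1 : sv s1 vlo = lo%:Z by rewrite (frame_v f1).
have tb1 : tabs s1 by apply: tabs_frame f1 _ _ tb.
have hrow i j : rowv s1 aR i j = rowv s aR i j by rewrite (rowv_frame _ _ f1).
have C1 : circuit s1 p t o b.
  apply: circuit_ext C _ _ _ => [i|i ip|//]; first by rewrite (frame_a f1).
  by rewrite h1; case: eqP => // e; move: ip; rewrite e ltnn.
have [ho1 _] := c_ord C1.
apply: ok_if => [|h|h]; [by lia| |]; rewrite /= hlo1 in h; last first.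
  have l0 : lo = 0%N by lia.
  apply: ok_skip; split=> [|x xp|x px].
  + by rewrite h1 eqxx.
  + by rewrite l0 /= orbF h1 -(c_bit_mem C) //; case: eqP => // e; lia.
  + by rewrite h1; case: eqP => // e; lia.
have olp : (o lo.-1 < p)%N by apply: (g_o G); lia.
apply: (ok_asg_seq (z := p%:Z)) => //; [by lia..|].
apply: (ok_asg_seq (z := (o lo.-1)%:Z)) => //.
  rewrite /= hlo1 (_ : `|_|%N = lo.-1) ?ho1 //; lia.
  by lia.
  by lia.
apply: (ok_asg_seq (z := (o lo.-1)%:Z)) => //; [by lia|by lia|].
set s2 := setv _ _ _.
have tb2 : tabs s2 by do 3!(apply: tabs_setv => //).
have C2 : circuit s2 p t o b by apply: circuit_ext C1 _ _ _.
apply: ok_weaken (@bit_ok s2 p t o b p (o lo.-1) (o lo.-1) f (t (o lo.-1)) _ _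
  _ _ _ _ _ _ _ _ _ _) _ _ => //.
- by lia.
- by move=> j jp; rewrite !rowv_setv hrow; apply: dp.
- by move=> j jp; rewrite !rowv_setv hrow; apply: dg.
- by rewrite !rowv_setv -hf; apply: eq_qval => // j _; apply: hrow.
- rewrite !rowv_setv -(g_val G olp); apply: eq_qval => // j _; apply: hrow.
- by lia.
move=> s3 _ h3; split=> [|x xp|x px].
- by rewrite h3 ifN /= ?h1 ?eqxx //; apply/nandP; left; lia.
- have e2 : ar s2 aBit x = (b x : nat)%:Z.
    by rewrite /= h1 ifN ?(c_bit_mem C) //; lia.
  rewrite h3 e2 (_ : (0 < lo)%N) /=; last by lia.
  case: (x =P o lo.-1) => [->|_] /=; last by rewrite orbF.
  by case: eqP; rewrite ?orbT ?orbF.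
- by rewrite h3 /= h1 !ifN //; [lia|apply/nandP; left; lia].
Qed.

(** The row of the last exponent of the run plus one at node [0] may have to be
    carried, and this takes one unit of the slack at node [0].  The run ends at a
    position without bit, so the exponent found is missing. *)
Lemma extend_ok s p t o b lo S : tabs s -> circuit s p t o b ->
  sv s vp = p%:Z -> (p < W)%N -> sv s vlo = lo%:Z -> (lo < p)%N ->
  (forall x, (x < p)%N ->
     adm q p t (fun j => `|rowv s aR x j| + S.+1 * (j == 0))%N) ->
  ok B c_extend s (50 + 20 * W) (fun s' => exists2 pos, (lo <= pos < p)%N &
    [/\ sv s' vlo = pos.+1%:Z,
      forall e, (t (o lo) <= e <= t (o pos))%N -> exists2 i, (i < p)%N & t i =
        e,
      (forall i, (i < p)%N -> t i <> (t (o pos)).+1),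
      [/\ forall j, (j < W)%N -> (`|rowv s' aR p j| < q)%N,
        forall j, (j < W)%N -> rowv s' aR p j != 0 -> (j < p)%N,
        qval q p t (rowv s' aR p) = (t (o pos)).+1%:Z &
        adm q p t (fun j => `|rowv s' aR p j| + S * (j == 0))%N] &
      forall i j, (j < W)%N -> i != p -> rowv s' aR i j = rowv s aR i j]).
Proof.
move=> tb C hp pW hlo lop hS.
have G := c_good C; have /andP[p0 pW'] := c_p C.
have [ho ho0] := c_ord C.
have [pX ppX XB] := @size_bounds p pW'.
have [WX _ _] := @size_bounds W (leqnn _).
have op i : (i < p)%N -> (o i < p)%N by apply: (g_o G).
have nqX : (q * n < X)%N by rewrite /table_size; nia.
pose filled pos := forall e, (t (o lo) <= e <= t (o pos))%N ->
  exists2 i, (i < p)%N & t i = e.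
pose I i s1 := exists pos, [/\ sv s1 vlo = pos%:Z, (lo <= pos < p)%N,
  filled pos & b (o pos) = false \/ pos = (lo + i)%N].
apply: (@ok_call _ _ _ _ (2 + 4 * p) _ (fun s1 =>
  exists pos, [/\ sv s1 vlo = pos%:Z,
  (lo <= pos < p)%N, filled pos & b (o pos) = false])).
  apply: (ok_for (k := p) (Tb := 2) (I := I)) => //.
  - lia.
  - exists lo; split=> //; [by lia| |by right; rewrite addn0].
    by move=> e h; exists (o lo); [apply: op | lia].
  - move=> i s1 ip f hi [pos [h1 h2 h3 h4]].
    have ho1 j : ar s1 aOrd j = (o j)%:Z by rewrite (frame_a f).
    have hb1 : ar s1 aBit (o pos) = (b (o pos) : nat)%:Z.
      by rewrite (frame_a f) // (c_bit_mem C) //; apply: op; lia.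
    have /andP[h2a h2b] := h2.
    apply: ok_if => [//|h|h]; rewrite /= h1 /= ho1 /= hb1 in h; last first.
      apply: ok_skip; exists pos; split=> //; left.
      by case: (b _) h.
    have bo : b (o pos) by case: (b _) h.
    apply: (ok_asgE (z := pos.+1%:Z)) => //=; [by rewrite h1; lia|by lia|].
    have /(good_bitP G (op _ h2b))[y yp ey] := bo.
    have [sp eo] := good_next q2 G h2b yp ey.
    exists pos.+1; split=> //; [by lia| |].
      move=> e /andP[e1 e2]; have [h5|h5] := leqP e (t (o pos)).
        by apply: h3; rewrite e1.
      by exists y => //; move: e2; rewrite eo ey; lia.
    by right; case: h4 => [h4|h4]; [rewrite h4 in bo | lia].
  - move=> s1 f _ [pos [h1 h2 h3 h4]]; exists pos; split=> //.
    by case: h4 => // h4; move: h2; rewrite h4; lia.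
  - lia.
- by lia.
move=> s1 f1 [pos [h1 h2 h3 h4]]; have /andP[h2a h2b] := h2.
have ho1 j : ar s1 aOrd j = (o j)%:Z by rewrite (frame_a f1).
have xp := op _ h2b; set x := o pos in xp.
have hfree i : (i < p)%N -> t i <> (t x).+1.
  move=> ip e; suff : b x by rewrite h4.
  by apply/(good_bitP G xp); exists i.
apply: (ok_asg_seq (z := x%:Z)) => //; [by rewrite /= h1 ho1|by lia|by lia|].
set s2 := setv _ _ _.
have tb2 : tabs s2 by apply: tabs_setv => //; apply: tabs_frame f1 _ _ tb.
have hrow2 i j : rowv s2 aR i j = rowv s aR i j.
  by rewrite rowv_setv (rowv_frame _ _ f1).
have hp2 : sv s2 vp = p%:Z by rewrite /= (frame_v f1).
pose J i s3 := (forall j, (j < i)%N -> (j < W)%N -> rowv s3 aR p j = rowv s aR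
  x j) /\
  (forall i' j, (j < W)%N -> i' != p -> rowv s3 aR i' j = rowv s aR i' j).
apply: (@ok_call _ _ _ _ (2 + 3 * W) _ (J W)).
  apply: (ok_for (k := W) (Tb := 1) (I := J)) => //.
  - exact: tw tb2.
  - lia.
  - by split=> // i' j jW _; rewrite rowv_setv.
  - move=> i s3 iW f3 hi [j1 j2].
    have tb3 : tabs s3 by apply: tabs_frame f3 _ _ tb2.
    apply: (ok_sto2 (i := p) (j := i) (z := rowv s aR x i) tb3) => //.
    + by rewrite /= (frame_v f3).
    + rewrite (ev_mat (i := x) (j := i) tb3) //;
        last by rewrite /= (frame_v f3).
        by rewrite j2 //; lia.
      by lia.
    + by have := g_dig G xp iW; lia.
    split=> [j ji jW|i' j jW ne].
      rewrite rowv_setv rowv_seta // !eqxx /=; case: (j =P i) => [-> //|ne].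
      by apply: j1 => //; lia.
    by rewrite rowv_setv rowv_seta // (negbTE ne) j2.
  - lia.
- by lia.
move=> s3 f3 [j1 j2].
have tb3 : tabs s3 by apply: tabs_frame f3 _ _ tb2.
have hp3 : sv s3 vp = p%:Z by rewrite (frame_v f3).
have W0 : (0 < W)%N by lia.
have r0 : (`|rowv s aR x 0| < q)%N by apply: (g_dig G).
apply: (ok_sto2_seq (i := p) (j := 0) (z := rowv s aR x 0%N + 1) tb3) => //.
- rewrite evD (ev_mat (i := p) (j := 0%N) tb3) // j1 //.
- by lia.
- by lia.
set s4 := seta _ _ _ _.
have tb4 : tabs s4 by apply: tabs_seta.
have hp4 : sv s4 vp = p%:Z by [].
have e4 j : (j < W)%N -> rowv s4 aR p j = upd (rowv s aR x) 0 (rowv s aR x 0 +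
  1) j.
  by move=> jW; rewrite rowv_seta // !eqxx /= /upd; case: eqP => // _;
    apply: j1.
have e4' i' j : (j < W)%N -> i' != p -> rowv s4 aR i' j = rowv s aR i' j.
  by move=> jW ne; rewrite rowv_seta // (negbTE ne) j2.
have O4 : ordered s4 p o.
  by split=> // j; rewrite /= (frame_a f3) // ; apply: ho1.
have G4 : good q W p t (rowv s4 aR) o b.
  apply: good_ext G => // i j ip jW; apply: e4' => //; lia.
have lowx j : (j < W)%N -> rowv s aR x j != 0 -> (j < p)%N.
  by move=> jW /(g_low G xp jW); lia.
have cm := @norm_ok p t _ o b (fun j => S * (j == 0))%N s4 tb4 hp4 pW' O4 G4.
apply: ok_call (cm _ _ _) _ _.
- by move=> j jW; rewrite e4 // /upd; case: (j =P 0%N) => [-> //|_];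
    apply: lowx.
- move=> j jp; have jW : (j < W)%N by lia.
  have := g_dig G xp jW; rewrite e4 // /upd; have : (q <= q * n)%N by nia.
  by case: (j =P 0%N) => [->|_]; lia.
- apply: adm_le (hS x xp) => j jp; rewrite e4 /upd; last by lia.
  by case: (j =P 0%N) => [->|_]; rewrite ?muln1 ?muln0; lia.
- by lia.
move=> s5 f5 [k1 k2 k3 k4 k5].
have hlo5 : sv s5 vlo = pos%:Z by rewrite (frame_v f5) //= (frame_v f3).
apply: (ok_asgE (z := pos.+1%:Z)); rewrite /= ?hlo5; try lia.
exists pos => //; split=> //.
- split=> //; rewrite !rowv_setv k3.
  rewrite (@eq_qval q p t t _ (upd (rowv s aR x) 0 (rowv s aR x 0 + 1))) //;
    last first.
    by move=> j jp; apply: e4; lia.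
  rewrite qval_upd // (g_val G xp) (c_t0 C) expr0 -/x; lia.
- by move=> i j jW ne; rewrite -e4' //; exact: k5.
Qed.

(** * Inserting one node *)

(** What the choice of the position leaves behind: row [p] represents the new
    exponent [f], the first one missing from the exponent [E] of the input node
    upwards, and node [x] carries the exponent [E]. *)
Record placed (s : st) (p : nat) (t o : nat -> nat) (E S f lo x : nat) : Prop :=
  Placed {
  pl_lo : sv s vlo = lo%:Z /\ (lo <= p)%N;
  pl_below : forall i, (i < lo)%N -> (t (o i) < f)%N;
  pl_above : forall i, (lo <= i < p)%N -> (f < t (o i))%N;
  pl_dig : forall j, (j < W)%N -> (`|rowv s aR p j| < q)%N;
  pl_low : forall j, (j < W)%N -> rowv s aR p j != 0 -> (j < p)%N;
  pl_val : qval q p t (rowv s aR p) = f%:Z;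
  pl_adm : adm q p t (fun j => `|rowv s aR p j| + S * (j == 0))%N;
  pl_fill : forall e, (E <= e < f)%N -> exists2 i, (i < p)%N & t i = e;
  pl_x : x = p /\ f = E \/ (x < p)%N /\ t x = E /\ (E <= f)%N
}.

(** If the exponent of the input node is new, the row at hand is already that of
    the new node; otherwise [extend_ok] replaces it. *)
Lemma place_ok s p t o b E S lo u : tabs s -> circuit s p t o b ->
  sv s vp = p%:Z -> (p < W)%N -> sv s vlo = lo%:Z -> (lo <= p)%N ->
  sv s vu = u%:Z ->
  sv s vfound = ((lo < p)%N && (t (o lo) == E) : nat)%:Z ->
  (forall i, (i < lo)%N -> (t (o i) < E)%N) ->
  (forall i, (lo <= i < p)%N -> (E <= t (o i))%N) ->
  (forall j, (j < W)%N -> (`|rowv s aR p j| < q)%N) ->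
  (forall j, (j < W)%N -> rowv s aR p j != 0 -> (j < p)%N) ->
  qval q p t (rowv s aR p) = E%:Z ->
  adm q p t (fun j => `|rowv s aR p j| + S * (j == 0))%N ->
  (forall x, (x < p)%N ->
     adm q p t (fun j => `|rowv s aR x j| + S.+1 * (j == 0))%N) ->
  ok B c_place s (60 + 20 * W) (fun s' =>
    exists f lo' x, [/\ placed s' p t o E S f lo' x,
      (forall i, ar s' aNode i = if i == u then x%:Z else ar s aNode i) &
      forall i j, (j < W)%N -> i != p -> rowv s' aR i j = rowv s aR i j]).
Proof.
move=> tb C hp pW hlo lop hu hf lo1 lo2 d1 d2 d3 d4 d5.
have G := c_good C; have /andP[p0 pW'] := c_p C.
have [ho ho0] := c_ord C.
have [pX ppX XB] := @size_bounds p pW'.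
apply: ok_if => [//|h|h]; rewrite /= hf in h.
  have [lp /eqP eE] : (lo < p)%N /\ t (o lo) == E by apply/andP;
    case: (_ && _) h.
  have olp : (o lo < p)%N by apply: (g_o G).
  apply: (ok_sto_seq (i := u) (z := (o lo)%:Z)) => //.
  - by rewrite /= hlo ho.
  - by lia.
  set s2 := seta _ _ _ _.
  have tb2 : tabs s2 by apply: tabs_seta.
  have C2 : circuit s2 p t o b by apply: circuit_ext C _ _ _.
  have cm := @extend_ok s2 p t o b lo S tb2 C2 hp pW hlo lp d5.
  apply: ok_weaken cm _ _ => [|s3 f3]; first by lia.
  move=> [pos /andP[p1 p2] [h1 h2 h3 [k1 k2 k3 k4] k5]].
  exists (t (o pos)).+1, pos.+1, (o lo); split; last exact: k5.
    split=> //.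
    - move=> i ip; rewrite ltnS; have [->//|ne] := eqVneq i pos.
      by apply: ltnW; apply: (g_inc G); lia.
    - move=> i /andP[i1 i2]; rewrite ltn_neqAle (g_inc G) ?i1 // andbT.
      by apply/eqP => e; apply: (h3 (o i)); [apply: (g_o G) | rewrite e].
    - by move=> e he; apply: h2; rewrite eE; lia.
    - right; split=> //; split=> //; rewrite -eE; apply: leqW.
      have [->//|ne] := eqVneq lo pos; apply: ltnW; apply: (g_inc G); lia.
  by move=> i; rewrite (frame_a f3).
have nf i : (lo <= i < p)%N -> (E < t (o i))%N.
  move=> /andP[i1 i2]; rewrite ltn_neqAle lo2 ?i1 // andbT; apply/eqP => e.
  have lp : (lo < p)%N by lia.
  have : (t (o lo) <= t (o i))%N.
    by rewrite leqNgt (good_incE G) // -leqNgt.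
  have := lo2 lo; rewrite leqnn lp => /(_ isT).
  by move: h; rewrite lp /=; case: eqP => // ne _; lia.
apply: (ok_stoE (i := u) (z := p%:Z)) => //; first by lia.
exists E, lo, p; split=> //.
split=> //; [by move=> e; lia | by left].
Qed.

(** [Dm] is the input, [t0] are the exponents of the input nodes and [rk] is a
    rank that witnesses acyclicity. *)
Variables (Dm : nat -> nat -> int) (t0 rk : nat -> nat).
Hypothesis Dq : forall r v, (r < n + m)%N -> (v < n)%N -> (`|Dm r v| < q)%N.
Hypothesis Dt : forall u, (u < n)%N ->
  (t0 u)%:Z = \sum_(v < n) Dm u v * q%:Z ^+ t0 v.
Hypothesis Drk : forall u v, (u < n)%N -> (v < n)%N -> Dm u v != 0 ->
  (rk v < rk u)%N.

Definition pending (dn : nat -> bool) (u : nat) : nat :=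
  \sum_(v < n | ~~ dn v && (Dm u v != 0)) 1.

Definition mult (dn : nat -> bool) (nd : nat -> nat) (x : nat) : nat :=
  \sum_(v < n | dn v && (nd v == x)) 1.

(** The situation with [k] of the [n] input nodes handled.  [i_adm] says that a
    label of absolute value up to [q - 1] at each of these input nodes can be
    carried out over the nodes [nd v] standing for them, which is what the next
    successor marking and later the given markings need; [i_rows] is the room
    for [extend_ok].  Both include the slack [n - k] at node [0] for the
    insertions to come. *)
Record stage_inv (s : st) (k : nat) (t o : nat -> nat) (b dn : nat -> bool)
    (nd : nat -> nat) : Prop := Inv {
  i_tabs : tabs s;
  i_D : forall r v, (r < n + m)%N -> (v < n)%N -> rowv s aD r v = Dm r v;
  i_circ : circuit s (n + k) t o b;
  i_bit0 : forall i, (n + k <= i)%N -> ar s aBit i = 0;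
  i_done : forall v, (v < n)%N -> ar s aDone v = (dn v : nat)%:Z;
  i_count : (\sum_(v < n | dn v) 1)%N = k;
  i_node : forall v, (v < n)%N -> ar s aNode v = (nd v)%:Z;
  i_nd : forall v, (v < n)%N -> (nd v < W)%N;
  i_exp : forall v, (v < n)%N -> dn v -> (nd v < n + k)%N /\ t (nd v) = t0 v;
  i_cnt : forall u, (u < n)%N -> ar s aCnt u = (pending dn u)%:Z;
  i_rows : forall x, (x < n + k)%N -> adm q (n + k) t
    (fun j => `|rowv s aR x j| + (n - k) * (j == 0))%N;
  i_adm : adm q (n + k) t
    (fun j => (q - 1) * mult dn nd j + (n - k) * (j == 0))%N
}.

Lemma pending_done (dn : nat -> bool) u v : pending dn u = 0%N -> (v < n)%N ->
  Dm u v != 0 -> dn v.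
Proof.
move/eqP; rewrite sum_nat_eq0 => /forallP h vn d; apply: contraT => nd.
by have := h (Ordinal vn); rewrite /= nd d.
Qed.

(** A node of least rank among the unhandled ones has no unhandled successor. *)
Lemma ready_exists (dn : nat -> bool) k : (\sum_(v < n | dn v) 1)%N = k -> (k <
  n)%N ->
  exists2 u, (u < n)%N & ~~ dn u && (pending dn u == 0%N).
Proof.
move=> hk kn; have [u0 hu0] : exists u : 'I_n, ~~ dn u.
  apply/existsP; apply: contraLR kn; rewrite negb_exists => /forallP h.
  rewrite -leqNgt -hk -[X in (X <= _)%N](card_ord n) -sum1_card.
  by apply: eq_leq; apply: eq_bigl => v; have := h v; rewrite negbK => ->.
case: (@arg_minnP _ u0 (fun u : 'I_n => ~~ dn u) (fun u : 'I_n => rk u) hu0) =>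
  u hu hmin.
exists u => //; rewrite hu /= /pending sum_nat_eq0; apply/forallP => v.
apply/implyP => /andP[nd d]; have := hmin v nd.
by rewrite leqNgt (Drk (ltn_ord u) (ltn_ord v) d).
Qed.

Definition ins_time : nat :=
  (500 + 100 * W + (trunc_log 2 X).+1 * (12 + 10 * W))%N.

(** The nine parts of [c_insert] in sequence, and then the invariant with one
    more node of exponent [f], found by [place_ok].  [adm_insert] with [i0 := x]
    gives [i_adm]: all exponents from that of [x] up to [f] are occupied.  For
    the rows, whose contents do not grow, it is used with the new node as
    [i0]. *)
Lemma insert_ok s k t o b dn nd : stage_inv s k t o b dn nd -> (k < n)%N ->
  sv s vp = (n + k)%N%:Z ->
  ok B (c_insert q) s ins_time (fun s' =>
    exists t' o' b' dn' nd', stage_inv s' k.+1 t' o' b' dn' nd').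
Proof.
move=> J kn; set p := (n + k)%N => hp.
have C := i_circ J; rewrite -/p in C.
have tb := i_tabs J.
have G := c_good C; have /andP[p0 pW'] := c_p C.
have pW : (p < W)%N by rewrite /p; lia.
have [pX ppX XB] := @size_bounds p pW'.
have nX : (n < X)%N by lia.
set Lp := ((trunc_log 2 X).+1 * (12 + 10 * p))%N.
set LW := ((trunc_log 2 X).+1 * (12 + 10 * W))%N.
have LpW : (Lp <= LW)%N by rewrite /Lp /LW leq_mul2l; apply/orP; right; lia.
pose sl := (n - k).-1; have eS : (n - k = sl.+1)%N by rewrite /sl; lia.
have cost : ((10 + 4 * n) + ((10 + 5 * W) + ((10 * p + 2) + ((10 + Lp) +
    ((12 + 10 * p) + ((60 + 20 * W) + ((50 + 20 * p) + ((10 + 3 * p) +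
    (10 + 5 * n)))))))) <= ins_time)%N.
  by rewrite /ins_time -/LW; lia.
apply: ok_le cost.
have ready := ready_exists (i_count J) kn.
have cm1 := @pick_ok s dn (pending dn) tb (i_done J) (i_cnt J) ready.
apply: ok_calls cm1 _ => s1 f1 [u hu [un ndu tu]].
have tb1 : tabs s1 by apply: tabs_frame f1 _ _ tb.
have hp1 : sv s1 vp = p%:Z by rewrite (frame_v f1).
have D1 r v : (r < n + m)%N -> (v < n)%N -> rowv s1 aD r v = Dm r v.
  by move=> rm vn; rewrite (rowv_frame _ _ f1) // (i_D J).
have un' : (u < n + m)%N by lia.
have N1 v : (v < n)%N -> ar s1 aNode v = (nd v)%:Z.
  by move=> vn; rewrite (frame_a f1) // (i_node J).
have Dq' v : (v < n)%N -> (`|Dm u v| <= q)%N by move=> vn; apply/ltnW/Dq.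
have cm2 := @pull_ok s1 p u nd (Dm u) tb1 hp1 pW' hu un'
  (fun v vn => D1 u v un' vn) Dq' N1 (i_nd J).
apply: ok_calls cm2 _ => s2 f2 [h2 h2'].
have tb2 : tabs s2 by apply: tabs_frame f2 _ _ tb1.
have hp2 : sv s2 vp = p%:Z by rewrite (frame_v f2).
have C2 : circuit s2 p t o b.
  apply: circuit_ext C _ _ _ => [i|i _|i j ip jW].
  - by rewrite (frame_a f2) // (frame_a f1).
  - by rewrite (frame_a f2) // (frame_a f1).
  - by rewrite h2' ?(rowv_frame _ _ f1) //; lia.
have ddone v : (v < n)%N -> Dm u v != 0 -> dn v by apply: pending_done.
pose c j := \sum_(v < n | nd v == j) Dm u v.
have cE j : c j = \sum_(v < n | dn v && (nd v == j)) Dm u v.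
  rewrite /c big_mkcond [RHS]big_mkcond; apply: eq_bigr => v _.
  have [->|d] := eqVneq (Dm u v) 0; first by rewrite !if_same.
  by rewrite ddone.
have cb j : (`|c j| <= (q - 1) * mult dn nd j)%N.
  rewrite cE; apply: absz_sum => v _; have := Dq un' (ltn_ord v); lia.
have clow j : c j != 0 -> (j < p)%N.
  apply: contraR => pj; apply/eqP; rewrite cE big1 // => v /andP[dv /eqP e].
  by have [] := i_exp J (ltn_ord v) dv; rewrite -/p e (negbTE pj).
have cqn j : (`|c j| <= q * n)%N.
  apply: leq_trans (cb j) _; apply: leq_mul; first by lia.
  by rewrite /mult sum1_card; apply: leq_trans (max_card _) _; rewrite card_ord.
have cval : qval q p t c = (t0 u)%:Z.
  rewrite qval_pull => [|v vn d]; last by have [] := i_exp J vn (ddone v vn d).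
  rewrite Dt //; apply: eq_bigr => v _.
  have [->|d] := eqVneq (Dm u v) 0; first by rewrite !mul0r.
  by have [_ ->] := i_exp J (ltn_ord v) (ddone v (ltn_ord v) d).
have cadm : adm q p t (fun j => `|c j| + sl.+1 * (j == 0))%N.
  by apply: adm_le (i_adm J) => j jp; rewrite eS leq_add2r.
have cm3 := @norm_ok p t _ o b (fun j => sl.+1 * (j == 0))%N s2 tb2
  hp2 pW' (c_ord C2) (c_good C2).
have r2 j : (j < W)%N -> rowv s2 aR p j = c j by move=> jW; rewrite h2.
apply: ok_calls (cm3 _ _ _) _.
- by move=> j jW; rewrite r2 //; apply: clow.
- by move=> j jp; rewrite r2 //; apply: leq_trans pW'.
- by apply: adm_le cadm => j jp; rewrite r2 //; apply: leq_trans pW'.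
move=> s3 f3 [e1 e2 e3 e4 e5].
have {}e3 : qval q p t (rowv s3 aR p) = (t0 u)%:Z.
  by rewrite e3 -cval; apply: eq_qval => // j jp; rewrite r2 //;
    apply: leq_trans pW'.
have tb3 : tabs s3 by apply: tabs_frame f3 _ _ tb2.
have hp3 : sv s3 vp = p%:Z by rewrite (frame_v f3).
have C3 : circuit s3 p t o b.
  apply: circuit_ext C2 _ _ _ => [i|i _|i j ip jW].
  - by rewrite (frame_a f3).
  - by rewrite (frame_a f3).
  - by rewrite e5 //; lia.
have e1' j : (j < p)%N -> (`|rowv s3 aR p j| < q)%N.
  by move=> jp; apply: e1; apply: leq_trans pW'.
have cm4 := @search_ok s3 p t o b (t0 u) tb3 C3 hp3 e1' e3.
apply: ok_calls cm4 _ => s4 f4 [lo [hlo4 ha4] [lop lo1 lo2]].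
have tb4 : tabs s4 by apply: tabs_frame f4 _ _ tb3.
have hp4 : sv s4 vp = p%:Z by rewrite (frame_v f4).
have C4 : circuit s4 p t o b by apply: circuit_frame f4 _ C3.
have e4r i j : rowv s4 aR i j = rowv s3 aR i j by rewrite (rowv_frame _ _ f4).
have e3' : qval q p t (rowv s4 aR p) = (t0 u)%:Z.
  by rewrite -e3; apply: eq_qval => // j _; apply: e4r.
have e14 j : (j < p)%N -> (`|rowv s4 aR p j| < q)%N by move=> jp;
  rewrite e4r e1'.
have cm5 := @found_ok s4 p t o b (t0 u) lo tb4 C4 hp4 ha4 hlo4 lop e14 e3'.
apply: ok_calls cm5 _ => s5 f5 hf5.
have tb5 : tabs s5 by apply: tabs_frame f5 _ _ tb4.
have hp5 : sv s5 vp = p%:Z by rewrite (frame_v f5).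
have hlo5 : sv s5 vlo = lo%:Z by rewrite (frame_v f5).
have C5 : circuit s5 p t o b by apply: circuit_frame f5 _ C4.
have e5r i j : rowv s5 aR i j = rowv s3 aR i j by rewrite (rowv_frame _ _ f5)
  // e4r.
have hu2 : sv s2 vu = u%:Z by rewrite (frame_v f2).
have hu5 : sv s5 vu = u%:Z.
  by rewrite (frame_v f5) // (frame_v f4) // (frame_v f3).
have r53 x j : (x < p)%N -> (j < W)%N -> rowv s5 aR x j = rowv s aR x j.
  move=> xp jW; rewrite e5r e5 //; last by lia.
  by rewrite h2' ?(rowv_frame _ _ f1) //; lia.
have cm6 := @place_ok s5 p t o b (t0 u) sl lo u tb5 C5 hp5 pW hlo5 lop hu5 hf5
  lo1 lo2.
apply: ok_calls (cm6 _ _ _ _ _) _.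
- by move=> j jW; rewrite e5r e1.
- by move=> j jW; rewrite e5r; apply: e2.
- by rewrite -e3; apply: eq_qval => // j _; apply: e5r.
- by apply: adm_le e4 => j jp; rewrite e5r; lia.
- move=> x xp; apply: adm_le (i_rows J xp) => j jp.
  by rewrite eS r53 //; apply: leq_trans pW'.
move=> s6 f6 [f [lo' [x [[[pl1 pl1'] pl2 pl3 pl4 pl5 pl6 pl7 pl8 pl9] nd6
  r6]]]].
have tb6 : tabs s6 by apply: tabs_frame f6 _ _ tb5.
have hp6 : sv s6 vp = p%:Z by rewrite (frame_v f6).
have hu6 : sv s6 vu = u%:Z by rewrite (frame_v f6).
have bit6 i : ar s6 aBit i = ar s aBit i.
  rewrite (frame_a f6) // (frame_a f5) // (frame_a f4) // (frame_a f3) //.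
  by rewrite (frame_a f2) // (frame_a f1).
have C6 : circuit s6 p t o b.
  apply: circuit_ext C5 _ _ _ => [i|i _|i j ip jW].
  - by rewrite (frame_a f6).
  - by rewrite (frame_a f6).
  - by apply: r6 => //; lia.
have pl4' j : (j < p)%N -> (`|rowv s6 aR p j| < q)%N.
  by move=> jp; apply: pl4; apply: leq_trans pW'.
have bp6 : ar s6 aBit p = 0 by rewrite bit6 (i_bit0 J).
have cm7 := @bits_ok s6 p t o b f lo' tb6 C6 hp6 pl1 pl1' pl4' pl6 bp6.
apply: ok_calls cm7 _ => s7 f7 [b1 b2 b3].
have tb7 : tabs s7 by apply: tabs_frame f7 _ _ tb6.
have hp7 : sv s7 vp = p%:Z by rewrite (frame_v f7).
have hlo7 : sv s7 vlo = lo'%:Z by rewrite (frame_v f7).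
have O7 : ordered s7 p o.
  have [o1 o2] := c_ord C6; split=> // i; rewrite (frame_a f7) //.
have op i : (i < p)%N -> (o i < p)%N by apply: (g_o G).
have cm8 := @shift_ok s7 p o lo' tb7 O7 hp7 hlo7 pl1' pW op.
apply: ok_calls cm8 _ => s8 f8 O8.
have tb8 : tabs s8 by apply: tabs_frame f8 _ _ tb7.
have D8 r v : (r < n + m)%N -> (v < n)%N -> rowv s8 aD r v = Dm r v.
  move=> rm vn; rewrite (rowv_frame _ _ f8) // (rowv_frame _ _ f7) //.
  rewrite (rowv_frame _ _ f6) // (rowv_frame _ _ f5) // (rowv_frame _ _ f4) //.
  by rewrite (rowv_frame _ _ f3) // (rowv_frame _ _ f2) // D1.
have hu8 : sv s8 vu = u%:Z by rewrite (frame_v f8) // (frame_v f7).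
have cnt8 i : ar s8 aCnt i = ar s aCnt i.
  rewrite (frame_a f8) // (frame_a f7) // (frame_a f6) // (frame_a f5) //.
  by rewrite (frame_a f4) // (frame_a f3) // (frame_a f2) // (frame_a f1).
have done8 i : ar s8 aDone i = ar s aDone i.
  rewrite (frame_a f8) // (frame_a f7) // (frame_a f6) // (frame_a f5) //.
  by rewrite (frame_a f4) // (frame_a f3) // (frame_a f2) // (frame_a f1).
have cntb i : (i < n)%N -> (`|ar s8 aCnt i| <= n)%N.
  move=> iN; rewrite cnt8 (i_cnt J) // absz_nat /pending sum1_card.
  by apply: leq_trans (max_card _) _; rewrite card_ord.
have D8u i : (i < n)%N -> rowv s8 aD i u = Dm i u by move=> iN; apply: D8 =>
  //; lia.
have cm9 := @finish_ok s8 u (fun i => Dm i u) tb8 hu8 un D8u cntb.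
apply: ok_weaken cm9 (leqnn _) _ => s9 f9 [n1 n2].
have tb9 : tabs s9 by apply: tabs_frame f9 _ _ tb8.
have r9 i j : rowv s9 aR i j = rowv s6 aR i j.
  by rewrite (rowv_frame _ _ f9) // (rowv_frame _ _ f8) // (rowv_frame _ _ f7).
have node9 i : ar s9 aNode i = if i == u then x%:Z else ar s aNode i.
  rewrite (frame_a f9) // (frame_a f8) // (frame_a f7) // nd6 (frame_a f5) //.
  by rewrite (frame_a f4) // (frame_a f3) // (frame_a f2) // (frame_a f1).
have bit9 i : ar s9 aBit i = ar s7 aBit i by rewrite (frame_a f9) // (frame_a
  f8).
have pS : (n + k.+1 = p.+1)%N by rewrite addnS.
pose t' i := if i == p then f else t i.
pose b' i := if i == p then (lo' < p)%N && (t (o lo') == f.+1)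
  else b i || [&& (0 < lo')%N, i == o lo'.-1 & f == (t i).+1].
pose dn' v := dn v || (v == u).
pose nd' v := if v == u then x else nd v.
have tE i : (i < p)%N -> t' i = t i by move=> ip; rewrite /t' ifN //; lia.
have tp : t' p = f by rewrite /t' eqxx.
have fnew i : (i < p)%N -> t i <> f.
  move=> ip; have [l lp <-] := g_onto G ip.
  by case: (ltnP l lo') => h; [have := pl2 l h | have := pl3 l]; lia.
have xp : (x <= p)%N by case: pl9 => [[-> _]|[h _]] //; apply: ltnW.
have t'x : t' x = t0 u.
  by case: pl9 => [[-> <-] //|[h [<- _]]]; rewrite tE.
have dnu : dn u = false by apply/negbTE.
have mS y : mult dn' nd' y = (mult dn nd y + (x == y))%N.
  rewrite /mult big_mkcond [in RHS]big_mkcond (bigD1 (Ordinal un)) //= [in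
    RHS](bigD1 (Ordinal un)) //=.
  rewrite /dn' /nd' eqxx orbT dnu add0n addnC /=; congr (_ + _)%N.
  apply: eq_bigr => v; rewrite -val_eqE /= => /negbTE ->; by rewrite orbF.
have tdS i : pending dn i = (pending dn' i + (Dm i u != 0))%N.
  rewrite /pending big_mkcond [in RHS]big_mkcond (bigD1 (Ordinal un)) //= [in
    RHS](bigD1 (Ordinal un)) //=.
  rewrite /dn' eqxx orbT dnu add0n addnC /=; congr (_ + _)%N.
  apply: eq_bigr => v; rewrite -val_eqE /= => /negbTE ->; by rewrite orbF.
have grow (w : nat -> nat) (w' : nat -> nat) : adm q p t w ->
    (forall j, (j < p)%N -> (w' j <= w j)%N) -> w' p = 0%N -> adm q p.+1 t' w'.
  move=> hw h1 h3; apply: (adm_insert q2 (i0 := p) hw) => //.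
  - by move=> i ip; rewrite tp; apply: fnew.
  - by move=> e; rewrite ltnNge; case: (_ <= _)%N.
  - by move=> i ip; apply: leq_trans (h1 i ip) (leq_addr _ _).
  - by rewrite h3.
have m0 : mult dn nd p = 0%N.
  rewrite /mult big1 // => v /andP[dv /eqP e].
  by have [] := i_exp J (ltn_ord v) dv; rewrite -/p e ltnn.
have p00 : (p == 0)%N = false by lia.
exists t', (ins o lo' p), b', dn', nd'; rewrite -/p in J *; split;
  rewrite ?pS //.
- by move=> r v rm vn; rewrite (rowv_frame _ _ f9) // D8.
- split; rewrite ?pW //.
  + by rewrite /t' ifN ?(c_t0 C) //; lia.
  + by have [o1 o2] := O8; split=> // i; rewrite (frame_a f9).
  + move=> i; rewrite ltnS leq_eqVlt bit9 /b' => /orP[/eqP ->|ip].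
      by rewrite eqxx b1.
    by rewrite ifN ?b2 //; lia.
  + apply: (good_insert q2 (c_good C6) (pos := lo') (f := f)
      (d := rowv s6 aR p) (t' := t')) => //.
    * by move=> i il; rewrite /ins il.
    * by rewrite /ins ltnn eqxx.
    * by move=> i /andP[i1 i2]; rewrite /ins ltnNge (leqW i1) /= ifN ?i2 //;
        lia.
    * by rewrite /b' eqxx.
    * by move=> i ip; rewrite /b' ifN //; lia.
- by move=> i ip; rewrite bit9 b3 ?bit6 ?(i_bit0 J) //; lia.
- move=> v vn; rewrite n1 /dn'; case: eqP => [_|_]; first by rewrite orbT.
  by rewrite orbF done8 (i_done J).
- rewrite -(i_count J) big_mkcond [in RHS]big_mkcond (bigD1 (Ordinal un)) //=
    [in RHS](bigD1 (Ordinal un)) //=.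
  rewrite /dn' eqxx orbT dnu add0n add1n; congr _.+1.
  by apply: eq_bigr => v; rewrite -val_eqE /= => /negbTE ->; rewrite orbF.
- by move=> v vn; rewrite node9 /nd'; case: eqP => // _; rewrite (i_node J).
- by move=> v vn; rewrite /nd'; case: eqP => _; [lia | apply: (i_nd J)].
- move=> v vn; rewrite /dn' /nd'; case: eqP => [->|_]; first by rewrite ltnS.
  rewrite orbF => dv; have [h1 h3] := i_exp J vn dv; rewrite -/p in h1.
  by rewrite tE //; split=> //; apply: ltnW.
- by move=> i iN; rewrite n2 // cnt8 (i_cnt J) // tdS; lia.
- move=> y; rewrite ltnS leq_eqVlt [(n - k.+1)%N]subnS -/sl => /orP[/eqP ->|yp].
    apply: grow pl7 _ _ => [j jp|]; first by rewrite r9.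
    rewrite p00 muln0 addn0 r9; apply/eqP; rewrite absz_eq0.
    by apply: contraT => /(pl5 _ pW); rewrite ltnn.
  apply: grow (i_rows J yp) _ _ => [j jp|].
    rewrite r9 r6 ?r53 //; [by rewrite eS; lia|by lia..].
  rewrite p00 muln0 addn0 r9 r6 ?r53 //; last by lia.
  apply/eqP; rewrite absz_eq0; apply: contraT => /(g_low G yp pW).
  by rewrite ltnNge (ltnW yp).
- rewrite [(n - k.+1)%N]subnS -/sl; apply: (adm_insert q2 (i0 := x) (i_adm J))
    => //.
  + by rewrite tp t'x; case: pl9 => [[_ ->]//|[_ [_ ->]]].
  + by move=> i ip; rewrite tp; apply: fnew.
  + by move=> e; rewrite t'x tp; apply: pl8.
  + by move=> i ip; rewrite mS eS (eq_sym i x) mulnDr mulSn; lia.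
  + by rewrite -/p mS m0 p00 muln0 addn0 add0n (eq_sym p x).
Qed.

(** * Tables, input and base nodes *)

Lemma sizes_ok s w : si s = [:: n%:Z, m%:Z & w] ->
  ok B (c_sizes q) s (10 + 3 * q) (fun s' =>
    [/\ sv s' vn = n%:Z /\ sv s' vm = m%:Z, sv s' vw = W%:Z,
        sv s' vh = (n + m)%N%:Z, sv s' vx = X%:Z & si s' = w]).
Proof.
move=> hw; have b2 := B2; rewrite /table_size in b2.
apply: (ok_read_seq hw) => //; first by lia.
apply: ok_read_seq => //; first by lia.
apply: (ok_asg_seq (z := W%:Z)) => //; first by lia.
apply: (ok_asg_seq (z := (n + m)%N%:Z)) => //; first by lia.
apply: (ok_asg_seq (z := (n + m + 1)%N%:Z)) => //; first by lia.
apply: (ok_for (k := q) (Tb := 1)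
  (I := fun i s1 => sv s1 vx = (n + m + 1 + i * W)%N%:Z)) => //.
- lia.
- by rewrite /= mul0n addn0.
- move=> i s1 iq f hi h; apply: (ok_asgE (z := (n + m + 1 + i.+1 * W)%N%:Z)) =>
    //.
    by rewrite /= h (frame_v f) //= mulSn; lia.
  by rewrite absz_nat; nia.
- by move=> s1 f _ h; split=> //; rewrite ?(frame_v f) ?(frame_i f).
- lia.
Qed.

Lemma mul_ok s : sv s vx = X%:Z -> sv s vw = W%:Z ->
  ok B c_mul s (10 + 4 * X) (fun s' =>
    forall i, (i < X)%N -> ar s' aMul i = (i * W)%N%:Z).
Proof.
move=> hx hw; have b1 := B1.
apply: (ok_asg_seq (z := 0)) => //.
apply: (ok_for (k := X) (Tb := 2) (I := fun i s1 => sv s1 ve = (i * W)%N%:Z /\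
  forall j, (j < i)%N -> ar s1 aMul j = (j * W)%N%:Z)) => //.
- lia.
- move=> i s1 iX f hi [h1 h2].
  have iW : (i.+1 * W <= X.+1 * W)%N by rewrite leq_mul2r; lia.
  have iW' : (i * W <= X.+1 * W)%N by rewrite leq_mul2r; lia.
  apply: (ok_sto_seq (i := i) (z := (i * W)%N%:Z)) => //; first by lia.
  apply: (ok_asgE (z := (i.+1 * W)%N%:Z)) => //.
    by rewrite /= h1 (frame_v f) //= hw mulSn; lia.
    by lia.
  split=> // j; rewrite ltnS leq_eqVlt => /orP[/eqP -> | ji];
    first by rewrite /= eqxx.
  by rewrite /= ifN ?h2 //; lia.
- by move=> s1 f _ [].
- lia.
Qed.

(** Quotient and remainder are counted up together, since the machine cannot
    divide. *)
Lemma div_ok a d s : a != aRem -> (0 < d <= q)%N -> sv s vx = X%:Z ->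
  ok B (c_div a d) s (10 + 8 * X) (fun s' =>
    forall i, (i < X)%N -> ar s' a i = (i %/ d)%N%:Z /\
      ar s' aRem i = (i %% d)%N%:Z).
Proof.
move=> ha /andP[d0 dq] hx; have b2 := B2.
apply: (ok_asg_seq (z := 0)) => //.
apply: (ok_asg_seq (z := 0)) => //.
apply: (ok_for (k := X) (Tb := 6) (I := fun i s1 =>
  [/\ sv s1 vz = (i %/ d)%N%:Z, sv s1 vr = (i %% d)%N%:Z &
  forall j, (j < i)%N -> ar s1 a j = (j %/ d)%N%:Z /\
    ar s1 aRem j = (j %% d)%N%:Z])) => //.
- lia.
- by rewrite /= div0n mod0n.
- move=> i s1 iX f hi [h1 h2 h3].
  have m1 := ltn_pmod i d0; have m2 := leq_div i d; have E := divn_succ i d0.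
  set z := (i %/ d)%N in h1 m2 E *; set r := (i %% d)%N in h2 m1 E *.
  have zj : (i %/ d)%N = z by []; have rj : (i %% d)%N = r by [].
  move: z r m1 m2 h1 h2 zj rj E => z r m1 m2 h1 h2 zj rj E.
  apply: (ok_sto_seq (i := i) (z := z%:Z)) => //; first by lia.
  apply: (ok_sto_seq (i := i) (z := r%:Z)) => //; first by lia.
  apply: (ok_asg_seq (z := r.+1%:Z)) => //.
    by rewrite /= h2; lia.
    by lia.
  have tab y y' j : (j < i.+1)%N ->
    let s2 := seta (seta s1 a i z%:Z) aRem i r%:Z in
    forall s3, ar s3 = ar s2 -> ar (setv (setv s3 vr y) vz y') a j = (j %/
      d)%N%:Z /\
      ar (setv (setv s3 vr y) vz y') aRem j = (j %% d)%N%:Z.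
    move=> ji s2 s3 e; rewrite /= e /= (negbTE ha) /=.
    have -> : (a == a) = true by apply/eqP.
    have -> : (aRem == a) = false by apply/eqP => h; rewrite h eqxx in ha.
    have [->|ne] := eqVneq j i; first by rewrite zj rj.
    by apply: h3; rewrite ltnS leq_eqVlt (negbTE ne) in ji.
  apply: ok_if => // h; rewrite /= in h.
    move: E; rewrite ifT; last by lia.
    move=> -[e1 e2].
    apply: (ok_asg_seq (z := 0)) => //.
    apply: (ok_asgE (z := z.+1%:Z)) => //.
      by rewrite /= h1; lia.
      by lia.
    split; rewrite ?e1 ?e2 //= => j ji.
    by have := tab 0 0 j ji (St (sv s1) _ [::] [::]) erefl.
  move: E; rewrite ifN; last by lia.
  move=> -[e1 e2]; apply: ok_skip.
  split; rewrite ?e1 ?e2 //= => j ji.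
  by have := tab 0 0 j ji (St (sv s1) _ [::] [::]) erefl.
- by move=> s1 f _ [].
- lia.
Qed.

Lemma log_ok s : sv s vx = X%:Z -> ok B c_log s (10 + 6 * X) (fun s' =>
  exists2 lg : nat, sv s' vlg = lg%:Z &
    (W < 2 ^ lg)%N /\ (lg <= (trunc_log 2 X).+1)%N).
Proof.
move=> hx; have b2 := B2; have WX : (W < X)%N by rewrite /table_size; nia.
apply: (ok_asg_seq (z := 0)) => //.
apply: (ok_asg_seq (z := 1)) => //; first by lia.
apply: (ok_for (k := X) (Tb := 4) (I := fun i s1 => exists lg : nat,
  [/\ sv s1 vlg = lg%:Z, sv s1 vpw = (2 ^ lg)%N%:Z, (i <= 2 ^ lg)%N &
  (lg == 0%N) || (2 ^ lg <= 2 * i)%N])) => //.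
- lia.
- by exists 0%N; split.
- move=> i s1 iX f hi [lg [h1 h2 h3 h4]].
  have lgX : (lg < 2 ^ lg)%N by apply: ltn_expl.
  have lg0 : lg == 0%N -> (2 ^ lg = 1)%N by move/eqP->.
  apply: ok_if => // h; rewrite /= hi h2 in h; last first.
    apply: ok_skip; exists lg; split=> //; first by lia.
    by move: h4; case: (lg == 0%N) => //=; lia.
  have e2 : (2 ^ lg.+1 = 2 ^ lg + 2 ^ lg)%N by rewrite expnS; lia.
  apply: (ok_asg_seq (z := (2 ^ lg.+1)%N%:Z)) => //.
    by rewrite /= h2; lia.
    by lia.
  apply: (ok_asgE (z := lg.+1%:Z)) => //.
    by rewrite /= h1; lia.
    by lia.
  exists lg.+1; split=> //=; lia.
- move=> s1 f _ [lg [h1 h2 h3 h4]]; exists lg => //; split; first by lia.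
  case: lg h4 {h1 h2 h3} => // lg /= h4; rewrite ltnS; apply: trunc_log_max =>
    //.
  by rewrite expnS in h4; lia.
- lia.
Qed.

Lemma tables_ok s w : si s = [:: n%:Z, m%:Z & w] ->
  ok B (c_tables q) s (60 + 3 * q + 26 * X) (fun s' => tabs s' /\ si s' = w).
Proof.
move=> hw.
have cost : (10 + 3 * q + (10 + 4 * X + (10 + 8 * X + (10 + 8 * X + (10 + 6 *
  X))))
  <= 60 + 3 * q + 26 * X)%N by lia.
apply: ok_le cost.
apply: ok_calls (sizes_ok hw) _ => s1 f1 [[h1 h2] h3 h4 h5 h6].
apply: ok_calls (mul_ok h5 h3) _ => s2 f2 k2.
have x2 : sv s2 vx = X%:Z by rewrite (frame_v f2).
have q2' : (0 < 2 <= q)%N by [].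
apply: ok_calls (@div_ok aHalf 2 s2 isT q2' x2) _ => s3 f3 k3.
have x3 : sv s3 vx = X%:Z by rewrite (frame_v f3).
have qq : (0 < q <= q)%N by rewrite leqnn; lia.
apply: ok_calls (@div_ok aQuo q s3 isT qq x3) _ => s4 f4 k4.
have x4 : sv s4 vx = X%:Z by rewrite (frame_v f4).
apply: ok_weaken (log_ok x4) (leqnn _) _ => s5 f5 k5.
split; last by rewrite (frame_i f5) // (frame_i f4) // (frame_i f3) // (frame_i
  f2).
have V x : x \in [:: vn; vm; vw; vh] -> sv s5 x = sv s1 x.
  rewrite !inE => /or4P[] /eqP ->;
  by rewrite (frame_v f5) // (frame_v f4) // (frame_v f3) // (frame_v f2).
split=> //; try by rewrite V.
- by move=> i iX; rewrite (frame_a f5) // (frame_a f4) // (frame_a f3) // k2.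
- by move=> i iX; rewrite (frame_a f5) // (frame_a f4) //;
    have [-> _] := k3 i iX.
- by move=> i iX; rewrite (frame_a f5) //; have [-> _] := k4 i iX.
- by move=> i iX; rewrite (frame_a f5) //; have [_ ->] := k4 i iX.
Qed.

(** A row may list its support in any order; what has not been read yet is zero
    because memory is. *)
Lemma read_ok s (Row : nat -> seq int) :
  tabs s -> (forall r, (r < n + m)%N -> row_enc n (Dm r) (Row r)) ->
  si s = flatten [seq Row r | r <- iota 0 (n + m)] ->
  (forall i, ar s aD i = 0) ->
  ok B c_read s (10 + (n + m) * (10 + 5 * n)) (fun s' =>
    (forall r v, (r < n + m)%N -> (v < n)%N -> rowv s' aD r v = Dm r v) /\
    (forall r, (r < n + m)%N ->
      ar s' aCnt r = (\sum_(v < n | Dm r v != 0) 1)%N%:Z)).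
Proof.
move=> tb hrow hsi D0; have b2 := B2.
have nmX : (n + m < X)%N by rewrite /table_size; lia.
pose rest i := flatten [seq Row r | r <- iota i (n + m - i)].
have restS i : (i < n + m)%N -> rest i = Row i ++ rest i.+1.
  by move=> h; rewrite /rest (_ : n + m - i = (n + m - i.+1).+1)%N //; lia.
pose I i s1 := [/\ si s1 = rest i,
  forall r v, (r < i)%N -> (v < n)%N -> rowv s1 aD r v = Dm r v,
  forall r v, (i <= r)%N -> (v < n)%N -> rowv s1 aD r v = 0 &
  forall r, (r < i)%N -> ar s1 aCnt r = (\sum_(v < n | Dm r v != 0) 1)%N%:Z].
apply: (ok_for (k := (n + m)%N) (Tb := 8 + 5 * n) (I := I)) => //.
- exact: th tb.
- lia.
- by split=> //; rewrite ?hsi /rest ?subn0 // => r v _ _; rewrite /rowv D0.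
- move=> i s1 im f hi [h1 h2 h3 h4].
  have [vs [vu vP rE]] := hrow i im.
  have sE : (size vs = \sum_(v < n | Dm i v != 0%R) 1)%N.
    rewrite -(big_mkord (fun v => Dm i v != 0) (fun=> 1%N)) sum1_count
      /index_iota subn0.
    rewrite -size_filter; apply/perm_size/uniq_perm => //.
      by apply: filter_uniq; apply: iota_uniq.
    by move=> v; rewrite vP mem_filter mem_iota add0n andbC.
  have sn : (size vs <= n)%N.
    by rewrite sE sum1_card; apply: leq_trans (max_card _) _; rewrite card_ord.
  have tb1 : tabs s1 by apply: tabs_frame f _ _ tb.
  pose enc us := flatten [seq [:: v%:Z; Dm i v] | v <- us] ++ rest i.+1.
  apply: (ok_read_seq (z := (size vs)%:Z) (w := enc vs)) => //.
    by rewrite h1 restS // rE.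
    by lia.
  apply: (ok_sto_seq (i := i) (z := (size vs)%:Z)) => //; first by lia.
  set s2 := seta _ _ _ _.
  have tb2 : tabs s2 by apply: tabs_seta => //; apply: tabs_seti;
    apply: tabs_setv.
  pose J j s3 := [/\ si s3 = enc (drop j vs),
    forall v, (v < n)%N -> rowv s3 aD i v = if v \in take j vs then Dm i v else
      0 &
    forall r v, r != i -> (v < n)%N -> rowv s3 aD r v = rowv s1 aD r v].
  apply: (ok_for (k := size vs) (Tb := 3) (I := J)) => //.
  + lia.
  + split=> [|v vn|//] /=; first by rewrite drop0.
    by rewrite take0 in_nil rowv_setv; apply: h3.
  + move=> j s3 js f3 hj [j1 j2 j3].
    have tb3 : tabs s3 by apply: tabs_frame f3 _ _ tb2.
    pose v := nth 0%N vs j; have vin : v \in vs by apply: mem_nth.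
    have /andP[vn vnz] : (v < n)%N && (Dm i v != 0) by rewrite -vP.
    have vq := Dq im vn.
    have j1' : si s3 = [:: v%:Z, Dm i v & enc (drop j.+1 vs)].
      by rewrite j1 (drop_nth 0%N js).
    apply: (ok_read_seq j1') => //; first by lia.
    apply: ok_read_seq => //; first by lia.
    have vW : (v < W)%N by lia.
    apply: (ok_sto2 (i := i) (j := v) (z := Dm i v)) => //.
      by do 2!(apply: tabs_seti; apply: tabs_setv => //).
      by lia.
      by rewrite /= (frame_v f3).
      by lia.
    split=> [//|w wn|r w ne wn].
      rewrite rowv_setv rowv_seta //; last by lia.
      rewrite !eqxx /= (take_nth 0%N js) mem_rcons inE -/v.
      by case: (w =P v) => [->//|_]; apply: j2.
    by rewrite rowv_setv rowv_seta ?(negbTE ne) //; [apply: j3|lia].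
  + move=> s3 f3 _ [j1 j2 j3].
    split=> [|r v ri vn|r v ir vn|r ri] /=.
    * by rewrite j1 drop_size.
    * rewrite rowv_setv; move: ri; rewrite ltnS leq_eqVlt => /orP[/eqP ->|ri].
        rewrite j2 // take_size vP vn /=.
        by case: eqP => // ->.
      by rewrite j3 ?h2 //; lia.
    * by rewrite rowv_setv j3 ?h3 //; lia.
    * rewrite (frame_a f3) //=; case: (r =P i) => [->|ne]; first by rewrite sE.
      by rewrite h4 //; lia.
  + lia.
- move=> s1 f _ [_ h2 _ h4]; split=> //.
- lia.
Qed.

Lemma base_ok s : tabs s -> (forall i, ar s aOrd i = 0) ->
  (forall i, ar s aBit i = 0) ->
  ok B c_base s (10 + n * (10 + 4 * n)) (fun s' =>
    [/\ forall k j, (k < n)%N -> (j < n)%N ->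
          rowv s' aR k j = (k %/ q ^ j %% q)%N%:Z,
        forall k j, (k < n)%N -> (n <= j < W)%N -> rowv s' aR k j = rowv s aR k
          j,
        forall i, ar s' aOrd i = (if (i < n)%N then i else 0%N)%:Z &
        forall i, ar s' aBit i = ((i.+1 < n)%N : nat)%:Z]).
Proof.
move=> tb O0 b0; have b2 := B2.
have nX : (n < X)%N by rewrite /table_size; lia.
pose I u s1 := [/\ forall k j, (k < u)%N -> (j < n)%N ->
      rowv s1 aR k j = (k %/ q ^ j %% q)%N%:Z,
    forall k j, (k < n)%N -> (n <= j < W)%N -> rowv s1 aR k j = rowv s aR k j,
    forall i, ar s1 aOrd i = (if (i < u)%N then i else 0%N)%:Z &
    forall i, ar s1 aBit i = ((i < u)%N && (i.+1 < n)%N : nat)%:Z].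
apply: (ok_for (k := n) (Tb := 6 + 4 * n) (I := I)) => //.
- exact: tn tb.
- lia.
- move=> u s1 un f hu [h1 h2 h3 h4].
  have tb1 : tabs s1 by apply: tabs_frame f _ _ tb.
  apply: (ok_asg_seq (z := u%:Z)) => //; first by lia.
  set s2 := setv _ _ _; have tb2 : tabs s2 by apply: tabs_setv.
  pose J j s3 := [/\ sv s3 vc = (u %/ q ^ j)%N%:Z,
    forall l, (l < j)%N -> (l < n)%N -> rowv s3 aR u l = (u %/ q ^ l %% q)%N%:Z
      &
    forall k l, (l < W)%N -> (k != u) || (n <= l)%N -> rowv s3 aR k l = rowv s1
      aR k l].
  have cost : ((2 + 4 * n) + 3 <= (6 + 4 * n).-1)%N by lia.
  apply: ok_le cost; apply: (@ok_calls _ _ _ _ (2 + 4 * n) 3 (J n)).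
    apply: (ok_for (k := n) (Tb := 2) (I := J)) => //.
    - exact: tn tb2.
    - lia.
    - by split=> //=; rewrite expn0 divn1.
    - move=> j s3 jn f3 hj [j1 j2 j3].
      have tb3 : tabs s3 by apply: tabs_frame f3 _ _ tb2.
      have := leq_div u (q ^ j); set x := (u %/ q ^ j)%N in j1 * => xu.
      have xX : (x < X)%N by lia.
      have jW : (j < W)%N by lia.
      have xq : (x %% q < q)%N by rewrite ltn_mod; lia.
      apply: (ok_sto2_seq (i := u) (j := j) (z := (x %% q)%N%:Z) tb3) => //.
      + by lia.
      + by rewrite /= (frame_v f3).
      + by rewrite /= j1 (trem tb3).
      + by rewrite absz_nat; lia.
      have xd : (x %/ q = u %/ q ^ j.+1)%N by rewrite /x -divnMA expnSr.
      apply: (ok_asgE (z := (u %/ q ^ j.+1)%N%:Z)) => //.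
      + by rewrite /= j1 (tquo tb3) // xd.
      + by rewrite absz_nat; apply: leq_trans (leq_div _ _) _; lia.
      split=> //= [l lj ln|k l lW kl].
        rewrite !rowv_setv rowv_seta //; last by lia.
        rewrite !eqxx /=; case: (l =P j) => [->//|ne]; apply: j2 => //; lia.
      rewrite !rowv_setv rowv_seta // j3 // ifN //.
      by apply/negP => /and3P[_ /eqP e1 /eqP e2]; move: kl; rewrite e1 e2 eqxx;
        lia.
    - lia.
  move=> s3 f3 [_ j2 j3].
  have tb3 : tabs s3 by apply: tabs_frame f3 _ _ tb2.
  have hu3 : sv s3 vu = u%:Z by rewrite (frame_v f3).
  have o3 i : ar s3 aOrd i = ar s1 aOrd i by rewrite (frame_a f3).
  have bt3 i : ar s3 aBit i = ar s1 aBit i by rewrite (frame_a f3).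
  apply: (ok_sto_seq (i := u) (z := u%:Z)) => //; first by lia.
  have fin s4 : (forall i j, rowv s4 aR i j = rowv s3 aR i j) ->
      (forall i, ar s4 aOrd i = if i == u then u%:Z else ar s3 aOrd i) ->
      (forall i, ar s4 aBit i = if (i == u) && (u.+1 < n)%N then 1 else ar s3
        aBit i) ->
      I u.+1 (setv s4 vu u.+1).
    move=> r4 o4 bt4; split=> [k j ku jn|k j kn jn|i|i] /=.
    - rewrite rowv_setv r4; move: ku; rewrite ltnS leq_eqVlt =>
        /orP[/eqP ->|ku].
        by apply: j2.
      by rewrite j3 ?h1 //; lia.
    - by rewrite rowv_setv r4 j3 ?h2 //; lia.
    - rewrite o4 o3 h3 [in RHS]ltnS [in RHS]leq_eqVlt.
      by case: (i =P u) => [->//|_].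
    - rewrite bt4 bt3 h4 (_ : (i < u.+1)%N = (i == u) || (i < u)%N); last first.
        by rewrite ltnS leq_eqVlt.
      by case: (i =P u) => [->|_] //=; rewrite ltnn; case: (u.+1 < n)%N.
  apply: ok_if => // h; rewrite /= (tn tb3) hu3 in h.
    apply: (ok_stoE (i := u) (z := 1)) => //; first by lia.
    by apply: fin => // i /=; rewrite (_ : (u.+1 < n)%N) ?andbT //; lia.
  apply: ok_skip; apply: fin => // i /=.
  by rewrite (_ : (u.+1 < n)%N = false) ?andbF //; lia.
- move=> s1 f _ [h1 h2 h3 h4]; split=> // i.
  by rewrite h4; case: (ltnP i n) => // h; rewrite ltnNge (leqW h).
- lia.
Qed.

(** * The main loop *)

Lemma stage_setv s x z k t o b dn nd : x \notin tab_vars ->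
  stage_inv s k t o b dn nd -> stage_inv (setv s x z) k t o b dn nd.
Proof.
move=> hx [h1 h2 [c1 c2 c3 c4 c5] *]; split=> //; exact: tabs_setv.
Qed.

Lemma main_ok s t o b dn nd : stage_inv s 0 t o b dn nd ->
  ok B (c_main q) s (10 + n * (3 + ins_time)) (fun s' =>
    exists t' o' b' dn' nd', stage_inv s' n t' o' b' dn' nd').
Proof.
move=> J; have tb := i_tabs J.
apply: (ok_for (k := n) (Tb := 1 + ins_time) (I := fun k s1 =>
  exists t' o' b' dn' nd', stage_inv s1 k t' o' b' dn' nd')) => //.
- exact: tn tb.
- lia.
- by exists t, o, b, dn, nd; apply: stage_setv.
- move=> k s1 kn f hk [t' [o' [b' [dn' [nd' J1]]]]].
  apply: (@ok_calls _ _ _ _ 1 _ (fun s2 => s2 = setv s1 vp (n + k)%N%:Z)).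
    apply: (ok_asgE (z := (n + k)%N%:Z)) => //; last by lia.
    by rewrite /= hk (tn (i_tabs J1)).
  move=> s2 _ ->; have J2 := stage_setv (n + k)%N%:Z (isT : vp \notin tab_vars)
    J1.
  apply: ok_weaken (insert_ok J2 kn erefl) (leqnn _) _.
  move=> s3 _ [t2 [o2 [b2 [dn2 [nd2 J3]]]]]; exists t2, o2, b2, dn2, nd2.
  exact: stage_setv.
- lia.
Qed.

(** The slack [n] at node [0], on top of a row of value less than [n], stays below
    [q ^ n] because [2n <= q ^ n]; this gives admissibility by [adm_base].  No
    input node is handled yet, so in [i_adm] the slack is the whole content. *)
Lemma stage0 s : (0 < n)%N -> tabs s ->
  (forall r v, (r < n + m)%N -> (v < n)%N -> rowv s aD r v = Dm r v) ->
  (forall r, (r < n + m)%N ->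
      ar s aCnt r = (\sum_(v < n | Dm r v != 0) 1)%N%:Z) ->
  (forall k j, (k < n)%N -> (j < n)%N ->
          rowv s aR k j = (k %/ q ^ j %% q)%N%:Z) ->
  (forall k j, (k < n)%N -> (n <= j < W)%N -> rowv s aR k j = 0) ->
  (forall i, ar s aOrd i = (if (i < n)%N then i else 0%N)%:Z) ->
  (forall i, ar s aBit i = ((i.+1 < n)%N : nat)%:Z) ->
  (forall i, ar s aNode i = 0) -> (forall i, ar s aDone i = 0) ->
  stage_inv s 0 id (fun i => if (i < n)%N then i else 0%N) (fun x =>
    (x.+1 < n)%N)
    (fun=> false) (fun=> 0%N).
Proof.
move=> n0 tb hD hC hR hR' hO hB hN hd.
have nqn : (n + n <= q ^ n)%N.
  have h2 k : (0 < k)%N -> (k + k <= 2 ^ k)%N.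
    case: k => // k _; rewrite expnS; have : (k < 2 ^ k)%N by apply: ltn_expl.
    by lia.
  by apply: leq_trans (h2 n n0) _; rewrite leq_exp2r.
have slack (w : nat -> nat) : (\sum_(j < n) w j * q ^ j < n)%N ->
    adm q n id (fun j => w j + n * (j == 0))%N.
  move=> hw; apply: adm_base => //.
  under eq_bigr do rewrite mulnDl.
  rewrite big_split /= (bigD1 (Ordinal n0) (P := xpredT)) //=.
  rewrite [X in (_ + X)%N](bigD1 (Ordinal n0)) //= expn0 !muln1.
  rewrite [X in (_ + (_ + X))%N]big1 => [|i hi]; last first.
    by rewrite -val_eqE /= in hi; rewrite (negbTE hi) muln0.
  by move: hw; rewrite (bigD1 (Ordinal n0)) //= expn0 muln1; lia.
have m0 x : mult (fun=> false) (fun=> 0%N) x = 0%N.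
  by rewrite /mult big1.
split; rewrite ?addn0 ?subn0 //.
- split=> //; first by lia.
    by split=> // i hi; rewrite ltnNge hi.
  have GB := @good_base q W q2 n (fun i => if (i < n)%N then i else 0%N)
    (leq_addr _ _).
  apply: good_ext (GB _) => [|i j iN jW|i iN]; first by lia.
    case: ltnP => jn; first by rewrite hR.
    by rewrite hR' // jn.
  by rewrite iN.
- by move=> i hi; rewrite hB ltnNge leqW.
- by rewrite big1.
- by move=> v vn; lia.
- by move=> u un; rewrite hC //; lia.
- move=> x xn; apply: slack; apply: leq_ltn_trans (xn).
  rewrite -lez_nat -(@qval_digits q q2 n x); last first.
    by apply: ltn_trans xn _; lia.
  rewrite /qval raddf_sum /=; apply: ler_sum => j _.
  by rewrite hR // absz_nat PoszM -!natz natrX natz.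
- by apply: slack; rewrite big1 // => i _; rewrite m0 muln0.
Qed.

(** * Output *)

(** Two passes, as the number of entries is printed before them. *)
Lemma row_ok s r : tabs s -> sv s vrow = r%:Z -> (r <= W)%N ->
  ok B c_row s (10 + 11 * W) (fun s' => so s' = so s ++ enc_row W (rowv s aR
    r)).
Proof.
move=> tb hr rW; have rX : (r < X)%N by lia.
pose d := rowv s aR r; pose vs k := [seq v <- iota 0 k | d v != 0].
have vsS k : vs k.+1 = if d k != 0 then rcons (vs k) k else vs k.
  rewrite /vs -[k.+1]addn1 iotaD filter_cat add0n /=.
  by case: ifP => _; rewrite ?cats0 // cats1.
have svs k : (size (vs k) <= k)%N by rewrite size_filter -[X in (_ <=
  X)%N](size_iota 0) count_size.
have ed s1 j : tabs s1 -> (forall i, rowv s1 aR r i = d i) -> sv s1 vrow = r%:Z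
  ->
    sv s1 vj = j%:Z -> ev s1 (mat aR vrow vj) = d j.
  by move=> t1 h1 h2 h3; rewrite (ev_mat (i := r) (j := j) t1) // h1.
have cost : (1 + ((2 + 5 * W) + (1 + (2 + 6 * W))) <= 10 + 11 * W)%N by lia.
apply: ok_le cost.
apply: (@ok_calls _ _ _ _ 1 _ (fun s1 => s1 = setv s vcnt 0)).
  exact: ok_asgE.
move=> s1 _ e1; subst s1.
apply: (@ok_calls _ _ _ _ (2 + 5 * W) _
  (fun s1 => sv s1 vcnt = (size (vs W))%:Z)).
  apply: (ok_for (k := W) (Tb := 3)
    (I := fun i s1 => sv s1 vcnt = (size (vs i))%:Z)) => //.
  - exact: tw tb.
  - lia.
  - move=> i s1 iW f hi h.
    have tb1 : tabs s1 by apply: tabs_frame f _ _ _ => //; apply: tabs_setv.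
    have e := ed s1 i tb1 _ _ hi.
    rewrite vsS; apply: ok_ifnz => // hd; rewrite e ?(frame_v f) // in hd.
    + rewrite hd; apply: (ok_asgE (z := (size (vs i)).+1%:Z)) => //.
      * by rewrite /= h; lia.
      * by have := svs i; lia.
      by rewrite /= size_rcons.
    + by move=> j; rewrite (rowv_frame _ _ f).
    + by rewrite hd.
    + by move=> j; rewrite (rowv_frame _ _ f).
  - lia.
move=> s2 f2 h2.
apply: (@ok_calls _ _ _ _ 1 _ (fun s3 => s3 = seto s2 (rcons (so s2) (size (vs
  W))%:Z))).
  by apply: ok_print => //=; rewrite h2.
move=> s3' _ ->; set s3 := seto _ _.
have tb3 : tabs s3.
  by apply: tabs_seto; apply: tabs_frame f2 _ _ _ => //; apply: tabs_setv.
have hr3 : sv s3 vrow = r%:Z by rewrite /= (frame_v f2).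
have d3 i : rowv s3 aR r i = d i by rewrite -[LHS]/(rowv s2 aR r i) (rowv_frame
  _ _ f2).
apply: (ok_for (k := W) (Tb := 4) (I := fun i s1 => so s1 =
  so s ++ (size (vs W))%:Z :: flatten [seq [:: v%:Z; d v] | v <- vs i])) => //.
- exact: tw tb3.
- lia.
- by rewrite /= (frame_o f2) //= cats1.
- move=> i s4 iW f hi h.
  have tb4 : tabs s4 by apply: tabs_frame f _ _ tb3.
  have r4 j : rowv s4 aR r j = d j by rewrite (rowv_frame _ _ f).
  have hr4 : sv s4 vrow = r%:Z by rewrite (frame_v f).
  have e := ed s4 i tb4 r4 hr4 hi.
  rewrite vsS; apply: ok_ifnz => // hd; rewrite e in hd.
    rewrite hd; apply: ok_print_seq => //; apply: ok_print => //.
    rewrite -[LHS]/(rcons (rcons (so s4) (sv s4 vj)) (ev s4 (mat aR vrow vj))).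
    rewrite e hi h.
    rewrite map_rcons flatten_rcons !rcons_cat !rcons_cons; congr (_ ++ _ :: _).
    by rewrite -!cats1 -catA.
  by rewrite hd.
- lia.
Qed.

(** What is left of [stage_inv] when all input nodes are handled.  Unlike
    [stage_inv] it has a meaning for the empty graph, which has no node [0]. *)
Record built (s : st) (t o : nat -> nat) (b : nat -> bool) (nd : nat -> nat) :
  Prop := Built {
  u_tabs : tabs s;
  u_D : forall r v, (r < n + m)%N -> (v < n)%N -> rowv s aD r v = Dm r v;
  u_good : good q W W t (rowv s aR) o b;
  u_ord : ordered s W o;
  u_bit : forall i, (i < W)%N -> ar s aBit i = (b i : nat)%:Z;
  u_node : forall v, (v < n)%N -> ar s aNode v = (nd v)%:Z;
  u_nd : forall v, (v < n)%N -> (nd v < W)%N /\ t (nd v) = t0 v;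
  u_adm : adm q W t (fun j => (q - 1) * \sum_(v < n | nd v == j) 1)%N
}.

(** All [n] nodes are handled, as [k] counts them. *)
Lemma built_of_inv s t o b dn nd : stage_inv s n t o b dn nd ->
  built s t o b nd.
Proof.
move=> J; have C := i_circ J.
have alld v : (v < n)%N -> dn v.
  move=> vn; apply: contraT => ndv; have := i_count J.
  rewrite sum1_card => e; have := max_card (fun v : 'I_n => dn v).
  have : (#|[pred v : 'I_n | dn v]| < #|'I_n|)%N.
    apply: proper_card; apply/properP; split; first exact/subsetP.
    by exists (Ordinal vn) => //; rewrite inE.
  by rewrite card_ord e ltnn.
split.
- exact: i_tabs J.
- exact: i_D J.
- exact: c_good C.
- exact: c_ord C.
- exact: c_bit_mem C.
- exact: i_node J.
- by move=> v vn; apply: (i_exp J vn (alld v vn)).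
- apply: adm_le (i_adm J) => j _; rewrite subnn mul0n addn0 leq_mul2l.
  apply/orP; right; rewrite /mult; apply: eq_leq; apply: eq_bigl => v.
  by rewrite alld.
Qed.

(** A marking is treated as the successor marking of one more node, without
    inserting that node; by then the slack is used up. *)
Lemma marking_ok s t o b nd i (pre : seq int) : built s t o b nd ->
  sv s vp = W%:Z -> sv s vk = i%:Z -> (i < m)%N -> so s = pre ->
  ok B (Asg vu (vn + vk)%E ;; c_pull ;; c_norm ;; Asg vrow vp ;; c_row) s
    (30 + 26 * W) (fun s' => built s' t o b nd /\
      exists2 d : nat -> int, (forall j, (j < W)%N -> (`|d j| < q)%N) /\
        qval q W t d = \sum_(v < n) Dm (n + i) v * q%:Z ^+ t0 v &
        so s' = pre ++ enc_row W d).
Proof.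
move=> U hp hk im hso; have tb := u_tabs U; have G := u_good U.
have cost : (1 + ((10 + 5 * W) + ((10 * W + 2) + (1 + (10 + 11 * W)))) <= 30 +
  26 * W)%N.
  by lia.
apply: ok_le cost; have rm : (n + i < n + m)%N by lia.
have nX : (n + m < X)%N by rewrite /table_size; lia.
apply: (@ok_calls _ _ _ _ 1 _ (fun s1 => s1 = setv s vu (n + i)%N%:Z)).
  apply: (ok_asgE (z := (n + i)%N%:Z)) => //; last by lia.
  by rewrite /= hk (tn tb).
move=> s1' _ ->; set s1 := setv _ _ _.
have tb1 : tabs s1 by apply: tabs_setv.
have Dq' v : (v < n)%N -> (`|Dm (n + i) v| <= q)%N by move=> vn; apply/ltnW/Dq.
have ndW v : (v < n)%N -> (nd v < W)%N by move=> vn; have [] := u_nd U vn.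
have cm := @pull_ok s1 W (n + i) nd (Dm (n + i)) tb1 hp (leqnn _) erefl rm
  (fun v vn => u_D U rm vn) Dq' (u_node U) ndW.
apply: ok_calls cm _ => s2 f2 [h1 h2].
have tb2 : tabs s2 by apply: tabs_frame f2 _ _ tb1.
have hp2 : sv s2 vp = W%:Z by rewrite (frame_v f2).
pose c j := \sum_(v < n | nd v == j) Dm (n + i) v.
have cb j : (`|c j| <= (q - 1) * \sum_(v < n | nd v == j) 1)%N.
  by apply: absz_sum => v _; have := Dq rm (ltn_ord v); lia.
have O2 : ordered s2 W o.
  by have [o1 o2] := u_ord U; split=> // j; rewrite (frame_a f2) //; apply: o1.
have G2 : good q W W t (rowv s2 aR) o b.
  by apply: good_ext G => // x j xW jW; apply: h2 => //; lia.
have cm3 := @norm_ok W t _ o b (fun=> 0%N) s2 tb2 hp2 (leqnn _) O2 G2.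
apply: ok_calls (cm3 _ _ _) _ => //.
- move=> j jW; rewrite h1 //; apply: leq_trans (cb j) _; apply: leq_mul;
    first by lia.
  by rewrite sum1_card; apply: leq_trans (max_card _) _; rewrite card_ord.
- by apply: adm_le (u_adm U) => j jW; rewrite addn0 h1 //; apply: cb.
move=> s3 f3 [e1 e2 e3 e4 e5].
have tb3 : tabs s3 by apply: tabs_frame f3 _ _ tb2.
apply: (@ok_calls _ _ _ _ 1 _ (fun s4 => s4 = setv s3 vrow W%:Z)).
  apply: (ok_asgE (z := W%:Z)) => //; last by lia.
  by rewrite /= (frame_v f3).
move=> s4' _ ->; set s4 := setv _ _ _.
have tb4 : tabs s4 by apply: tabs_setv.
apply: ok_weaken (@row_ok s4 W tb4 erefl (leqnn _)) (leqnn _) _.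
move=> s5 f5 h5; split.
  have r5 x j : (x < W)%N -> (j < W)%N -> rowv s5 aR x j = rowv s aR x j.
    move=> xW jW; rewrite (rowv_frame _ _ f5) // rowv_setv e5 ?h2 //; lia.
  split.
  - exact: tabs_frame f5 _ _ tb4.
  - move=> r v rnm vn; rewrite (rowv_frame _ _ f5) // rowv_setv.
    rewrite (rowv_frame _ _ f3) // (rowv_frame _ _ f2) //; exact: (u_D U).
  - by apply: good_ext G.
  - have [o1 o2] := O2; split=> // j; rewrite (frame_a f5) // -o1.
    exact: (frame_a f3).
  - move=> j jW; rewrite (frame_a f5) // -(u_bit U jW) -[RHS]/(ar s1 aBit j).
    by rewrite -(frame_a f2) //; apply: (frame_a f3).
  - move=> j jW; rewrite (frame_a f5) // -(u_node U jW) -[RHS]/(ar s1 aNode j).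
    by rewrite -(frame_a f2) //; apply: (frame_a f3).
  - exact: u_nd U.
  - exact: u_adm U.
exists (rowv s3 aR W).
  split=> //; rewrite e3 (@eq_qval q W t t _ c) // qval_pull => [|v vn _];
    last exact: ndW.
  by apply: eq_bigr => v _; have [_ ->] := u_nd U (ltn_ord v).
by rewrite h5 rowv_setv /= (frame_o f3) // (frame_o f2) //= hso.
Qed.

Lemma out_ok s t o b nd : built s t o b nd -> so s = [::] ->
  ok B c_out s (50 + W * (30 + 11 * W) + m * (40 + 26 * W)) (fun s' =>
    good q W W t (rowv s aR) o b /\
    exists2 Ms : nat -> nat -> int,
      forall i, (i < m)%N -> (forall j, (j < W)%N -> (`|Ms i j| < q)%N) /\
        qval q W t (Ms i) = \sum_(v < n) Dm (n + i) v * q%:Z ^+ t0 v &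
      so s' = [:: W%:Z, m%:Z & flatten [seq enc_row W (rowv s aR i) | i <- iota
        0 W]
        ++ flatten [seq enc_row W (Ms i) | i <- iota 0 m]]
        ++ [seq (o i)%:Z | i <- iota 0 W]
        ++ [seq (b (o i) : nat)%:Z | i <- iota 0 W.-1]).
Proof.
move=> U hso; have tb := u_tabs U; have G := u_good U.
have [ho ho0] := u_ord U.
have iotaS k : iota 0 k.+1 = iota 0 k ++ [:: k] by rewrite -[k.+1]addn1 iotaD.
have mX : (m < X)%N by rewrite /table_size; lia.
have cost : (3 + ((2 + W * (12 + 11 * W)) + ((2 + m * (32 + 26 * W)) + ((2 + 3
  * W)
  + (2 + 4 * W)))) <= 50 + W * (30 + 11 * W) + m * (40 + 26 * W))%N by lia.
apply: ok_le cost.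
pose s1 := setv (seto s [:: W%:Z; m%:Z]) vp W%:Z.
apply: ok_print_seq => //; apply: ok_print_seq => //.
apply: (ok_asg_seq (z := W%:Z)); [exact: tw tb | by lia | by [] |].
set s1' := setv _ vp _; have -> : s1' = s1.
  by rewrite /s1' /s1 /seto /setv /= (tw tb) (tm tb) hso.
have tb1 : tabs s1 by apply: tabs_setv => //; apply: tabs_seto.
pose rows k := flatten [seq enc_row W (rowv s aR i) | i <- iota 0 k].
apply: (@ok_calls _ _ _ _ (2 + W * (12 + 11 * W)) _
  (fun s2 => so s2 = [:: W%:Z, m%:Z & rows W])).
  apply: (ok_for (k := W) (Tb := 10 + 11 * W)
    (I := fun k s2 => so s2 = [:: W%:Z, m%:Z & rows k])) => //.
  - exact: tw tb1.
  - lia.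
  - move=> k s2 kW f hk h.
    have tb2 : tabs s2 by apply: tabs_frame f _ _ tb1.
    apply: ok_weaken (@row_ok s2 k tb2 hk (ltnW kW)) (leqnn _) _.
    move=> s3 _ h3; rewrite -[LHS]/(so s3) h3 h /= /rows iotaS map_cat
      flatten_cat /= cats0.
    congr [:: _, _ & _ ++ _]; apply: eq_enc_row => j _.
    by rewrite (rowv_frame _ _ f).
  - lia.
move=> s2 f2 h2.
have U2 : built s2 t o b nd.
  split.
  - exact: tabs_frame f2 _ _ tb1.
  - move=> r v rm vn; rewrite (rowv_frame _ _ f2) //; exact: (u_D U).
  - apply: good_ext G => // x j _ _; rewrite (rowv_frame _ _ f2) //.
  - by split=> // j; rewrite (frame_a f2) //; apply: ho.
  - move=> j jW; rewrite (frame_a f2) //; exact: (u_bit U).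
  - move=> j jW; rewrite (frame_a f2) //; exact: (u_node U).
  - exact: u_nd U.
  - exact: u_adm U.
have hp2 : sv s2 vp = W%:Z by rewrite (frame_v f2).
pose good_marking i (d : nat -> int) := (forall j, (j < W)%N -> (`|d j| < q)%N)
  /\
  qval q W t d = \sum_(v < n) Dm (n + i) v * q%:Z ^+ t0 v.
pose marks (Ms : nat -> nat -> int) k := flatten [seq enc_row W (Ms i) | i <-
  iota 0 k].
apply: (@ok_calls _ _ _ _ (2 + m * (32 + 26 * W)) _ (fun s3 =>
  built s3 t o b nd /\
    exists2 Ms : nat -> nat -> int, forall i, (i < m)%N -> good_marking i (Ms
      i) &
      so s3 = [:: W%:Z, m%:Z & rows W ++ marks Ms m])).
  apply: (ok_for (k := m) (Tb := 30 + 26 * W) (I := fun k s3 =>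
    [/\ built s3 t o b nd,
    sv s3 vp = W%:Z & exists2 Ms : nat -> nat -> int,
      forall i, (i < k)%N -> good_marking i (Ms i) &
      so s3 = [:: W%:Z, m%:Z & rows W ++ marks Ms k]])) => //.
  - exact: tm (u_tabs U2).
  - lia.
  - split=> //; last by exists (fun _ _ => 0) => //=; rewrite h2 cats0.
    case: U2 => h *; split=> //; exact: tabs_setv.
  - move=> k s3 km f hk [U3 hp3 [Ms M1 M2]].
    apply: ok_weaken (marking_ok U3 hp3 hk km M2) (leqnn _) _.
    move=> s4 f4 [U4 [d d1 d2]]; split.
    + case: U4 => h *; split=> //; exact: tabs_setv.
    + by rewrite /= (frame_v f4).
    exists (fun i => if i == k then d else Ms i) => [i|].
      rewrite ltnS leq_eqVlt; case: eqP => [-> //|_] /=; exact: M1.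
    rewrite -[LHS]/(so s4) d2 /marks iotaS map_cat flatten_cat /= eqxx cats0
      -catA.
    congr [:: _, _ & _ ++ (flatten _ ++ _)].
    apply/eq_in_map => i; rewrite mem_iota add0n => /andP[_ ik].
    by rewrite ifN //; lia.
  - by move=> s3 _ _ [h1 _ h3].
  - lia.
move=> s3 f3 [U3 [Ms M1 M2]].
have tb3 := u_tabs U3; have [o3 _] := u_ord U3.
apply: (@ok_calls _ _ _ _ (2 + 3 * W) _ (fun s4 =>
    so s4 = so s3 ++ [seq (o i)%:Z | i <- iota 0 W])).
  apply: (ok_for (k := W) (Tb := 1) (I := fun k s4 =>
    so s4 = so s3 ++ [seq (o i)%:Z | i <- iota 0 k])) => //.
  - exact: tw tb3.
  - lia.
  - by rewrite /= cats0.
  - move=> k s4 kW f hk h; apply: ok_print => //.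
    have e : ev s4 (EA aOrd vj) = (o k)%:Z by rewrite /= hk (frame_a f).
    rewrite -[LHS]/(rcons (so s4) (ev s4 (EA aOrd vj))) h e.
    by rewrite iotaS map_cat catA cats1.
  - lia.
move=> s4 f4 h4.
have tb4 : tabs s4 by apply: tabs_frame f4 _ _ tb3.
apply: (ok_for (k := W) (Tb := 2) (I := fun k s5 =>
    so s5 = so s4 ++ [seq (b (o i) : nat)%:Z | i <- iota 0 k.-1])) => //.
- exact: tw tb4.
- lia.
- by rewrite /= cats0.
- move=> k s5 kW f hk h.
  apply: ok_if => [//|h0|h0]; rewrite /= hk in h0; last first.
    apply: ok_skip; rewrite -[LHS]/(so s5) h.
    by have -> : k = 0%N by lia.
  apply: ok_print => //.
  have kb : (o k.-1 < W)%N by apply: (g_o G); lia.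
  have e1 : ar s5 aOrd k.-1 = (o k.-1)%:Z by rewrite (frame_a f) // (frame_a
    f4).
  have e2 : ar s5 aBit (o k.-1) = (b (o k.-1) : nat)%:Z.
    by rewrite (frame_a f) // (frame_a f4) // (u_bit U3).
  have e3 : ev s5 (EA aBit (EA aOrd (vj - num 1)%E)) = (b (o k.-1) : nat)%:Z.
    have ek : `|(k%:Z - 1)%R|%N = k.-1 by lia.
    by rewrite /= hk ek e1.
  rewrite -[LHS]/(rcons (so s5) (ev s5 (EA aBit (EA aOrd (vj - num 1)%E)))) e3
    h.
  have -> : iota 0 k.+1.-1 = iota 0 k.-1 ++ [:: k.-1] by rewrite -iotaS prednK
    //; lia.
  by rewrite map_cat catA cats1.
- move=> s5 _ _ h5; split=> //; exists Ms; first exact: M1.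
  by rewrite h5 h4 M2 /= -!catA.
- lia.
Qed.

(** * The whole program *)

Definition all_time : nat :=
  ((60 + 3 * q + 26 * X) + ((10 + (n + m) * (10 + 5 * n)) +
   ((10 + n * (10 + 4 * n)) + ((10 + n * (3 + ins_time)) +
   (50 + W * (30 + 11 * W) + m * (40 + 26 * W))))))%N.

Lemma all_ok (Row : nat -> seq int) w :
  (forall r, (r < n + m)%N -> row_enc n (Dm r) (Row r)) ->
  w = [:: n%:Z, m%:Z & flatten [seq Row r | r <- iota 0 (n + m)]] ->
  ok B (c_all q) (St (fun=> 0) (fun _ _ => 0) w [::]) all_time (fun s' =>
    exists (t o : nat -> nat) (R : nat -> nat -> int) (b : nat -> bool)
      (Md : nat -> nat -> int),
    [/\ good q W W t R o b,
      forall i, (i < m)%N -> (forall j, (j < W)%N -> (`|Md i j| < q)%N) /\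
        qval q W t (Md i) = \sum_(v < n) Dm (n + i) v * q%:Z ^+ t0 v &
      so s' = [:: W%:Z, m%:Z & flatten [seq enc_row W (R i) | i <- iota 0 W]
        ++ flatten [seq enc_row W (Md i) | i <- iota 0 m]]
        ++ [seq (o i)%:Z | i <- iota 0 W]
        ++ [seq (b (o i) : nat)%:Z | i <- iota 0 W.-1]]).
Proof.
move=> hRow hw; set s0 := St _ _ _ _.
apply: ok_calls (@tables_ok s0 _ hw) _ => s1 f1 [tb1 si1].
have z1 a i : a \in [:: aD; aOrd; aBit; aNode; aDone; aR] -> ar s1 a i = 0.
  by rewrite !inE => /or4P[|||/or3P[||]] /eqP ->; rewrite (frame_a f1).
have D1 i : ar s1 aD i = 0 by apply: z1.
apply: ok_calls (@read_ok s1 Row tb1 hRow si1 D1) _ => s2 f2 [hD hC].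
have tb2 : tabs s2 by apply: tabs_frame f2 _ _ tb1.
have O2 i : ar s2 aOrd i = 0 by rewrite (frame_a f2) // z1.
have b2' i : ar s2 aBit i = 0 by rewrite (frame_a f2) // z1.
apply: ok_calls (@base_ok s2 tb2 O2 b2') _ => s3 f3 [h1 h2 h3 h4].
have tb3 : tabs s3 by apply: tabs_frame f3 _ _ tb2.
have D3 r v : (r < n + m)%N -> (v < n)%N -> rowv s3 aD r v = Dm r v.
  by move=> rm vn; rewrite (rowv_frame _ _ f3) // hD.
have C3 r : (r < n + m)%N -> ar s3 aCnt r = (\sum_(v < n | Dm r v != 0) 1)%N%:Z.
  by move=> rm; rewrite (frame_a f3) // hC.
have N3 i : ar s3 aNode i = 0 by rewrite (frame_a f3) // (frame_a f2) // z1.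
have d3 i : ar s3 aDone i = 0 by rewrite (frame_a f3) // (frame_a f2) // z1.
have R3 k j : (k < n)%N -> (n <= j < W)%N -> rowv s3 aR k j = 0.
  move=> kn jW; rewrite h2 // (rowv_frame _ _ f2) //.
  by rewrite /rowv (frame_a f1).
have so3 : so s3 = [::].
  by rewrite (frame_o f3) // (frame_o f2) // (frame_o f1).
apply: (@ok_calls _ _ _ _ (10 + n * (3 + ins_time)) _ (fun s4 =>
    exists t o b nd, built s4 t o b nd)).
  (* The empty graph: the main loop runs zero times. *)
  have [n0|n0] := posnP n.
    apply: (ok_for (k := 0) (Tb := 0) (I := fun _ s5 =>
      forall a i, ar s5 a i = ar s3 a i)) => //.
    - by rewrite /= (tn tb3) n0.
    - move=> s4 f4 _ h; have W0 : W = 0%N by rewrite n0.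
      exists id, (fun=> 0%N), (fun=> false), (fun=> 0%N).
      split; rewrite ?W0 //.
      + by apply: tabs_frame f4 _ _ tb3.
      + move=> r v rm; by rewrite n0.
      + by split=> // i j; rewrite ltn0 andbF.
      + by split=> // i; rewrite h h3 n0.
      + by move=> v; rewrite n0.
      + by move=> v; rewrite n0.
      + by exists (fun=> 0%N).
  have J := @stage0 s3 n0 tb3 D3 C3 h1 R3 h3 h4 N3 d3.
  apply: ok_weaken (main_ok J) (leqnn _) _ => s4 _ [t [o [b [dn [nd J4]]]]].
  by exists t, o, b, nd; apply: built_of_inv J4.
move=> s4 f4 [t [o [b [nd U]]]].
have so4 : so s4 = [::] by rewrite (frame_o f4).
apply: ok_weaken (@out_ok s4 t o b nd U so4) (leqnn _) _.
move=> s5 _ [G [Md M1 M2]].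
by exists t, o, (rowv s4 aR), b, Md.
Qed.

End Verification.

(** * From graphs to rows and back *)

Section Digits.

Variable q : nat.
Hypothesis q2 : (2 <= q)%N.

Lemma zero_digit_proof : - q%:Z + 1 <= 0 <= q%:Z - 1.
Proof. lia. Qed.

Definition zero_digit : digit q := Sub (0 : int) zero_digit_proof.

Definition to_digit (x : int) : digit q := insubd zero_digit x.

Lemma to_digitK x : (`|x| < q)%N -> val (to_digit x) = x.
Proof. by move=> h; rewrite val_insubd ifT //; lia. Qed.

Lemma digit_lt (d : digit q) : (`|val d| < q)%N.
Proof. by have := valP d; lia. Qed.

End Digits.

Lemma enc_row_marking q k (M : marking q 'I_k) (d : nat -> int) :
  (forall v : 'I_k, val (M v) = d v) -> enc_marking M (enc_row k d).
Proof.
move=> e; exists [seq v <- enum 'I_k | d (nat_of_ord v) != 0]; split.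
- by apply: filter_uniq; apply: enum_uniq.
- by move=> v; rewrite mem_filter mem_enum andbT /supp inE e.
rewrite /enc_row -val_enum_ord filter_map size_map -map_comp.
by congr (_ :: flatten _); apply: eq_map => v /=; rewrite e.
Qed.

Lemma marking_row_enc q n (M : marking q 'I_n) (d : nat -> int) w :
  (forall v : 'I_n, val (M v) = d v) -> enc_marking M w -> row_enc n d w.
Proof.
move=> e [s [us se ->]]; exists [seq nat_of_ord v | v <- s]; split.
- by rewrite map_inj_uniq //; apply: ord_inj.
- move=> v; apply/mapP/andP => [[u]|[vn dv]].
    by rewrite se /supp inE e => h ->.
  by exists (Ordinal vn) => //; rewrite se /supp inE e.
rewrite size_map -map_comp; congr (_ :: flatten _).
by apply: eq_map => v /=; rewrite e.
Qed.

(** The number of nodes reachable from [u] decreases along edges: [u] is reachable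
    from itself, but not from its successors. *)
Lemma acyclic_rank (T : finType) (e : rel T) :
  (forall c : seq T, cycle e c -> c = [::]) ->
  forall u v, e u v -> (#|connect e v| < #|connect e u|)%N.
Proof.
move=> ac u v uv; apply: proper_card; apply/properP; split.
  apply/subsetP => x; rewrite !inE; apply: connect_trans; exact: connect1.
exists u; first by rewrite inE.
rewrite inE; apply/negP => /connectP[p vp up].
by have := ac (v :: p); rewrite /= rcons_path vp -up uv => /(_ isT).
Qed.

Section Reals.

Variables (R : realType) (q : nat).
Hypothesis q2 : (2 <= q)%N.

Lemma mval_int (V : finType) (f : V -> R) (t : V -> nat) (M : marking q V) :
  (forall u, supp M u -> f u = q%:R ^+ t u) ->
  mval f M = (\sum_u val (M u) * q%:Z ^+ t u)%:~R.
Proof.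
move=> h; rewrite /mval big_mkcond rmorph_sum; apply: eq_bigr => u _ /=.
case: ifP => [su|]; first by rewrite h // rmorphM rmorphXn.
by rewrite /supp /= => /negbT; rewrite negbK => /eqP ->; rewrite mul0r.
Qed.

Lemma powR_exp k : (q%:R : R) `^ k%:R = q%:R ^+ k.
Proof. by rewrite powR_mulrn. Qed.

Lemma expq_inj k l : (q%:R : R) ^+ k = q%:R ^+ l -> k = l.
Proof.
by rewrite -!natrX => /eqP; rewrite eqr_nat => /eqP; apply: expnI.
Qed.

Lemma expq_lt k l : ((q%:R : R) ^+ k < q%:R ^+ l) = (k < l)%N.
Proof. by rewrite -!natrX ltr_nat ltn_exp2l. Qed.

End Reals.

Section Assembly.

Variable q : nat.
Hypothesis q2 : (2 <= q)%N.

(** By induction on the number of nodes reachable from [u]: if the successors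
    are worth integer powers of [q], the exponent of [u] is an integer, and it
    is nonnegative by hypothesis. *)
Lemma exponents_exist (R : realType) n (P : pgraph q 'I_n) : power_circuit R P
  ->
  exists t : 'I_n -> nat, forall u, eps R P (succ_marking P u) = (t u)%:R /\
    eps_node R P u = q%:R ^+ t u.
Proof.
move=> pc.
have E u : exists k : nat, eps R P (succ_marking P u) == k%:R.
  have [k hk] := ubnP #|connect [rel u v | val (delta P u v) != 0] u|.
  elim: k => // k IH in u hk *.
  have : eps R P (succ_marking P u) \is a Num.nat.
    rewrite natrEint pc andbT; apply: rpred_sum => v; rewrite /supp /= => uv.
    have vu := acyclic_rank (@delta_acyclic _ _ P) (u := u) (v := v) uv.
    have [l /eqP hl] := IH v (leq_trans vu hk).
    by rewrite eps_nodeE hl powR_exp rpredM ?rpredX ?intr_int ?natr_int.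
  by move/natrP => [l ->]; exists l.
exists (fun u => ex_minn (E u)) => u; case: ex_minnP => k /eqP hk _.
by rewrite eps_nodeE hk powR_exp.
Qed.

Variables (R : realType) (n m : nat) (P : pgraph q 'I_n)
  (Ms : 'I_m -> marking q 'I_n).

(** Rows [0, ..., n - 1] are the successor markings, the next [m] the given
    markings. *)
Definition rows (r v : nat) : int :=
  if insub v is Some v' then
    if insub r is Some u then val (delta P u v')
    else if insub (r - n)%N is Some i then val (Ms i v') else 0
  else 0.

Lemma rows_node (u v : 'I_n) : rows u v = val (delta P u v).
Proof. by rewrite /rows !valK. Qed.

Lemma rows_marking (i : 'I_m) (v : 'I_n) : rows (n + i) v = val (Ms i v).
Proof. by rewrite /rows valK insubN ?addKn ?valK // -leqNgt leq_addr. Qed.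

Lemma rows_lt r v : (`|rows r v| < q)%N.
Proof.
have q0 : (`|0%Z| < q)%N by rewrite absz0; lia.
rewrite /rows; case: (insub v) => [v'|//].
case: (insub r) => [u|]; first exact: digit_lt.
by case: (insub _) => [i|//]; apply: digit_lt.
Qed.

Lemma input_rows w : enc_circuit P Ms w -> exists Row : nat -> seq int,
  (forall r, (r < n + m)%N -> row_enc n (rows r) (Row r)) /\
  w = [:: n%:Z, m%:Z & flatten [seq Row r | r <- iota 0 (n + m)]].
Proof.
move=> [W0 [Z0 [hW hZ ->]]].
pose Row r := if insub r is Some u then W0 u
  else if insub (r - n)%N is Some i then Z0 i else [::].
exists Row; split.
  move=> r rm; have [rn|nr] := ltnP r n.
    have -> : Row r = W0 (Ordinal rn) by rewrite /Row insubT.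
    by apply: marking_row_enc (hW _) => v; rewrite -rows_node.
  have rm' : (r - n < m)%N by lia.
  have -> : Row r = Z0 (Ordinal rm') by rewrite /Row insubN ?insubT // -leqNgt.
  apply: marking_row_enc (hZ _) => v.
  by rewrite -rows_marking /= subnKC.
congr [:: _, _ & _]; rewrite iotaD map_cat flatten_cat add0n; congr (_ ++ _).
  rewrite -val_enum_ord -map_comp; congr flatten; apply: eq_map => u /=.
  by rewrite /Row valK.
rewrite -[n in iota n]addn0 iotaDl -val_enum_ord -!map_comp; congr flatten.
apply: eq_map => i /=.
by rewrite /Row insubN ?addKn ?valK // -leqNgt leq_addr.
Qed.

End Assembly.

Section Output.

Variables (R : realType) (q W : nat).
Hypothesis q2 : (2 <= q)%N.
Variables (t o : nat -> nat) (D : nat -> nat -> int) (b : nat -> bool).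
Hypothesis G : good q W W t D o b.

Definition out_delta (u v : 'I_W) : digit q := to_digit q2 (D u v).

Lemma out_deltaE u v : val (out_delta u v) = D u v.
Proof. by rewrite to_digitK // (g_dig G). Qed.

(** Along a walk the indices decrease. *)
Lemma out_acyclic (c : seq 'I_W) :
  cycle [rel u v | val (out_delta u v) != 0] c -> c = [::].
Proof.
case: c => // x p /= h.
have : path (fun u v : 'I_W => (v < u)%N) x (rcons p x).
  apply: sub_path h => u v /=; rewrite out_deltaE; exact: (g_low G).
rewrite path_sortedE; last by move=> u v y h1 h2; apply: ltn_trans h1.
by rewrite all_rcons ltnn.
Qed.

Definition out_graph : pgraph q 'I_W := PGraph out_acyclic.

(** By induction on the index, since labels sit at smaller indices only. *)
Lemma out_eps_node u : eps_node R out_graph u = q%:R ^+ t u.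
Proof.
case: u => u; elim/ltn_ind: u => u IH uW; rewrite eps_nodeE /eps.
rewrite (mval_int (t := fun v => t (nat_of_ord v))).
  under eq_bigr do rewrite /succ_marking /= out_deltaE.
  by rewrite -[\sum_(_ < _) _]/(qval q W t (D u)) (g_val G) // powR_exp.
move=> v; rewrite /supp /succ_marking /= out_deltaE =>
  /(g_low G uW (ltn_ord v)) vu.
by case: v vu => v vW /= vu; apply: IH.
Qed.

Lemma out_eps (M : marking q 'I_W) (d : nat -> int) :
  (forall v, val (M v) = d (nat_of_ord v)) ->
  eps R out_graph M = (qval q W t d)%:~R.
Proof.
move=> e; rewrite /eps (mval_int (t := fun v => t (nat_of_ord v))) => [|v _].
  by congr (_ %:~R); apply: eq_bigr => v _; rewrite e.
exact: out_eps_node.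
Qed.

Let ho (i : 'I_W) : (o i < W)%N := g_o G (ltn_ord i).

Definition out_order : seq 'I_W := [seq Ordinal (ho i) | i <- enum 'I_W].

Definition out_bits : bitseq := [seq b (o i) | i <- iota 0 W.-1].

Lemma out_orderE : [seq nat_of_ord u | u <- out_order] = [seq o i | i <- iota 0
  W].
Proof. by rewrite /out_order -val_enum_ord -!map_comp. Qed.

(** The powers of [q] are ordered as their exponents, so this is [good]
    rephrased.  The bit at position [i] is that of the node [o i]. *)
Lemma out_reduced : reduced R out_graph out_order out_bits.
Proof.
have hinj : injective (fun i : 'I_W => Ordinal (ho i)).
  move=> i j /(congr1 val) /= /(good_oinj G (ltn_ord i) (ltn_ord j)) e.
  exact: val_inj.
split.
- move=> u; have [k hk] : exists k : nat, eps R out_graph (succ_marking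
    out_graph u) = k%:R.
    exists (t u); rewrite (@out_eps _ (D u)) => [|v]; last exact: out_deltaE.
    by rewrite (g_val G).
  by rewrite hk.
- apply: uniq_perm => [||u]; [|exact: enum_uniq|].
    by rewrite map_inj_uniq ?enum_uniq.
  rewrite mem_enum; apply/mapP; have [i iW e] := g_onto G (ltn_ord u).
  by exists (Ordinal iW); rewrite ?mem_enum //; apply: val_inj.
- move=> u v; rewrite !out_eps_node => /(expq_inj q2).
  by move=> /(good_inj G (ltn_ord u) (ltn_ord v)) /val_inj.
- rewrite sorted_map; apply: (@sub_sorted _ (relpre val ltn)).
    move=> i j /= ij; rewrite !out_eps_node expq_lt //=.
    by apply: (g_inc G); rewrite ij ltn_ord.
  by rewrite -sorted_map val_enum_ord; apply: iota_ltn_sorted.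
have so : size out_order = W by rewrite size_map size_enum_ord.
split; first by rewrite size_map size_iota so.
move=> u0 i; rewrite so => iW.
have nu j : (j < W)%N -> nat_of_ord (nth u0 out_order j) = o j.
  move=> jW; rewrite -(nth_map u0 (nat_of_ord u0)) ?so // out_orderE.
  by rewrite (nth_map 0%N) ?size_iota // nth_iota.
rewrite !out_eps_node !nu //; last by apply: ltnW.
rewrite (nth_map 0%N) ?size_iota; last by lia.
rewrite nth_iota; last by lia.
rewrite add0n (good_bit_next q2 G) // -exprS; split=> [/eqP -> //|].
by move/(expq_inj q2) => ->.
Qed.

End Output.

(** * Time and space bounds *)

(** The logarithm of a polynomially bounded number is at most a constant times
    the logarithm, whence values quadratic in [g] cost no more than [g]. *)
Lemma blen_le K g B : (0 < g)%N -> (B <= K * g ^ 2)%N ->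
  (blen B <= (K + 3) * blen g)%N.
Proof.
move=> g0 hB; rewrite /blen.
have hg : (g < 2 ^ (trunc_log 2 g).+1)%N by apply: trunc_log_ltn.
have hK : (K < 2 ^ K)%N by apply: ltn_expl.
suff: (trunc_log 2 B < K + 2 * (trunc_log 2 g).+1)%N by nia.
have [->|B0] := posnP B; first by rewrite trunc_log0; lia.
rewrite -(ltn_exp2l (m := 2)) //.
apply: leq_ltn_trans (trunc_logP _ B0) _ => //.
apply: leq_ltn_trans hB _; rewrite [(2 * _)%N]mulnC expnD expnM.
by apply: ltn_mul => //; rewrite ltn_exp2r.
Qed.

Definition bound_B (q n m : nat) : nat :=
  ((table_size q n m).+1 * (n + n) + (table_size q n m + table_size q n m + 4 *
    q + 4))%N.

Lemma params_bound q n m : (2 <= q)%N -> params q n m (bound_B q n m).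
Proof. by move=> q2; split=> //; rewrite /bound_B; lia. Qed.

(** Products of [n], [m] and the logarithm [L] of degree two at most are compared
    with [g * L] one by one; [q] is a constant. *)
Lemma time_bound q n m (g := (maxn 1 n ^ 2 + maxn 1 n * m)%N) :
  (all_time q n m <= (100 * q + 1500) * (g * (trunc_log 2 (table_size q n
    m)).+1))%N.
Proof.
rewrite /all_time /ins_time.
have : (0 < (trunc_log 2 (table_size q n m)).+1)%N by [].
move: (trunc_log 2 _).+1 => L L0.
have e1 : (1 <= g)%N by rewrite /g; nia.
have e2 : (n <= g)%N by rewrite /g; nia.
have e3 : (m <= g)%N by rewrite /g; nia.
have e4 : (n * n <= g)%N by rewrite /g; nia.
have e5 : (n * m <= g)%N by rewrite /g; nia.
move: g e1 e2 e3 e4 e5 => g e1 e2 e3 e4 e5.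
have gL : (g <= g * L)%N by nia.
have gq : (q * n <= q * g)%N by rewrite leq_mul2l e2 orbT.
have qgL : (q * g <= q * (g * L))%N by rewrite leq_mul2l gL orbT.
have qL : (q <= q * (g * L))%N by nia.
have nnL : (n * n * L <= g * L)%N by rewrite leq_mul2r e4 orbT.
have nL : (n * L <= g * L)%N by rewrite leq_mul2r e2 orbT.
rewrite /table_size.
have -> : (n * (3 + (500 + 100 * (n + n) + L * (12 + 10 * (n + n)))) =
  503 * n + 200 * (n * n) + 12 * (n * L) + 20 * (n * n * L))%N by ring.
have -> : ((n + m) * (10 + 5 * n) = 10 * n + 10 * m + 5 * (n * n) + 5 * (n *
  m))%N by ring.
have -> : ((n + n) * (30 + 11 * (n + n)) = 60 * n + 44 * (n * n))%N by ring.
have -> : (m * (40 + 26 * (n + n)) = 40 * m + 52 * (n * m))%N by ring.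
have -> : (n * (10 + 4 * n) = 10 * n + 4 * (n * n))%N by ring.
have -> : (q * (n + n) = 2 * (q * n))%N by ring.
rewrite mulnDl -!mulnA; lia.
Qed.

Lemma size_poly_bound q n m (g := (maxn 1 n ^ 2 + maxn 1 n * m)%N) :
  (table_size q n m <= (2 * q + 3) * g ^ 2)%N /\
  (bound_B q n m <= (20 * q + 40) * g ^ 2)%N.
Proof.
have e1 : (1 <= g)%N by rewrite /g; nia.
have e2 : (n <= g)%N by rewrite /g; nia.
have e3 : (m <= g)%N by rewrite /g; nia.
move: g e1 e2 e3 => g e1 e2 e3.
have hX : (table_size q n m <= (2 * q + 3) * g)%N by rewrite /table_size; nia.
have gg : (g <= g ^ 2)%N by nia.
split; first by apply: leq_trans hX _; rewrite leq_mul2l gg orbT.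
rewrite /bound_B; move: (table_size q n m) hX => X hX.
have h1 : (X.+1 * (n + n) <= ((2 * q + 4) * g) * (2 * g))%N.
  by apply: leq_mul; lia.
have h2 : (((2 * q + 4) * g) * (2 * g) = (4 * q + 8) * g ^ 2)%N by ring.
rewrite h2 in h1; have qgg : (q * g <= q * g ^ 2)%N by rewrite leq_mul2l gg
  orbT.
have qg : (q <= q * g ^ 2)%N by nia.
lia.
Qed.

Theorem theorem2p14 (q : nat) (hq : (2 <= q)%N) :
  exists (p : program) (c k : nat),
  forall (R : realType) (n m : nat) (P : pgraph q 'I_n)
    (Ms : 'I_m -> marking q 'I_n) (w : seq int),
  power_circuit R P -> enc_circuit P Ms w ->
  exists (n' : nat) (P' : pgraph q 'I_n') (us : seq 'I_n') (b : bitseq)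
    (Ms' : 'I_m -> marking q 'I_n') (t : nat) (o : seq int),
  [/\ outputs p w t o /\ enc_reduced P' us b Ms' o,
      reduced R P' us b,
      forall i : 'I_m, eps R P (Ms i) = eps R P' (Ms' i),
      (* the maximum only matters for the empty graph *)
      (t <= soft c k (maxn 1 n ^ 2 + maxn 1 n * m))%N &
      (n' <= 2 * n)%N].
Proof.
have [p [C hC]] := compile_correct (c_all q).
(* One logarithm for the rounds of the search, one for the cost of a step. *)
exists p, (C * ((100 * q + 1500) * (2 * q + 6)) * (20 * q + 43) + 1)%N, 2%N.
move=> R n m P Ms w pc enc.
have [t0 ht] := exponents_exist pc.
have [Row [hRow hw]] := input_rows hq enc.
pose D := rows P Ms.
pose t1 v := if insub v is Some v' then t0 v' else 0%N.
pose rk v := if insub v is Some v' then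
  #|connect [rel u v | val (delta P u v) != 0] v'| else 0%N.
have t1E (v : 'I_n) : t1 v = t0 v by rewrite /t1 valK.
have Dq r v : (r < n + m)%N -> (v < n)%N -> (`|D r v| < q)%N.
  by move=> _ _; apply: rows_lt.
have mvalE (M : marking q 'I_n) :
    eps R P M = (\sum_(v < n) val (M v) * q%:Z ^+ t1 v)%:~R.
  by apply: mval_int => v _; have [_ ->] := ht v; rewrite t1E.
have Dt u : (u < n)%N -> (t1 u)%:Z = \sum_(v < n) D u v * q%:Z ^+ t1 v.
  move=> un; apply: (@intr_inj R); have [h _] := ht (Ordinal un).
  rewrite mvalE in h; rewrite (t1E (Ordinal un)) -pmulrn -h.
  congr (_ %:~R); apply: eq_bigr => v _.
  by rewrite /D (rows_node P Ms (Ordinal un)).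
have Drk u v : (u < n)%N -> (v < n)%N -> D u v != 0 -> (rk v < rk u)%N.
  move=> un vn; rewrite /D (rows_node P Ms (Ordinal un) (Ordinal vn)) => d.
  rewrite /rk !insubT; apply: acyclic_rank d; exact: delta_acyclic.
have H := params_bound n m hq.
have [s [s' [hrun hs [t [o [D' [b [Md [G hM hso]]]]]]]]] :=
  all_ok H Dq Dt Drk hRow hw.
have B1 : (1 <= bound_B q n m)%N by rewrite /bound_B; lia.
have [k hout hk] := hC _ _ _ _ B1 hrun.
pose Ms' (i : 'I_m) : marking q 'I_(n + n) := fun v => to_digit hq (Md i v).
have Ms'E i v : val (Ms' i v) = Md i v.
  by rewrite to_digitK //; have [h _] := hM i (ltn_ord i); apply: h.
exists (n + n)%N, (out_graph hq G), (out_order G), (out_bits (n + n) o b), Ms',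
  k, (so s').
split.
- split=> //; exists [:: (n + n)%N%:Z, m%:Z &
    flatten [seq enc_row (n + n) (D' u) | u : 'I_(n + n) <- enum 'I_(n + n)] ++
    flatten [seq enc_row (n + n) (Md i) | i : 'I_m <- enum 'I_m]].
    exists (fun u : 'I_(n + n) => enc_row (n + n) (D' u)),
      (fun i : 'I_m => enc_row (n + n) (Md i)); split=> // [u|i].
      by apply: enc_row_marking => v; exact: (out_deltaE hq G).
    by apply: enc_row_marking => v; apply: Ms'E.
  rewrite hso; congr ([:: _, _ & flatten _ ++ flatten _] ++ (_ ++ _)).
  + by rewrite -[in LHS]val_enum_ord -map_comp.
  + by rewrite -[in LHS]val_enum_ord -map_comp.
  + by rewrite (map_comp Posz o) -(out_orderE G) -map_comp.
  + by rewrite /out_bits -map_comp.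
- exact: out_reduced.
- move=> i; rewrite (out_eps _ hq G (Ms'E i)).
  have [_ ->] := hM i (ltn_ord i); rewrite mvalE; congr (_ %:~R).
  by apply: eq_bigr => v _; rewrite /D rows_marking.
- pose g := (maxn 1 n ^ 2 + maxn 1 n * m)%N; rewrite -/g.
  have g0 : (0 < g)%N by rewrite /g; nia.
  have [hX hB] := size_poly_bound q n m; rewrite -/g in hX hB.
  have l1 := blen_le g0 hX; have l2 := blen_le g0 hB.
  have hT := leq_trans hs (time_bound q n m); rewrite -/g in hT.
  rewrite /soft; rewrite -/(blen (table_size q n m)) in hT; rewrite -/(blen g).
  have L0 : (0 < blen g)%N by apply: ltn0Sn.
  move: (blen g) (blen (table_size q n m)) (blen (bound_B q n m)) l1 l2 hT hk
    L0 => L Lx Lb l1 l2 hT hk L0.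
  have e1 : (C * s <= C * ((100 * q + 1500) * (g * ((2 * q + 3 + 3) * L))))%N.
    rewrite leq_mul2l; apply/orP; right; apply: leq_trans hT _.
    by rewrite !leq_mul2l l1 !orbT.
  have e2 := leq_mul e1 l2.
  have e3 : (0 < g * L ^ 2)%N by rewrite muln_gt0 g0 expn_gt0 L0.
  apply: leq_trans hk _; apply: (leq_trans (n := (C * ((100 * q + 1500) *
    (g * ((2 * q + 3 + 3) * L))) * ((20 * q + 40 + 3) * L) + g * L ^ 2))%N).
    by move: e2 e3; move: (_ * Lb)%N (g * _)%N => x y; lia.
  by apply: eq_leq; ring.
- by rewrite mul2n addnn.
Qed.
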